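(* Let $(\Phi_H,H,h)$ be a topological contact dynamical system on $(M,\alpha)$. Then there exists a continuous contact dynamical system $(\Phi_F,F,f)$ with the same time-one map $\phi_F^1=\phi_H^1$. Given $\epsilon>0$, the continuous contact dynamical system $(\Phi_F,F,f)$ can be chosen so that either (whichever of the two is desired) $$\overline d(\Phi_F,\Phi_H)<\epsilon,\quad |f-h|<\epsilon,\quad \|F-H\|_{(1,\infty)}<\epsilon,$$ or $$\overline d(\Phi_F,\mathrm{id})<\overline d(\Phi_H,\mathrm{id})+\epsilon,\quad |f|<|h|+\epsilon,\quad \|F\|_\infty<\|H\|_{(1,\infty)}+\epsilon .$$ In fact, $(\Phi_F,F,f)$ is smooth everywhere except possibly at time one, i.e. the maps $(t,x)\mapsto\phi_F^t(x)$, $(t,x)\mapsto(\phi_F^t)^{-1}(x)$, $(t,x)\mapsto F_t(x)$, and $(t,x)\mapsto f_t(x)$ are smooth except possibly at $t=1$.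
   Context: Setting. $M$ is a closed (compact, without boundary), connected smooth manifold of dimension $2n+1$ with a cooriented contact structure $\xi=\ker\alpha$, where $\alpha$ is a fixed contact form, and $\nu_\alpha=\alpha\wedge(d\alpha)^n$ is the induced volume form. $\mathrm{Diff}(M,\xi)$ is the group of diffeomorphisms $\phi$ with $\phi^*\alpha=e^{g}\alpha$ for a smooth function $g$ on $M$ (the conformal factor of $\phi$). A smooth contact isotopy is a smooth isotopy $\Phi=\{\phi_t\}_{0\le t\le1}$ in $\mathrm{Diff}(M,\xi)$ with $\phi_0=\mathrm{id}$; if $\frac{d}{dt}\phi_t=X_t\circ\phi_t$, its Hamiltonian is $H_t=\alpha(X_t)$. This is a bijection between smooth contact isotopies and smooth functions $H\colon[0,1]\times M\to\mathbb R$; one writes $\Phi=\Phi_H=\{\phi_H^t\}$. Its conformal factor is the function $h\colon[0,1]\times M\to\mathbb R$ with $(\phi_H^t)^*\alpha=e^{h_t}\alpha$, and $(\Phi_H,H,h)$ is called a smooth contact dynamical system. Norms. For a function $H$ on $M$, $\|H\|=\max_M H-\min_M H+\left|\frac{1}{\int_M\nu_\alpha}\int_M H\,\nu_\alpha\right|$. For $H\colon[0,1]\times M\to\mathbb R$, $\|H\|_{(1,\infty)}=\int_0^1\|H_t\|\,dt$ and $\|H\|_\infty=\max_{0\le t\le1}\|H_t\|$. For conformal factors, $|h|=\max_{t,x}|h(t,x)|$. $C^0$-metric. Fix a Riemannian metric on $M$ with distance $d$. For homeomorphisms, $d(\phi,\psi)=\max_x d(\phi(x),\psi(x))$ and $\overline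 d(\phi,\psi)=d(\phi,\psi)+d(\phi^{-1},\psi^{-1})$; for isotopies, $\overline d(\Phi,\Psi)=\max_t\overline d(\phi_t,\psi_t)$. $\mathrm{id}$ also denotes the constant isotopy at the identity. Topological and continuous systems. A triple $(\Phi,H,h)$ of a continuous isotopy of homeomorphisms $\Phi$ and functions $H,h\colon[0,1]\times M\to\mathbb R$ is a topological contact dynamical system if there are smooth contact dynamical systems $(\Phi_{H_i},H_i,h_i)$ with $\Phi_{H_i}\to\Phi$ uniformly, $h_i\to h$ uniformly, and $\|H-H_i\|_{(1,\infty)}\to0$ ($H$ being an element of $L^1([0,1],C^0(M))$). It is a continuous contact dynamical system if there is such a sequence with $\|H-H_i\|_\infty\to0$ instead. By a known uniqueness theorem $\Phi$ and $h$ are determined by $H$, and one writes $\Phi=\Phi_H=\{\phi_H^t\}$. *)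

(* Defs.v *)
From HB Require Import structures.
From mathcomp Require Import all_boot all_order all_algebra all_fingroup.
From mathcomp Require Import all_classical all_reals all_analysis.

Set Implicit Arguments.
Unset Strict Implicit.
Unset Printing Implicit Defensive.

Import Order.TTheory GRing.Theory Num.Theory.
Import numFieldNormedType.Exports.

Local Open Scope classical_set_scope.
Local Open Scope ring_scope.

(* [Ck_on k U f]: f is of class C^k on the open set U.  Only the values of f on
   U matter.  The spaces V used below are finite-dimensional, so asking for all
   directional derivatives to be C^k is the usual definition. *)
Fixpoint Ck_on (R : realType) (V W : normedModType R) (k : nat)
    (U : set V) (f : V -> W) : Prop :=
  match k with
  | 0%N => forall x, U x -> {for x, continuous f}
  | k'.+1 => (forall x, U x -> differentiable f x) /\
             (forall v, Ck_on k' U (fun x => 'D_v f x))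
  end.

Definition smooth_on (R : realType) (V W : normedModType R)
    (U : set V) (f : V -> W) : Prop := forall k, Ck_on k U f.

(* Smoothness on a subset that need not be open (here: [0,1] x U, [0,1[ x U):
   near each point of the subset, f is the restriction of a smooth function
   defined on a neighbourhood in the ambient space. *)
Definition smooth_in (R : realType) (V W : normedModType R)
    (S : set V) (f : V -> W) : Prop :=
  forall x, S x -> exists (U : set V) (g : V -> W),
    [/\ open U, U x, smooth_on U g & forall y, S y -> U y -> f y = g y].

(* A smooth structure on M without boundary: the charts [coord c] map the open
   sets [dom c] homeomorphically onto open subsets of R^m, with inverse
   [param c]; [coord c] and [param c] are irrelevant elsewhere. *)
Record atlas (R : realType) (m : nat) (M : topologicalType) := Atlas {
  chart : Type;
  dom : chart -> set M;
  coord : chart -> M -> 'rV[R]_m;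
  param : chart -> 'rV[R]_m -> M;
  img : chart -> set 'rV[R]_m := fun c => coord c @` dom c;
  dom_open : forall c, open (dom c);
  img_open : forall c, open (img c);
  coordK : forall c x, dom c x -> param c (coord c x) = x;
  coord_continuous : forall c x, dom c x -> {for x, continuous (coord c)};
  param_continuous : forall c u, img c u -> {for u, continuous (param c)};
  dom_cover : forall x, exists c, dom c x;
  transition_smooth : forall c c',
    smooth_on (coord c @` (dom c `&` dom c')) (coord c' \o param c)
}.

Definition pairing (R : realType) (m : nat) (a v : 'rV[R]_m) : R :=
  \sum_(k < m) a 0 k * v 0 k.

(* A smooth differential 1-form: in the chart c it is
   \sum_k (form_coef c u) 0 k du_k, and the local expressions are related by
   pullback along the changes of charts. *)
Record one_form (R : realType) (m : nat) (M : topologicalType)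
    (A : atlas R m M) := OneForm {
  form_coef : chart A -> 'rV[R]_m -> 'rV[R]_m;
  form_smooth : forall c, smooth_on (img c) (form_coef c);
  form_compat : forall c c' u v, (coord c @` (dom c `&` dom c')) u ->
    pairing (form_coef c u) v =
    pairing (form_coef c' (coord c' (param c u)))
            ('D_v (coord c' \o param c) u)
}.

Definition qform (R : realType) (m : nat) (G : 'M[R]_m) (v w : 'rV[R]_m) : R :=
  (v *m G *m w^T) 0 0.

Record riemannian (R : realType) (m : nat) (M : topologicalType)
    (A : atlas R m M) := Riemannian {
  metric_coef : chart A -> 'rV[R]_m -> 'M[R]_m;
  metric_smooth : forall c, smooth_on (img c) (metric_coef c);
  metric_sym : forall c u, img c u -> (metric_coef c u)^T = metric_coef c u;
  metric_pos : forall c u v, img c u -> v != 0 ->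
    0 < qform (metric_coef c u) v v;
  metric_compat : forall c c' u v w, (coord c @` (dom c `&` dom c')) u ->
    qform (metric_coef c u) v w =
    qform (metric_coef c' (coord c' (param c u)))
          ('D_v (coord c' \o param c) u) ('D_w (coord c' \o param c) u)
}.

Section RiemannianDistance.
Variables (R : realType) (m : nat) (M : topologicalType) (A : atlas R m M).
Variable g : riemannian A.

Definition smooth_curve (gam : R -> M) : Prop :=
  {within `[0, 1], continuous gam} /\
  forall c : chart A, smooth_in [set t : R | t \in `[0, 1] /\ dom c (gam t)]
                                (coord c \o gam).

Definition curve_length (gam : R -> M) (L : R) : Prop :=
  exists s : R -> R,
    (forall (t : R) (c : chart A), t \in `]0, 1[ -> dom c (gam t) ->
       s t = Num.sqrt (qform (metric_coef g c (coord c (gam t)))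
                             (derive1 (coord c \o gam) t)
                             (derive1 (coord c \o gam) t))) /\
    L = \int[lebesgue_measure]_(t in `]0, 1[) s t.

(* L is the length of a piecewise smooth curve from x to y *)
Inductive path_length : M -> M -> R -> Prop :=
| PathSmooth gam L : smooth_curve gam -> curve_length gam L ->
    path_length (gam 0) (gam 1) L
| PathConcat x y z L L' : path_length x y L -> path_length y z L' ->
    path_length x z (L + L').

Definition riem_dist (x y : M) : R := inf [set L | path_length x y L].

End RiemannianDistance.

(* (d alpha)_u (e_p, e_q) = d_p alpha_q - d_q alpha_p *)
Definition ext_deriv (R : realType) (m : nat) (a : 'rV[R]_m -> 'rV[R]_m)
    (u : 'rV[R]_m) (p q : 'I_m) : R :=
  'D_(delta_mx 0 p : 'rV[R]_m) (fun w => a w 0 q) u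
  - 'D_(delta_mx 0 q : 'rV[R]_m) (fun w => a w 0 p) u.

(* (alpha /\ (d alpha)^n)_u (e_0, ..., e_2n), from the formula
   (w_1 /\ ... /\ w_r)(v_1, ..., v_m) =
     (k_1! ... k_r!)^-1 \sum_s sgn(s) (w_1 (x) ... (x) w_r)(v_s1, ..., v_sm)
   for forms w_i of degree k_i with k_1 + ... + k_r = m. *)
Definition volume_coef (R : realType) (n : nat)
    (a : 'rV[R]_(n.*2.+1) -> 'rV[R]_(n.*2.+1)) (u : 'rV[R]_(n.*2.+1)) : R :=
  (2 ^+ n)^-1 * \sum_(s : 'S_(n.*2.+1))
    (-1) ^+ s * a u 0 (s ord0) *
    \prod_(k < n) ext_deriv a u (s (inord k.*2.+1)) (s (inord k.*2.+2)).

Definition contact_form (R : realType) (n : nat) (M : topologicalType)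
    (A : atlas R n.*2.+1 M) (alpha : one_form A) : Prop :=
  forall (c : chart A) u, img c u -> volume_coef (form_coef alpha c) u != 0.

(* Lebesgue integral over R^m of a nonnegative Borel function, as an iterated
   integral. *)
Fixpoint iterated_integral (R : realType) (m : nat) :
    ('rV[R]_m -> \bar R) -> \bar R :=
  match m with
  | 0%N => fun f => f 0
  | m'.+1 => fun f =>
      (\int[lebesgue_measure]_(x in [set: R])
         iterated_integral (fun v : 'rV[R]_m' => f (row_mx (x%:M : 'rV_1) v)))%E
  end.

Notation borel M := (g_sigma_algebraType (@open M)).

(* mu is the Borel measure given by the volume form alpha /\ (d alpha)^n, M
   being oriented by this form; the absolute value accounts for the charts
   that reverse this orientation. These equations determine mu. *)
Definition volume_measure (R : realType) (n : nat) (M : ptopologicalType)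
    (A : atlas R n.*2.+1 M) (alpha : one_form A)
    (mu : {measure set (borel M) -> \bar R}) : Prop :=
  forall (c : chart A) (B : set (borel M)), measurable B -> B `<=` dom c ->
    mu B = iterated_integral (fun u =>
      (\1_(coord c @` B) u * `| volume_coef (form_coef alpha c) u |)%:E).

Section Norms.
Variables (R : realType) (M : ptopologicalType).
Variable mu : {measure set (borel M) -> \bar R}.

(* meaningful for continuous f on a compact space: sup and inf are then max and
   min *)
Definition osc_norm (f : M -> R) : R :=
  sup (range f) - inf (range f)
  + `| (fine (mu setT))^-1 * \int[mu]_x f x |.

Definition norm_1oo (H : R -> M -> R) : \bar R :=
  (\int[lebesgue_measure]_(t in `[0%R, 1%R]) (osc_norm (H t))%:E)%E.

Definition norm_oo (H : R -> M -> R) : R :=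
  sup [set osc_norm (H t) | t in `[0, 1]].

Definition sup_norm (h : R -> M -> R) : R :=
  sup [set `| h p.1 p.2 | | p in `[0, 1] `*` [set: M]].

(* H represents an element of L^1([0,1], C^0(M)): for a.e. t the function H_t is
   continuous, and t |-> H_t is measurable (C^0(M) being separable, this can be
   tested on evaluations) and integrable in norm. *)
Definition L1C0 (H : R -> M -> R) : Prop :=
  [/\ {ae lebesgue_measure, forall t : R, t \in `[0, 1] -> continuous (H t)},
      forall x, measurable_fun (`[0, 1] : set R) (fun t => H t x)
    & (norm_1oo H < +oo)%E].

End Norms.

(* Time-dependent objects are indexed by t : R; only t in [0,1] matters. *)
Record isotopy (R : realType) (M : Type) := Isotopy {
  fwd : R -> M -> M;
  bwd : R -> M -> M
}.

Definition id_isotopy (R : realType) (M : Type) : isotopy R M :=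
  Isotopy (fun _ x => x) (fun _ x => x).

Section Isotopies.
Variables (R : realType) (m : nat) (M : topologicalType) (A : atlas R m M).

Definition isotopy_inverse (Phi : isotopy R M) : Prop :=
  forall t : R, t \in `[0, 1] ->
    cancel (fwd Phi t) (bwd Phi t) /\ cancel (bwd Phi t) (fwd Phi t).

Definition continuous_isotopy (Phi : isotopy R M) : Prop :=
  [/\ isotopy_inverse Phi,
      {within `[0, 1] `*` [set: M],
        continuous (fun p : R * M => fwd Phi p.1 p.2)}
    & {within `[0, 1] `*` [set: M],
        continuous (fun p : R * M => bwd Phi p.1 p.2)}].

(* smoothness of (t, x) |-> phi t x on T x M *)
Definition smooth_family (T : set R) (phi : R -> M -> M) : Prop :=
  {within T `*` [set: M], continuous (fun p : R * M => phi p.1 p.2)} /\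
  forall c c' : chart A,
    smooth_in [set p : R * 'rV[R]_m |
                [/\ T p.1, img c p.2 & dom c' (phi p.1 (param c p.2))]]
              (fun p => coord c' (phi p.1 (param c p.2))).

Definition smooth_function (T : set R) (f : R -> M -> R) : Prop :=
  forall c : chart A,
    smooth_in [set p : R * 'rV[R]_m | T p.1 /\ img c p.2]
              (fun p => f p.1 (param c p.2)).

Variable g : riemannian A.

Definition dist_C0 (phi psi : M -> M) : R :=
  sup (range (fun x => riem_dist g (phi x) (psi x))).

Definition dbar (Phi Psi : isotopy R M) : R :=
  sup [set dist_C0 (fwd Phi t) (fwd Psi t) + dist_C0 (bwd Phi t) (bwd Psi t)
      | t in `[0, 1]].

End Isotopies.

Section ContactSystems.
Variables (R : realType) (m : nat) (M : ptopologicalType) (A : atlas R m M).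
Variables (alpha : one_form A) (g : riemannian A).
Variable mu : {measure set (borel M) -> \bar R}.

(* (phi_t)^* alpha = e^(h_t) alpha *)
Definition conformal_factor (Phi : isotopy R M) (h : R -> M -> R) : Prop :=
  forall (t : R) (c c' : chart A) (u v : 'rV[R]_m),
    t \in `[0, 1] -> img c u -> dom c' (fwd Phi t (param c u)) ->
    pairing (form_coef alpha c' (coord c' (fwd Phi t (param c u))))
            ('D_v (fun w => coord c' (fwd Phi t (param c w))) u)
    = expR (h t (param c u)) * pairing (form_coef alpha c u) v.

(* H_t (phi_t x) = alpha (X_t (phi_t x)) where X_t (phi_t x) = d/dt phi_t x,
   with coordinates w; the derivative is one-sided at t = 0 and t = 1. *)
Definition contact_hamiltonian (Phi : isotopy R M) (H : R -> M -> R) : Prop :=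
  forall (t : R) (x : M) (c : chart A),
    t \in `[0, 1] -> dom c (fwd Phi t x) ->
    exists2 w : 'rV[R]_m,
      (s - t)^-1 *: (coord c (fwd Phi s x) - coord c (fwd Phi t x))
        @[s --> within `[0, 1] t^'] --> w
    & H t (fwd Phi t x) =
      pairing (form_coef alpha c (coord c (fwd Phi t x))) w.

Definition smooth_contact_system
    (Phi : isotopy R M) (H h : R -> M -> R) : Prop :=
  [/\ [/\ isotopy_inverse Phi, smooth_family A `[0, 1] (fwd Phi),
          smooth_family A `[0, 1] (bwd Phi) & forall x, fwd Phi 0 x = x],
      smooth_function A `[0, 1] H /\ contact_hamiltonian Phi H
    & smooth_function A `[0, 1] h /\ conformal_factor Phi h].

Definition uniform_limit (h_ : nat -> R -> M -> R) (h : R -> M -> R) : Prop :=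
  {uniform `[0, 1] `*` [set: M],
    (fun i (p : R * M) => h_ i p.1 p.2) @ \oo --> (fun p => h p.1 p.2)}.

Definition topological_contact_system
    (Phi : isotopy R M) (H h : R -> M -> R) : Prop :=
  [/\ continuous_isotopy Phi, L1C0 mu H
    & exists (Phi_ : nat -> isotopy R M) (H_ h_ : nat -> R -> M -> R),
      [/\ forall i, smooth_contact_system (Phi_ i) (H_ i) (h_ i),
          dbar g (Phi_ i) Phi @[i --> \oo] --> (0 : R),
          uniform_limit h_ h
        & norm_1oo mu (fun t x => H t x - H_ i t x) @[i --> \oo] --> 0%E]].

(* A uniform limit of smooth Hamiltonians is continuous; this is required
   beforehand so that norm_oo below is a maximum. *)
Definition continuous_contact_system
    (Phi : isotopy R M) (H h : R -> M -> R) : Prop :=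
  [/\ continuous_isotopy Phi,
      {within `[0, 1] `*` [set: M], continuous (fun p : R * M => H p.1 p.2)}
    & exists (Phi_ : nat -> isotopy R M) (H_ h_ : nat -> R -> M -> R),
      [/\ forall i, smooth_contact_system (Phi_ i) (H_ i) (h_ i),
          dbar g (Phi_ i) Phi @[i --> \oo] --> (0 : R),
          uniform_limit h_ h
        & norm_oo mu (fun t x => H t x - H_ i t x) @[i --> \oo] --> (0 : R)]].

Definition smooth_before_one (Phi : isotopy R M) (H h : R -> M -> R) : Prop :=
  [/\ smooth_family A `[0, 1[ (fwd Phi), smooth_family A `[0, 1[ (bwd Phi),
      smooth_function A `[0, 1[ H & smooth_function A `[0, 1[ h].

End ContactSystems.

(* Main.v *)
From Pilot Require Import Defs.
From HB Require Import structures.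
From mathcomp Require Import all_boot all_order all_algebra all_fingroup.
From mathcomp Require Import all_classical all_reals all_analysis.
From mathcomp Require Import measurable_realfun ring lra.

Import Order.TTheory GRing.Theory Num.Theory.
Import numFieldNormedType.Exports.

Local Open Scope classical_set_scope.
Local Open Scope ring_scope.

Import Pilot.Defs.

Set Implicit Arguments.
Unset Strict Implicit.
Unset Printing Implicit Defensive.

(* Let phi_i be smooth contact isotopies converging to Phi_H. The isotopy
   phi_j^s (phi_i^s)^-1 phi_i^1 leads from phi_i^1 to phi_j^1; for large i and j it stays close to
   phi_H^1, and its Hamiltonian H_j - e^u (H_i o sigma), with u near 0 and sigma near the identity,
   has small (1,oo)-norm because H_i converges. Run phi_{i_0} during [0,T] and then infinitely many
   such pieces during intervals of length (1-T) 2^-(j+1) accumulating at time 1. Reparametrizing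
   each piece so that its speed is inversely proportional to the norm of its Hamiltonian turns the
   smallness in L^1 into uniform smallness, whence convergence at time 1; making the
   reparametrizations flat at both ends makes the concatenation smooth before time 1. The first
   alternative reparametrizes phi_{i_0} by a map C^1-close in the mean to the identity, the second
   one by a map that equalizes the norms of the Hamiltonians. *)

(** * Smooth maps *)

(** The limit isotopy must come with smooth systems converging to it uniformly in time. These are
    the truncations of the concatenation: follow it up to the end of some piece, then rest at the
    map reached there, with zero Hamiltonian. Flatness makes them smooth, and beyond the cut only
    the tail of the concatenation is lost, which is small in every norm involved. The obstacle in
    estimating H_j - e^u (H_i o sigma) is that the H_i have no common modulus of continuity. One
    index N_0 is therefore fixed first: for large i and j both H_i and H_j are L^1-close to the
    Hamiltonian of index N_0, and only this single function, uniformly continuous on [0,1] x M, is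
    compared with its composition with sigma. Most estimates can be made pointwise, because the norm
    of a continuous function lies between its supremum norm and three times that; the second
    alternative needs a sharp constant and carries the norm itself through. Maps are compared by the
    Riemannian distance, an infimum of lengths; that it induces the topology of M is proved with
    bump functions that are Lipschitz along curves. *)

Section Calculus.
Context {R : realType}.

(** The first-order expansion of [f] at [x] is also one of [g], and uniqueness of the differential
    identifies its linear part with ['d g x]. *)
Lemma near_differentiable (V W : normedModType R) (f g : V -> W) (x : V) :
  (\near x, f x = g x) -> differentiable f x -> differentiable g x.
Proof.
move=> fg df; have [cdf ef] := (diff_locallyxP x f).1 df.
have fgx : f x = g x by exact: nbhs_singleton fg.
have cvgS : (fun h : V => h + x) @ nbhs (0 : V) --> x.
  by rewrite -[X in _ --> X]add0r; apply: cvgD; [exact: cvg_id|exact: cvg_cst].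
have eg : g \o shift x = cst (g x) + 'd f x +o_ (0 : V) id.
  apply/eqaddoP => e e0.
  have /eqaddoP : f \o shift x = cst (f x) + 'd f x +o_ (0 : V) id.
    exact: ((diff_locallyP x f).1 df).2.
  move=> /(_ e e0) H; have fg' := cvgS _ fg; near=> h.
  have E : f (h + x) = g (h + x) by near: h; exact: fg'.
  by rewrite !fctE /= -fgx -E; near: h; exact: H.
by apply/diff_locallyP; rewrite (diff_unique cdf eg).
Unshelve. all: by end_near. Qed.

Lemma Ck_sub (V W : normedModType R) k (U U' : set V) (f : V -> W) :
  U' `<=` U -> Ck_on k U f -> Ck_on k U' f.
Proof.
move=> UU; elim: k f => [|k IH] f /= => [h x /UU/h //|[h1 h2]].
by split=> [x /UU /h1 //|v]; exact: IH.
Qed.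

Lemma Ck_eq (V W : normedModType R) k (U : set V) (f g : V -> W) :
  open U -> (forall x, U x -> f x = g x) -> Ck_on k U f -> Ck_on k U g.
Proof.
move=> oU; elim: k f g => [|k IH] f g fg /=.
  move=> h x Ux; suff : g y @[y --> x] --> f x by rewrite fg.
  apply: cvg_trans (h x Ux); apply: near_eq_cvg.
  by near=> y; rewrite fg//; near: y; exact: open_nbhs_nbhs.
move=> [h1 h2]; split=> [x Ux|v].
  apply: near_differentiable (h1 x Ux).
  by near=> y; apply: fg; near: y; exact: open_nbhs_nbhs.
apply: IH (h2 v) => x Ux; apply: near_eq_derive.
by near=> y; apply: fg; near: y; exact: open_nbhs_nbhs.
Unshelve. all: by end_near. Qed.

Lemma CkS (V W : normedModType R) k (U : set V) (f : V -> W) :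
  Ck_on k.+1 U f -> Ck_on k U f.
Proof.
elim: k f => [|k IH] f [h1 h2].
  by move=> x /h1 /differentiable_continuous.
by split=> // v; apply: IH.
Qed.

Lemma smooth_sub (V W : normedModType R) (U U' : set V) (f : V -> W) :
  U' `<=` U -> smooth_on U f -> smooth_on U' f.
Proof. by move=> UU h k; apply: Ck_sub (h k). Qed.

Lemma smooth_eq (V W : normedModType R) (U : set V) (f g : V -> W) :
  open U -> (forall x, U x -> f x = g x) -> smooth_on U f -> smooth_on U g.
Proof. by move=> oU fg h k; exact: Ck_eq (h k). Qed.

Lemma smooth_differentiable (V W : normedModType R) (U : set V) (f : V -> W) x :
  smooth_on U f -> U x -> differentiable f x.
Proof. by move=> /(_ 1%N)[+ _]; exact. Qed.

Lemma smooth_continuous (V W : normedModType R) (U : set V) (f : V -> W) x :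
  smooth_on U f -> U x -> {for x, continuous f}.
Proof. by move=> /(_ 0%N); exact. Qed.

Lemma smooth_derive (V W : normedModType R) (U : set V) (f : V -> W) v :
  smooth_on U f -> smooth_on U (fun x => 'D_v f x).
Proof. by move=> h k; have [_] := h k.+1; exact. Qed.

Lemma Ck_cst (V W : normedModType R) k (U : set V) (a : W) :
  Ck_on k U (fun _ : V => a).
Proof.
elim: k a => [|k IH] a /=; first by move=> x _; exact: cst_continuous.
split=> [x _|v]; first exact: differentiable_cst.
have -> : (fun x => 'D_v (fun _ : V => a) x) = (fun _ : V => 0 : W).
  by apply/funext => x; exact: derive_cst.
exact: IH.
Qed.

Lemma CkD (V W : normedModType R) k (U : set V) (f g : V -> W) : open U ->
  Ck_on k U f -> Ck_on k U g -> Ck_on k U (fun x => f x + g x).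
Proof.
move=> oU; elim: k f g => [|k IH] f g /=.
  by move=> h1 h2 x Ux; apply: continuousD; [exact: h1|exact: h2].
move=> [f1 f2] [g1 g2]; split=> [x Ux|v].
  by apply: differentiableD; [exact: f1|exact: g1].
apply: (@Ck_eq _ _ _ _ (fun x => 'D_v f x + 'D_v g x)) => //.
  by move=> x Ux; rewrite -deriveD//; apply: diff_derivable; [exact: f1|exact: g1].
exact: IH.
Qed.

Lemma Ck_sum (V W : normedModType R) k (U : set V) n (f : 'I_n -> V -> W) :
  open U -> (forall i, Ck_on k U (f i)) ->
  Ck_on k U (fun x => \sum_(i < n) f i x).
Proof.
move=> oU; elim: n f => [|n IH] f h.
  have -> : (fun x => \sum_(i < 0) f i x) = (fun _ : V => 0 : W).
    by apply/funext => x; rewrite big_ord0.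
  exact: Ck_cst.
have -> : (fun x => \sum_(i < n.+1) f i x) =
    (fun x => \sum_(i < n) f (widen_ord (leqnSn n) i) x + f ord_max x).
  by apply/funext => x; rewrite big_ord_recr.
by apply: CkD => //; exact: IH.
Qed.

Section Scale.
Variable W : normedModType R.

Lemma scale_is_bilinear :
  bilinear_for
    (GRing.Scale.Law.clone _ _ *:%R _) (GRing.Scale.Law.clone _ _ *:%R _)
    (fun (a : R) (w : W) => a *: w).
Proof.
split=> [u'|u] a x y /=; first by rewrite scalerDl scalerA.
by rewrite scalerDr !scalerA mulrC.
Qed.

Let sc (a : R) (w : W) := a *: w.
HB.instance Definition _ := bilinear_isBilinear.Build R R W W _ _ sc
  scale_is_bilinear.

(** The product is the bilinear map [sc] composed with the pair of [a] and [f], so the product rule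
    is the chain rule together with the differential of a bilinear map. *)
Lemma diff_scale (V : normedModType R) (a : V -> R) (f : V -> W) x :
  differentiable a x -> differentiable f x ->
  differentiable (fun y => a y *: f y) x /\
  forall v, 'D_v (fun y => a y *: f y) x = a x *: 'D_v f x + 'D_v a x *: f x.
Proof.
move=> da df.
have cs : continuous (fun p : R * W => sc p.1 p.2) by exact: scale_continuous.
have dp := differentiable_pair da df.
have ds : differentiable (fun p : R * W => sc p.1 p.2) (a x, f x).
  exact: differentiable_bilin.
have E : (fun y => a y *: f y) = (fun p : R * W => sc p.1 p.2) \o (fun y => (a y, f y)).
  by [].
split; first by rewrite E; exact: differentiable_comp.
move=> v; rewrite E deriveE; last exact: differentiable_comp.
rewrite diff_comp//= diff_bilin//= diff_pair//= /sc.
by rewrite !deriveE.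
Qed.

End Scale.

Lemma CkZ (V W : normedModType R) k (U : set V) (a : V -> R) (f : V -> W) :
  open U -> Ck_on k U a -> Ck_on k U f -> Ck_on k U (fun x => a x *: f x).
Proof.
move=> oU; elim: k a f => [|k IH] a f.
  by move=> h1 h2 x Ux; apply: cvgZ; [exact: h1|exact: h2].
move=> ha hf; split=> [x Ux|v].
  by have [] := diff_scale (ha.1 x Ux) (hf.1 x Ux).
apply: (@Ck_eq _ _ _ _ (fun x => a x *: 'D_v f x + 'D_v a x *: f x)) => //.
  by move=> x Ux; rewrite (diff_scale (ha.1 x Ux) (hf.1 x Ux)).2.
apply: CkD => //; apply: IH => //; try exact: CkS.
- exact: hf.2.
- exact: ha.2.
Qed.

Lemma Ck_linear (V W Z : normedModType R) k (U : set V) (l : {linear W -> Z})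
  (f : V -> W) : open U -> continuous l -> Ck_on k U f -> Ck_on k U (fun x => l (f x)).
Proof.
move=> oU cl; elim: k f => [|k IH] f.
  by move=> h x Ux; apply: (continuous_comp (h x Ux)); exact: cl.
move=> [h1 h2]; split=> [x Ux|v].
  apply: (differentiable_comp (h1 x Ux)).
  by apply: linear_differentiable; exact: cl.
apply: (@Ck_eq _ _ _ _ (fun x => l ('D_v f x))) => //; last by apply: IH; exact: h2.
move=> x Ux; have df := h1 x Ux.
have dl y : differentiable l y by apply: linear_differentiable; exact: cl.
have dc : differentiable (l \o f) x by exact: differentiable_comp.
by rewrite [RHS](deriveE v dc) (diff_comp df (dl _)) /= diff_lin//= deriveE.
Qed.

(** [Ck_on] differentiates in fixed directions, whereas in the chain rule the outer function is
    differentiated in a direction that varies with the point; expanding this direction in continuous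
    coordinates repairs the mismatch. *)
Definition finite_basis (W : normedModType R) :=
  exists (n : nat) (e : 'I_n -> W) (l : 'I_n -> {linear W -> R}),
    (forall i, continuous (l i)) /\ forall w, w = \sum_(i < n) l i w *: e i.

Lemma finite_basis_R : finite_basis R.
Proof.
exists 1%N, (fun _ => 1), (fun _ => idfun); split=> [i x|w]; first exact: cvg_id.
by rewrite big_ord1 /= /GRing.scale /= mulr1.
Qed.

Lemma coord_is_linear m (i : 'I_m) : linear (fun v : 'rV[R]_m => v 0 i : R).
Proof. by move=> a u v; rewrite !mxE. Qed.

Lemma finite_basis_rV m : finite_basis 'rV[R]_m.
Proof.
pose L i : {linear 'rV[R]_m -> R} := HB.pack (fun v : 'rV[R]_m => v 0 i : R)
  (GRing.isLinear.Build R 'rV[R]_m R *:%R _ (coord_is_linear i)).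
exists m, (fun i => delta_mx 0 i), L; split=> [i|w].
  exact: matrix_normedtype.coord_continuous.
by rewrite /L /= -row_sum_delta.
Qed.

Lemma finite_basis_pair (V W : normedModType R) :
  finite_basis V -> finite_basis W -> finite_basis (V * W)%type.
Proof.
move=> [n [e [l [cl lE]]]] [n' [e' [l' [cl' lE']]]].
pose f1 i : {linear (V * W)%type -> R} := [the {linear (V * W)%type -> R} of l i \o fst].
pose f2 i : {linear (V * W)%type -> R} := [the {linear (V * W)%type -> R} of l' i \o snd].
exists (n + n')%N, (fun i => match fintype.split i with inl j => (e j, 0 : W) | inr j => (0 : V, e' j) end),
  (fun i => match fintype.split i with inl j => f1 j | inr j => f2 j end); split.
- move=> i; case: (fintype.split i) => j x /=.
    by apply: (continuous_comp cvg_fst); exact: cl.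
  by apply: (continuous_comp cvg_snd); exact: cl'.
move=> [v w]; rewrite big_split_ord /=.
under eq_bigr do rewrite -[lshift _ _]/(unsplit (inl _)) unsplitK.
under [X in _ = _ + X]eq_bigr do rewrite -[rshift _ _]/(unsplit (inr _)) unsplitK.
rewrite {1}(lE v) {1}(lE' w).
have -> : \sum_(i < n) f1 i (v, w) *: (e i, 0 : W) = (\sum_(i < n) l i v *: e i, 0).
  rewrite (big_morph (fun a : V => (a, 0 : W)) (id1 := 0) (op1 := +%R))//.
    by apply: eq_bigr => i _; congr pair; exact: scaler0.
  by move=> a b; congr pair; rewrite addr0.
have -> : \sum_(i < n') f2 i (v, w) *: (0 : V, e' i) = (0, \sum_(i < n') l' i w *: e' i).
  rewrite (big_morph (fun a : W => (0 : V, a)) (id1 := 0) (op1 := +%R))//.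
    by apply: eq_bigr => i _; congr pair; exact: scaler0.
  by move=> a b; congr pair; rewrite addr0.
by congr pair; rewrite ?addr0 ?add0r.
Qed.

(** Induction on [k]: the derivative of the composition is the sum of the products of
    [l i ('D_v f x)] and ['D_(e i) g (f x)], and the induction hypothesis applies to the second
    factors with the same inner function. *)
Lemma Ck_comp (V W Z : normedModType R) k (U : set V) (U' : set W)
  (f : V -> W) (g : W -> Z) : finite_basis W -> open U ->
  (forall x, U x -> U' (f x)) -> Ck_on k U f -> Ck_on k U' g ->
  Ck_on k U (fun x => g (f x)).
Proof.
move=> [n [e [l [cl lE]]]] oU fU; elim: k f fU g => [|k IH] f fU g hf hg.
  by move=> x Ux; apply: (continuous_comp (hf x Ux)); exact/hg/fU.
split=> [x Ux|v].
  by apply: (differentiable_comp (hf.1 x Ux)); exact/hg.1/fU.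
apply: (@Ck_eq _ _ _ _
  (fun x => \sum_(i < n) l i ('D_v f x) *: 'D_(e i) g (f x))) => //.
  move=> x Ux; have df := hf.1 x Ux; have dg := hg.1 _ (fU x Ux).
  have dc : differentiable (g \o f) x := differentiable_comp df dg.
  rewrite [RHS](deriveE v dc) (diff_comp df dg) /=.
  rewrite (deriveE v df) [in RHS](lE ('d f x v)) linear_sum.
  by apply: eq_bigr => i _; rewrite linearZ deriveE.
apply: Ck_sum => // i; apply: CkZ => //.
  by apply: Ck_linear => //; exact: hf.2.
apply: (IH f fU ('D_(e i) g)); [exact: CkS hf|exact: hg.2].
Qed.

Lemma smooth_cst (V W : normedModType R) (U : set V) (a : W) :
  smooth_on U (fun _ : V => a).
Proof. by move=> k; exact: Ck_cst. Qed.

Lemma smoothD (V W : normedModType R) (U : set V) (f g : V -> W) : open U ->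
  smooth_on U f -> smooth_on U g -> smooth_on U (fun x => f x + g x).
Proof. by move=> oU hf hg k; exact: CkD. Qed.

Lemma smoothZ (V W : normedModType R) (U : set V) (a : V -> R) (f : V -> W) :
  open U -> smooth_on U a -> smooth_on U f -> smooth_on U (fun x => a x *: f x).
Proof. by move=> oU ha hf k; exact: CkZ. Qed.

Lemma smoothM (V : normedModType R) (U : set V) (a f : V -> R) :
  open U -> smooth_on U a -> smooth_on U f -> smooth_on U (fun x => a x * f x).
Proof. exact: smoothZ. Qed.

Lemma smoothN (V W : normedModType R) (U : set V) (f : V -> W) :
  open U -> smooth_on U f -> smooth_on U (fun x => - f x).
Proof.
move=> oU hf; have -> : (fun x => - f x) = (fun x => (-1) *: f x).
  by apply/funext => x; rewrite scaleN1r.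
by apply: smoothZ => //; exact: smooth_cst.
Qed.

Lemma smooth_linear (V W : normedModType R) (U : set V) (l : {linear V -> W}) :
  continuous l -> smooth_on U l.
Proof.
move=> cl [|k] /=; first by move=> x _; exact: cl.
split=> [x _|v]; first exact: linear_differentiable.
have -> : (fun x => 'D_v l x) = (fun _ => l v).
  by apply/funext => x; rewrite deriveE; [rewrite diff_lin|exact: linear_differentiable].
exact: Ck_cst.
Qed.

Lemma smooth_comp (V W Z : normedModType R) (U : set V) (U' : set W)
  (f : V -> W) (g : W -> Z) : finite_basis W -> open U ->
  (forall x, U x -> U' (f x)) -> smooth_on U f -> smooth_on U' g ->
  smooth_on U (fun x => g (f x)).
Proof. by move=> bW oU fU hf hg k; exact: (@Ck_comp _ _ _ k U U'). Qed.

Lemma smooth_id (V : normedModType R) (U : set V) : smooth_on U (fun x : V => x).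
Proof. exact: (@smooth_linear _ _ _ idfun (fun=> cvg_id)). Qed.

Lemma smooth_fst (V W : normedModType R) (U : set (V * W)) :
  smooth_on U (fun p : V * W => p.1).
Proof. by apply: (@smooth_linear _ _ _ fst) => x; exact: cvg_fst. Qed.

Lemma smooth_snd (V W : normedModType R) (U : set (V * W)) :
  smooth_on U (fun p : V * W => p.2).
Proof. by apply: (@smooth_linear _ _ _ snd) => x; exact: cvg_snd. Qed.

Lemma smooth_pair (V W Z : normedModType R) (U : set V)
  (f : V -> W) (g : V -> Z) : open U ->
  smooth_on U f -> smooth_on U g -> smooth_on U (fun x => (f x, g x)).
Proof.
move=> oU hf hg k; elim: k f g hf hg => [|k IH] f g hf hg.
  by move=> x Ux; apply: cvg_pair; [exact: (hf 0%N)|exact: (hg 0%N)].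
have df x Ux := smooth_differentiable hf Ux (x := x).
have dg x Ux := smooth_differentiable hg Ux (x := x).
split=> [x Ux|v]; first by apply: differentiable_pair; [exact: df|exact: dg].
apply: (@Ck_eq _ _ _ _ (fun x => ('D_v f x, 'D_v g x))) => //.
  move=> x Ux; rewrite [RHS]deriveE; last by apply: differentiable_pair; auto.
  by rewrite diff_pair /= ?deriveE; auto.
by apply: IH; exact: smooth_derive.
Qed.

Lemma smooth_expR (U : set R) : open U -> smooth_on U (@expR R).
Proof.
move=> oU k; elim: k => [|k IH]; first by move=> x _; exact: continuous_expR.
split=> [x _|v]; first exact/derivable1_diffP/derivable_expR.
have -> : (fun x => 'D_v (@expR R) x) = (fun x => v *: expR x).
  apply/funext => x; have d : derivable (@expR R) x 1 by exact: derivable_expR.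
  rewrite deriveE; last exact/derivable1_diffP.
  rewrite deriv1E//= derive1E; congr (_ *: _).
  exact: (congr1 (fun f => f x) (@derive_expR R)).
by apply: CkZ => //; exact: Ck_cst.
Qed.

End Calculus.

(** * Reparametrizations of the interval *)

Section FlatFunctions.
Context {R : realType}.
Implicit Types (f F : R -> R) (x : R).

Lemma near_lt (x a : R) : x < a -> \forall y \near x, y < a.
Proof. by move=> xa; apply: open_nbhs_nbhs; split => //; exact: open_lt. Qed.

Lemma near_gt (x a : R) : a < x -> \forall y \near x, a < y.
Proof. by move=> xa; apply: open_nbhs_nbhs; split => //; exact: open_gt. Qed.

Lemma is_derive_near0 F x : (\near x, F x = 0) -> is_derive x 1 F 0.
Proof.
move=> h; have c0 : is_derive x 1 (cst 0 : R -> R) 0 by exact: is_derive_cst.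
by apply: near_eq_is_derive c0; near=> y; rewrite (near h y).
Unshelve. all: by end_near. Qed.

Lemma smooth_primitive F f : (forall x, is_derive x 1 F (f x)) ->
  smooth_on setT f -> smooth_on setT F.
Proof.
move=> dF sf.
have dd x : differentiable F x by apply/derivable1_diffP; have [] := dF x.
case=> [|k]; first by move=> x _; exact: differentiable_continuous.
split=> // v.
have -> : (fun x => 'D_v F x) = (fun x => v *: f x).
  apply/funext => x; rewrite deriveE//.
  have [d <-] := dF x.
  by rewrite deriv1E//= derive1E.
by apply: CkZ => //; [exact: openT|exact: Ck_cst].
Qed.

Lemma smooth_derive1 f : smooth_on setT f -> smooth_on setT (derive1 f).
Proof.
move=> sf; apply: (@smooth_eq _ _ _ _ (fun x => 'D_1 f x)).
- exact: openT.
- by move=> x _; rewrite derive1E.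
- exact: smooth_derive.
Qed.

Lemma smooth_is_derive f x : smooth_on setT f -> is_derive x 1 f (derive1 f x).
Proof.
move=> sf; rewrite derive1E; apply: derivableP; apply: diff_derivable.
exact: (smooth_differentiable sf).
Qed.

Lemma smooth_cts f : smooth_on setT f -> continuous f.
Proof. by move=> sf x; exact: (smooth_continuous sf). Qed.

Lemma nondecreasing_of_derive F f : (forall x, is_derive x 1 F (f x)) ->
  (forall x, 0 <= f x) -> forall x y, x <= y -> F x <= F y.
Proof.
move=> dF f0 x y; rewrite le_eqVlt => /predU1P[->//|xy].
have cF : {within `[x, y], continuous F}.
  apply: continuous_subspaceT => z; apply: differentiable_continuous.
  by apply/derivable1_diffP; have [] := dF z.
have [c _ E] := MVT xy (fun z _ => dF z) cF.
by rewrite -subr_ge0 E mulr_ge0// subr_ge0 ltW.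
Qed.

Lemma is_derive_integral f x : continuous f -> -1 < x ->
  is_derive x 1 (fun y => \int[lebesgue_measure]_(t in `[(-1 : R), y]) f t)%R (f x).
Proof.
move=> cf x1; have xu : x < x + 1 by lra.
have ci : lebesgue_measure.-integrable `[(-1 : R), x + 1] (EFin \o f).
  apply: continuous_compact_integrable; first exact: segment_compact.
  exact: continuous_subspaceT.
have [d <-] := continuous_FTC1_closed xu ci x1 (cf x).
by rewrite derive1E; exact: derivableP.
Qed.

Lemma exists_primitive f : continuous f -> (forall x, x <= 0 -> f x = 0) ->
  exists F, (forall x, x <= 0 -> F x = 0) /\ forall x, is_derive x 1 F (f x).
Proof.
move=> cf f0.
(* The base point -1 makes every [x >= 0] an interior point of the domain of integration, where the
   fundamental theorem of calculus gives a two-sided derivative. *)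
pose F (x : R) := (\int[lebesgue_measure]_(t in `[(-1 : R), x]) f t)%R.
have F0 x : x <= 0 -> F x = 0.
  move=> x0; rewrite /F (@eq_Rintegral _ _ _ _ _ (cst 0)) ?Rintegral_cst ?mul0r//.
  by move=> t; rewrite inE/= in_itv/= => /andP[_ tx]; rewrite f0//; exact: le_trans tx x0.
exists F; split=> // x; have [x0|x0] := ltP x 0; last by apply: is_derive_integral => //; lra.
rewrite f0 ?ltW//; apply: is_derive_near0.
by near=> y; rewrite F0// ltW//; near: y; exact: near_lt.
Unshelve. all: by end_near. Qed.

(** The powers of 1/x are carried along because they make the family closed under differentiation up
    to linear combinations; smoothness at 0 then becomes an induction. *)
Definition flat (n : nat) (x : R) : R :=
  if 0 < x then x^-1 ^+ n * expR (- x^-1) else 0.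

Lemma pow_le_expR (n : nat) : exists2 C : R, 0 < C &
  forall y : R, 0 < y -> y ^+ n <= C * expR y.
Proof.
case: n => [|n].
  exists 1 => // y y0; rewrite expr0 mul1r; apply: le_trans (expR_ge1Dx y).
  by rewrite lerDl ltW.
exists (n.+1`!%:R); first by rewrite ltr0n fact_gt0.
move=> y y0; have := expR_ge1Dxn n (ltW y0).
have f0 : (0 : R) < n.+1`!%:R by rewrite ltr0n fact_gt0.
move=> h; have {}h : y ^+ n.+1 / n.+1`!%:R <= expR y by apply: le_trans h; rewrite lerDr.
by rewrite ler_pdivrMr// mulrC in h.
Qed.

(** A quadratic bound makes the difference quotient at 0 tend to 0; this is the only analytic input
    for differentiability there. *)
Lemma flat_quadratic n : exists2 C : R, 0 < C & forall x, `|flat n x| <= C * x ^+ 2.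
Proof.
have [C C0 hC] := pow_le_expR n.+2; exists C => // x.
rewrite /flat; case: ifPn => [x0|_]; last first.
  by rewrite normr0 mulr_ge0 ?sqr_ge0 ?ltW.
have xn0 : x != 0 by rewrite gt_eqF.
rewrite ger0_norm; last by rewrite mulr_ge0 ?expR_ge0// exprn_ge0// invr_ge0 ltW.
have := hC x^-1; rewrite invr_gt0 => /(_ x0) h.
rewrite expRN ler_pdivrMr ?expR_gt0//.
apply: le_trans (_ : x ^+ 2 * (C * expR x^-1) <= _); last by rewrite mulrCA mulrA.
apply: le_trans (ler_wpM2l (sqr_ge0 x) h).
have -> : n.+2 = (n + 2)%N by rewrite addn2.
by rewrite exprD mulrCA -exprMn divff// expr1n mulr1.
Qed.

Lemma is_derive_flat n x : is_derive x 1 (flat n) (flat n.+2 x - n%:R * flat n.+1 x).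
Proof.
have [x0|x0|->] := ltgtP x 0.
- rewrite /flat !ltNge !(ltW x0)/= mulr0 subr0.
  apply: is_derive_near0.
  by near=> y; rewrite ltNge ltW//; near: y; exact: near_lt.
- have xn0 : x != 0 by rewrite gt_eqF.
  apply: (@near_eq_is_derive _ _ _ (fun y : R => y^-1 ^+ n * expR (- y^-1))).
    near=> y; rewrite /flat ifT//; near: y; exact: near_gt.
  have di : is_derive x 1 (fun y : R => y^-1) (- x ^- 2).
    have di : derivable (fun y : R => y) x 1 by exact: derivable_id.
    apply: DeriveDef; first exact: (derivableV xn0 di).
    by rewrite (deriveV xn0 di) derive_id scaleNr /GRing.scale/= mulr1.
  have dn : is_derive x 1 (fun y : R => - y^-1) (x ^- 2).
    by rewrite -[X in is_derive _ _ _ X]opprK; exact: is_deriveN.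
  have de : is_derive x 1 (fun y : R => expR (- y^-1)) (x ^- 2 * expR (- x^-1)).
    rewrite mulrC.
    exact: (@is_derive1_comp _ (@expR R) (fun y : R => - y^-1)).
  have dx : is_derive x 1 (fun y : R => y^-1 ^+ n) (- n%:R * x^-1 ^+ n.+1).
    have -> : (fun y : R => y^-1 ^+ n) = (fun y : R => y^-1) ^+ n.
      by apply/funext => y; rewrite exprfctE.
    have H := is_deriveX n di.
    apply: (is_derive_eq H).
    case: n {H} => [|n]; first by rewrite !mul0r scale0r oppr0 mul0r.
    by rewrite /GRing.scale/= -exprVn !exprS expr0; ring.
  apply: (is_derive_eq (is_deriveM dx de)).
  rewrite /flat x0 /GRing.scale/= -exprVn !exprS expr0; ring.
- rewrite /flat !ltxx mulr0 subr0.
  have [C C0 hC] := flat_quadratic n.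
  have c0 : (fun h : R => h^-1 *: ((flat n \o shift 0) (h *: 1) - flat n 0)) h @[h --> 0^'] --> (0 : R).
    apply/cvgrPdist_le => e e0; near=> h.
    have hn0 : h != 0 by near: h; exact: nbhs_dnbhs_neq.
    rewrite sub0r normrN /= addr0 /GRing.scale/= mulr1.
    rewrite [X in _ - X]/flat ltxx subr0 normrM normfV ler_pdivrMl ?normr_gt0//.
    apply: le_trans (hC h) _; rewrite -(real_normK (num_real h)) expr2.
    rewrite mulrA mulrC ler_pM2l ?normr_gt0//.
    rewrite -ler_pdivlMl// mulrC; near: h.
    apply: (@dnbhs0_le _ _ (e / C)); exact: divr_gt0.
  apply: DeriveDef; first by apply/cvg_ex; exists 0.
  by rewrite /derive; apply/cvg_lim.
Unshelve. all: by end_near. Qed.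

Lemma smooth_flat n : smooth_on setT (flat n).
Proof.
move=> k; elim: k n => [|k IH] n.
  move=> x _; apply: differentiable_continuous; apply/derivable1_diffP.
  by have [] := is_derive_flat n x.
split=> [x _|v]; first by apply/derivable1_diffP; have [] := is_derive_flat n x.
have -> : (fun x => 'D_v (flat n) x) = (fun x => v *: (flat n.+2 x + (- n%:R) *: flat n.+1 x)).
  apply/funext => x; have [d e] := is_derive_flat n x.
  rewrite deriveE; last exact/derivable1_diffP.
  by rewrite deriv1E//= derive1E e /GRing.scale /= mulNr.
have oT := @openT R.
by apply: CkZ => //; [exact: Ck_cst|apply: CkD => //; apply: CkZ => //; exact: Ck_cst].
Qed.

Lemma smooth_affine (a b : R) : smooth_on setT (fun x : R => a * x + b).
Proof.
apply: smoothD; [exact: openT| |exact: smooth_cst].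
by apply: smoothM; [exact: openT|exact: smooth_cst|exact: smooth_id].
Qed.

Lemma smooth_compR f F : smooth_on setT f -> smooth_on setT F ->
  smooth_on setT (fun x => F (f x)).
Proof.
move=> sf sF; apply: (smooth_comp (finite_basis_R) _ _ sf sF) => //.
exact: openT.
Qed.

(** [l] is the normalized primitive of the bump [b], which is positive exactly on ]0, 1[. *)
Lemma smooth_step : exists l : R -> R,
  [/\ smooth_on setT l, forall x, 0 <= l x <= 1, forall x, x <= 0 -> l x = 0,
      forall x, 1 <= x -> l x = 1 & forall x, 0 < x -> 0 < l x].
Proof.
pose b x := flat 0 x * flat 0 (- 1 * x + 1).
have f0 x : 0 <= flat 0 x.
  by rewrite /flat; case: ifP => // _; rewrite expr0 mul1r expR_ge0.
have b0 x : 0 <= b x by exact: mulr_ge0.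
have sb : smooth_on setT b.
  apply: smoothM; [exact: openT|exact: smooth_flat|].
  by apply: smooth_compR; [exact: smooth_affine|exact: smooth_flat].
have bl x : x <= 0 -> b x = 0.
  by move=> x0; rewrite /b /flat ltNge x0/= mul0r.
have [F [F0 dF]] := exists_primitive (smooth_cts sb) bl.
have mF := nondecreasing_of_derive dF b0.
have bp x : 0 < x -> x < 1 -> 0 < b x.
  move=> x0 x1; rewrite /b /flat x0 expr0 !mul1r.
  by rewrite ifT; [rewrite mulr_gt0 ?expR_gt0|lra].
have cF (x y : R) : {within `[x, y], continuous F}.
  apply: continuous_subspaceT => z; apply: differentiable_continuous.
  by apply/derivable1_diffP; have [] := dF z.
have Fp x : 0 < x -> 0 < F x.
  move=> x0; pose m := Num.min x 1.
  have m0 : 0 < m by rewrite lt_min x0 ltr01.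
  apply: lt_le_trans (_ : F m <= _); last by apply: mF; rewrite ge_min lexx.
  have [c /itvP ci E] := MVT m0 (fun z _ => dF z) (cF 0 m).
  rewrite (F0 0 (lexx _)) !subr0 in E; rewrite E mulr_gt0// bp ?ci//.
  by apply: lt_le_trans (_ : m <= 1); rewrite ?ci// ge_min lexx orbT.
have F1 : 0 < F 1 by apply: Fp.
have Fr x : 1 <= x -> F x = F 1.
  rewrite le_eqVlt => /predU1P[<-//|x1].
  have [c /itvP ci E] := MVT x1 (fun z _ => dF z) (cF 1 x).
  apply/eqP; rewrite -subr_eq0 E /b [X in _ * X * _]/flat ifF; first by rewrite mulr0 mul0r.
  have c1 : 1 < c by rewrite ci.
  by apply/negbTE; rewrite -leNgt; lra.
have sF := smooth_primitive dF sb.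
exists (fun x => (F 1)^-1 * F x); split.
- by apply: smoothM; [exact: openT|exact: smooth_cst|].
- move=> x; rewrite mulr_ge0 ?invr_ge0 ?(ltW F1)//=; last first.
    by have [x0|x0] := leP x 0; [rewrite F0|exact/ltW/Fp].
  rewrite ler_pdivrMl// mulr1; have [x1|x1] := leP 1 x; first by rewrite Fr.
  exact/mF/ltW.
- by move=> x x0; rewrite (F0 x x0) mulr0.
- by move=> x x1; rewrite (Fr x x1) mulVf// gt_eqF.
- by move=> x x0; rewrite mulr_gt0// ?invr_gt0// Fp.
Qed.

(** [s] is the normalized primitive of a plateau [q] with values in [0, 1], equal to 1 on
    [2e, 1 - 2e] and to 0 outside ]e, 1 - e[. Its total integral is at least 1 - 4e, so normalizing
    raises the slope to at most 1 / (1 - 4e), and [e] is chosen to make this at most 1 + k. *)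
Lemma flat_step (k : R) : 0 < k -> exists (e : R) (s : R -> R),
  [/\ 0 < e < 1 / 2, smooth_on setT s, forall x, x <= e -> s x = 0,
      forall x, 1 - e <= x -> s x = 1 & forall x, 0 <= derive1 s x <= 1 + k].
Proof.
move=> k0; have [l [sl l01 l0 l1 _]] := smooth_step.
pose e : R := Num.min (1 / 8) (k / (4 * (1 + k))).
have e0 : 0 < e by rewrite lt_min; apply/andP; split; [lra|apply: divr_gt0; lra].
have e8 : e <= 1 / 8 by rewrite /e ge_min lexx.
have ek : (1 + k) * (1 - 4 * e) >= 1.
  have : e <= k / (4 * (1 + k)) by rewrite /e ge_min lexx orbT.
  rewrite ler_pdivlMr; last lra.
  by lra.
pose q x := l (e^-1 * x - 1) * l (- e^-1 * x + (1 - e) / e).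
have sq : smooth_on setT q.
  by apply: smoothM; [exact: openT|apply: smooth_compR => //; exact: smooth_affine
    |apply: smooth_compR => //; exact: smooth_affine].
have q01 x : 0 <= q x <= 1.
  have /andP[a1 a2] := l01 (e^-1 * x - 1).
  have /andP[b1 b2] := l01 (- e^-1 * x + (1 - e) / e).
  by rewrite mulr_ge0//= -[1]mulr1 ler_pM.
have ql x : x <= e -> q x = 0.
  by move=> xe; rewrite /q l0 ?mul0r// subr_le0 ler_pdivrMl// mulr1.
have qr x : 1 - e <= x -> q x = 0.
  move=> xe; rewrite /q [l (- _ * _ + _)]l0 ?mulr0// mulNr mulrC addrC -mulrBl.
  by rewrite mulr_le0_ge0 ?invr_ge0 ?subr_le0// ltW.
have qm x : 2 * e <= x -> x <= 1 - 2 * e -> q x = 1.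
  move=> x1 x2; rewrite /q !l1 ?mulr1//.
    rewrite mulNr mulrC addrC -mulrBl ler_pdivlMr// mul1r; lra.
  by rewrite mulrC lerBrDr ler_pdivlMr//; lra.
have [F [F0 dF]] := exists_primitive (smooth_cts sq) (fun x (h : x <= 0) =>
  ql x (le_trans h (ltW e0))).
have mF := nondecreasing_of_derive dF (fun x => (andP (q01 x)).1).
have cF (x y : R) : {within `[x, y], continuous F}.
  apply: continuous_subspaceT => z; apply: differentiable_continuous.
  by apply/derivable1_diffP; have [] := dF z.
have Fl x : x <= e -> F x = 0.
  move=> xe; have [x0|x0] := leP x 0; first exact: F0.
  have [c /itvP ci E] := MVT x0 (fun z _ => dF z) (cF 0 x).
  have qc : q c = 0 by apply: ql; apply: le_trans xe; rewrite ci.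
  by rewrite qc (F0 0 (lexx _)) in E; lra.
have Fr x : 1 - e <= x -> F x = F (1 - e).
  rewrite le_eqVlt => /predU1P[<-//|x1].
  have [c /itvP ci E] := MVT x1 (fun z _ => dF z) (cF (1 - e) x).
  by apply/eqP; rewrite -subr_eq0 E qr ?mul0r// ci.
have F1 : 1 - 4 * e <= F (1 - e).
  have h : 2 * e < 1 - 2 * e by lra.
  have [c /itvP ci E] := MVT h (fun z _ => dF z) (cF _ _).
  rewrite qm ?ci// in E.
  have : F (1 - 2 * e) <= F (1 - e) by apply: mF; lra.
  have : F 0 <= F (2 * e) by apply: mF; lra.
  rewrite F0//; lra.
have F1p : 0 < F (1 - e) by lra.
have sF := smooth_primitive dF sq.
exists e, (fun x => (F (1 - e))^-1 * F x); split.
- by rewrite e0/=; lra.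
- by apply: smoothM; [exact: openT|exact: smooth_cst|].
- by move=> x x0; rewrite (Fl x x0) mulr0.
- by move=> x x1; rewrite (Fr x x1) mulVf// gt_eqF.
- move=> x.
  have -> : derive1 (fun x => (F (1 - e))^-1 * F x) x = (F (1 - e))^-1 * q x.
    rewrite derive1E; have [d <-] := dF x.
    exact: (deriveZ (F (1 - e))^-1 d).
  have /andP[h1 h2] := q01 x.
  rewrite mulr_ge0 ?invr_ge0 ?(ltW F1p)//= ler_pdivrMl//.
  apply: le_trans h2 (le_trans ek _); rewrite mulrC.
  by rewrite ler_pM2r//; lra.
Qed.

End FlatFunctions.

(** On the compact set where [g >= e], the function [f] attains a minimum, which is positive; this
    minimum is [d]. With a distance as [f], the lemma yields all the uniform continuity statements
    below. *)
Lemma compact_control (R : realType) (T : topologicalType) (K : set T)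
    (f g : T -> R) : compact K -> continuous f -> continuous g ->
  (forall p, K p -> 0 <= f p) -> (forall p, K p -> f p = 0 -> g p <= 0) ->
  forall e, 0 < e -> exists2 d, 0 < d & forall p, K p -> f p < d -> g p < e.
Proof.
move=> cK cf cg f0 fg e e0; pose K' := K `&` (g @^-1` [set x | e <= x]).
have cK' : compact K'.
  by apply: compact_closedI => //; apply: preimage_closed => [? ?|]; [exact: cg|exact: closed_ge].
have [[p0 Kp0]|/nonemptyPn K'0] := pselect (K' !=set0); last first.
  exists 1 => // p Kp _; rewrite ltNge; apply/negP => gp.
  by have : K' p by []; rewrite K'0.
have [c] := compact_EVT_min (ex_intro _ p0 Kp0) cK' (continuous_subspaceT cf).
rewrite inE => -[Kc gc] cmin.
have fc : 0 < f c.
  rewrite lt_neqAle f0// andbT eq_sym; apply/eqP => /(fg _ Kc).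
  by move: gc => /= /(lt_le_trans e0); rewrite leNgt => ->.
exists (f c) => // p Kp; apply: contraTT; rewrite -!leNgt => gp.
by apply: cmin; rewrite inE.
Qed.

Section Reparametrization.
Context {R : realType}.

(** An upper Darboux sum close to the integral. The bounds [m j] are strictly positive because the
    time allotted to an interval will be proportional to them. *)
Lemma darboux (q : R -> R) (c : R) : continuous q -> (forall x, 0 <= q x) ->
  (\int[lebesgue_measure]_(t in `[0%R, 1%R]) (q t)%:E < c%:E)%E ->
  exists (N : nat) (m : nat -> R) (c' : R), [/\ (0 < N)%N, forall j, 0 < m j, 0 < c' < c,
    forall j x, (j < N)%N -> j%:R / N%:R <= x <= j.+1%:R / N%:R -> q x <= m j &
    \sum_(0 <= j < N) m j <= c' * N%:R].
Proof.
move=> cq q0 Iq.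
pose F (x : R) := (\int[lebesgue_measure]_(t in `[(-1 : R), x]) q t)%R.
have dF (x : R) : -1 < x -> is_derive x 1 F (q x) by exact: is_derive_integral.
have cF (x : R) : -1 < x -> {for x, continuous F}.
  move=> x1; apply: differentiable_continuous; apply/derivable1_diffP.
  by have [] := dF x x1.
have iE : (\int[lebesgue_measure]_(t in `[0%R, 1%R]) (q t)%:E = (F 1)%:E - (F 0)%:E)%E.
  apply: continuous_FTC2 => //; first exact: continuous_subspaceT.
    split.
    - by move=> x; rewrite in_itv/= => /andP[x0 _]; have [] := dF x (lt_trans (ltrN10 _) x0).
    - by apply: cvg_at_right_filter; apply: cF; lra.
    - by apply: cvg_at_left_filter; apply: cF; lra.
  move=> x; rewrite in_itv/= => /andP[x0 _]; rewrite derive1E.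
  by have [_ ->] := dF x (lt_trans (ltrN10 _) x0).
rewrite iE -EFinB lte_fin in Iq.
have I0 : 0 <= F 1 - F 0.
  rewrite subr_ge0; have l01 : (0 : R) < 1 by lra.
  have [z /itvP zi E] : exists2 z, z \in `](0 : R), 1[%R & F 1 - F 0 = q z * (1 - 0).
    apply: (@MVT _ F q) => //.
      by move=> z /itvP zi; apply: dF; apply: lt_trans (_ : 0 < z); rewrite ?zi//; lra.
    apply: derivable_within_continuous => z; rewrite in_itv/= => /andP[z0 _].
    by have [] := dF z (lt_le_trans (ltrN10 _) z0).
  by rewrite -subr_ge0 E mulr_ge0//; lra.
pose e : R := (c - (F 1 - F 0)) / 4.
have e0 : 0 < e by rewrite /e; lra.
have cI : compact (`[(0 : R), 1] `*` `[(0 : R), 1]).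
  by apply: compact_setX; exact: segment_compact.
have cd : continuous (fun p : R * R => `|p.1 - p.2|).
  by move=> p; apply: cvg_norm; apply: cvgB; [exact: cvg_fst|exact: cvg_snd].
have cdq : continuous (fun p : R * R => `|q p.1 - q p.2|).
  move=> p; apply: cvg_norm; apply: cvgB.
    by apply: (continuous_comp cvg_fst); exact: cq.
  by apply: (continuous_comp cvg_snd); exact: cq.
have [||d d0 hd] := compact_control cI cd cdq _ _ e0.
- by move=> p _; exact: normr_ge0.
- move=> p _ /eqP; rewrite normr_eq0 subr_eq0 => /eqP ->.
  by rewrite subrr normr0.
have [N' N'd] : exists N : nat, N.+1%:R^-1 < d.
  have [N _ hN] := near_infty_natSinv_lt (PosNum d0).
  by exists N; apply: (hN N); rewrite /= leqnn.
pose N := N'.+1; have N0 : (0 : R) < N%:R by rewrite ltr0n.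
have jN (j : nat) : (j <= N)%N -> 0 <= (j%:R / N%:R : R) <= 1.
  move=> jN; rewrite divr_ge0 ?ler0n//= ler_pdivrMr// mul1r ler_nat//.
have hq j x y : (j < N)%N -> j%:R / N%:R <= x <= j.+1%:R / N%:R ->
    j%:R / N%:R <= y <= j.+1%:R / N%:R -> `|q x - q y| < e.
  move=> jlt /andP[x1 x2] /andP[y1 y2].
  have /andP[a1 _] := jN j (ltnW jlt); have /andP[_ b2] := jN j.+1 jlt.
  apply: (hd (x, y)); first by split; rewrite /= in_itv/=; apply/andP; split; lra.
  apply: le_lt_trans N'd; rewrite -/N /=.
  have E : j.+1%:R / N%:R - j%:R / N%:R = N%:R^-1 :> R.
    by rewrite -mulrBl -natrB// subSnn mul1r.
  by rewrite ler_norml; apply/andP; split; lra.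
(* On an interval of length 1/N the function [q] varies by less than [e], so [m j] lies above [q]
   there and exceeds its mean by at most 2e. The sum of the [m j / N] is thus at most the integral
   plus 2e, which is below [c] because 4e is the whole slack. *)
pose m (j : nat) := q (j%:R / N%:R) + e.
have hm j : (j < N)%N -> (m j - 2 * e) / N%:R <= F (j.+1%:R / N%:R) - F (j%:R / N%:R).
  move=> jlt; have /andP[a1 _] := jN j (ltnW jlt).
  have E : j.+1%:R / N%:R - j%:R / N%:R = N%:R^-1 :> R.
    by rewrite -mulrBl -natrB// subSnn mul1r.
  have lt : j%:R / N%:R < j.+1%:R / N%:R :> R.
    by rewrite -subr_gt0 E invr_gt0.
  have [z /itvP zi ->] : exists2 z, z \in `](j%:R / N%:R : R), (j.+1%:R / N%:R : R)[%R &
      F (j.+1%:R / N%:R) - F (j%:R / N%:R) = q z * (j.+1%:R / N%:R - j%:R / N%:R).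
    apply: (@MVT _ F q) => //.
      move=> z /itvP zi; apply: dF; apply: lt_trans (_ : j%:R / N%:R < z); last by rewrite zi.
      by lra.
    apply: derivable_within_continuous => z; rewrite in_itv/= => /andP[z0 _].
    by have [] := dF z (lt_le_trans (ltrN10 _) (le_trans a1 z0)).
  rewrite E ler_pM2r ?invr_gt0//.
  have : `|q z - q (j%:R / N%:R)| < e by apply: (hq j) => //; rewrite ?lexx ?zi ?ltW.
  by rewrite /m ltr_norml => /andP[]; lra.
exists N, m, (F 1 - F 0 + 2 * e); split => //.
- by move=> j; rewrite /m ltr_wpDl.
- by apply/andP; split; rewrite /e; lra.
- move=> j x jlt xj.
  have lt : j%:R / N%:R <= j.+1%:R / N%:R :> R.
    by rewrite ler_pM2r ?invr_gt0// ler_nat.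
  have : `|q x - q (j%:R / N%:R)| < e by apply: (hq j) => //; rewrite ?lexx.
  by rewrite /m ltr_norml => /andP[]; lra.
- have : \sum_(0 <= j < N) (m j - 2 * e) / N%:R <= F 1 - F 0.
    have -> : F 1 - F 0 = \sum_(0 <= j < N) (F (j.+1%:R / N%:R) - F (j%:R / N%:R)).
      by rewrite (telescope_sumr (fun j => F (j%:R / N%:R)))// mul0r divff// gt_eqF.
    rewrite !big_nat; apply: ler_sum => j /andP[_ jlt]; exact: hm.
  rewrite -mulr_suml sumrB big_const_nat subn0 iter_addr_0 -mulr_natr ler_pdivrMr//.
  by lra.
Qed.

Lemma smooth_sum (V : normedModType R) (U : set V) n (f : 'I_n -> V -> R) : open U ->
  (forall i, smooth_on U (f i)) -> smooth_on U (fun x => \sum_(i < n) f i x).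
Proof. by move=> oU h k; apply: Ck_sum => // i; exact: h. Qed.

Lemma sum_indicator (N j : nat) : (j <= N)%N ->
  \sum_(i < N) ((i < j)%N%:R : R) = j%:R.
Proof.
move=> jN; rewrite -(big_mkord xpredT (fun i => (i < j)%N%:R)) (@big_cat_nat _ _ _ j)//=.
rewrite [X in _ + X]big1_seq ?addr0; last first.
  by move=> i /=; rewrite mem_index_iota => /andP[ji _]; rewrite ltnNge ji.
rewrite (@eq_big_nat _ _ _ _ _ _ (fun=> 1)); last by move=> i /andP[_ ->].
by rewrite big_const_nat subn0 iter_addr_0.
Qed.

Lemma derive1_near_cst (f : R -> R) (x a : R) : (\near x, f x = a) -> derive1 f x = 0.
Proof.
move=> h; rewrite derive1E (@near_eq_derive _ _ _ f (cst a))// derive_cst//.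
Qed.

(* The interval [j/N, (j+1)/N], on which [q <= m j], is traversed during a time proportional to
   [m j]; the flat ends of the steps make the concatenation smooth. *)
Lemma reparametrization_unit (q : R -> R) (c : R) : continuous q -> (forall x, 0 <= q x) ->
  (\int[lebesgue_measure]_(t in `[0%R, 1%R]) (q t)%:E < c%:E)%E ->
  exists (e : R) (s : R -> R), [/\ 0 < e, smooth_on setT s,
    forall t, t <= e -> s t = 0, forall t, 1 - e <= t -> s t = 1 &
    forall t, [/\ 0 <= s t <= 1, 0 <= derive1 s t & derive1 s t * q (s t) <= c]].
Proof.
move=> cq q0 /(darboux cq q0)[N [m [c' [N0 m0 /andP[c'0 c'c] qm sm]]]].
have NR : (0 : R) < N%:R by rewrite ltr0n.
(* The slack between [c'] and [c] pays for the flat ends: the steps may have slope up to 1 + k = c /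
   c'. *)
have k0 : 0 < c / c' - 1 by rewrite subr_gt0 ltr_pdivlMr// mul1r.
have [h [x [/andP[h0 h2] sx xl xr dx]]] := flat_step k0.
have mx : forall a b, a <= b -> x a <= x b.
  by apply: (nondecreasing_of_derive (fun t => smooth_is_derive t sx)) => t; case/andP: (dx t).
have x01 t : 0 <= x t <= 1.
  apply/andP; split.
    by have [t0|/ltW t0] := leP t h; [rewrite xl|rewrite -(xl h)// mx].
  by have [t0|/ltW t0] := leP (1 - h) t; [rewrite xr|rewrite -(xr (1 - h))// mx].
pose S := \sum_(0 <= j < N) m j.
have S0 : 0 < S.
  rewrite /S; case: N N0 {qm sm NR S} => // N _.
  by rewrite big_nat_recl// ltr_pwDl// sumr_ge0// => i _; exact: ltW.
pose T (j : nat) := (\sum_(0 <= i < j) m i) / S.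
pose tau (j : nat) := m j / S.
have tau0 j : 0 < tau j by exact: divr_gt0.
have TS j : T j.+1 = T j + tau j by rewrite /T big_nat_recr//= mulrDl.
have mT i j : (i <= j)%N -> T i <= T j.
  elim: j => [|j IH]; first by rewrite leqn0 => /eqP ->.
  rewrite leq_eqVlt => /predU1P[->//|]; rewrite ltnS => /IH h'.
  by rewrite TS; apply: le_trans h' _; rewrite lerDl ltW.
have T0 : T 0%N = 0 by rewrite /T big_geq// mul0r.
have TN : T N = 1 by rewrite /T divff// gt_eqF.
have [e e0 etau] : exists2 e, 0 < e & forall i, (i < N)%N -> e <= tau i.
  move: (N); elim=> [|n [e e0 IH]]; first by exists 1.
  exists (Num.min e (tau n)); first by rewrite lt_min e0 tau0.
  by move=> i; rewrite ltnS leq_eqVlt => /predU1P[->|/IH le]; rewrite ge_min ?lexx ?le ?orbT.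
pose y (i : nat) t := (tau i)^-1 * t + - (T i / tau i).
have yE i t : y i t = (t - T i) / tau i by rewrite /y mulrBl mulrC.
(* A staircase of [N] flat steps of height 1/N, the one of index [i] being climbed during
   [T i, T i.+1]; as a finite sum of smooth functions it needs no gluing. *)
pose s t := N%:R^-1 * \sum_(i < N) x (y i t).
have sy i : smooth_on setT (fun t => x (y i t)).
  by apply: smooth_compR => //; exact: smooth_affine.
have ss : smooth_on setT s.
  by apply: smoothM; [exact: openT|exact: smooth_cst|apply: smooth_sum => //; exact: openT].
have ds t : derive1 s t = N%:R^-1 * \sum_(i < N) (tau i)^-1 * derive1 x (y i t).
  have dy i : is_derive t 1 (fun t => x (y i t)) ((tau i)^-1 * derive1 x (y i t)).
    have dyi : is_derive t 1 (y i) (tau i)^-1.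
      rewrite /y -[X in is_derive _ _ _ X]addr0; apply: is_deriveD.
      by rewrite -[X in is_derive _ _ _ X]mulr1; exact: is_deriveZ.
    rewrite mulrC.
    exact: (@is_derive1_comp _ x (y i) t _ _ (smooth_is_derive (y i t) sx) dyi).
  rewrite derive1E /s.
  have H := @is_derive_sum _ _ _ N (fun i t => x (y i t)) t 1 _ (fun i => dy i).
  have H' := is_deriveZ (N%:R^-1) H.
  have [_ E] := H'; apply: etrans E; congr ('D_1 _ t).
  by apply/funext => z /=; rewrite fct_sumE.
have dx0 z : z <= 0 -> derive1 x z = 0.
  move=> z0; apply: (@derive1_near_cst _ _ 0).
  near=> w; apply: xl; apply: ltW; near: w; apply: near_lt; exact: le_lt_trans z0 h0.
have dx1 z : 1 <= z -> derive1 x z = 0.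
  move=> z0; apply: (@derive1_near_cst _ _ 1).
  near=> w; apply: xr; apply: ltW; near: w; apply: near_gt; lra.
have s01 t : 0 <= s t <= 1.
  rewrite /s mulr_ge0 ?invr_ge0 ?ler0n//= ?sumr_ge0//; last by move=> i _; case/andP: (x01 (y i t)).
  rewrite ler_pdivrMl// mulr1 -[leRHS](sum_indicator (leqnn N)).
  by apply: ler_sum => i _; rewrite ltn_ord; case/andP: (x01 (y i t)).
have ds0 t : 0 <= derive1 s t.
  rewrite ds mulr_ge0 ?invr_ge0 ?ler0n// sumr_ge0// => i _.
  by rewrite mulr_ge0 ?invr_ge0 ?(ltW (tau0 _))//; case/andP: (dx (y i t)).
exists (h * e), s; split=> //.
- exact: mulr_gt0.
- move=> t te; rewrite /s big1 ?mulr0// => i _; apply: xl; rewrite yE ler_pdivrMr//.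
  apply: le_trans (_ : t <= _); first by rewrite gerBl -T0 mT.
  by apply: le_trans te _; rewrite ler_pM2l// etau.
- move=> t te; rewrite /s (eq_bigr (fun=> 1)).
    by rewrite sumr_const card_ord mulVf// gt_eqF.
  move=> i _; apply: xr; rewrite yE ler_pdivlMr// mulrBl mul1r.
  have : T i.+1 <= 1 by rewrite -TN mT.
  have : h * e <= h * tau i by rewrite ler_pM2l// etau.
  by rewrite TS; lra.
- move=> t; split=> //.
  (* At a time outside all these intervals every step is either over or not begun, and the
     derivative vanishes. *)
  have [[j jN /andP[tj1 tj2]]|nj] := pselect (exists2 j, (j < N)%N & T j <= t <= T j.+1); last first.
    rewrite ds big1 ?mulr0 ?mul0r; first by rewrite ltW//; exact: lt_trans c'c.
    move=> i _; have [ti|ti] := leP t (T i).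
      by rewrite dx0 ?mulr0// yE pmulr_lle0 ?invr_gt0// subr_le0.
    rewrite dx1 ?mulr0// yE ler_pdivlMr// mul1r.
    have : ~~ (t <= T i.+1).
      by apply/negP => ti'; apply: nj; exists i => //; rewrite ltW.
    by rewrite -ltNge TS; lra.
  have yl (i : 'I_N) : (i < j)%N -> 1 <= y i t.
    move=> ij; rewrite yE ler_pdivlMr// mul1r.
    by have := mT _ _ ij; rewrite TS; lra.
  have yr (i : 'I_N) : (j < i)%N -> y i t <= 0.
    move=> ij; rewrite yE pmulr_lle0 ?invr_gt0// subr_le0.
    by apply: le_trans tj2 _; exact: mT.
  have sj : j%:R / N%:R <= s t <= j.+1%:R / N%:R.
    rewrite /s [_^-1 * _]mulrC !ler_pM2r ?invr_gt0//.
    rewrite -(sum_indicator (ltnW jN)) -(sum_indicator jN).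
    apply/andP; split; apply: ler_sum => i _.
      case: ltnP => ij; last by case/andP: (x01 (y i t)).
      by rewrite xr//; apply: le_trans (yl i ij); lra.
    rewrite ltnS; case: leqP => ij; first by case/andP: (x01 (y i t)).
    by rewrite xl//; apply: le_trans (yr i ij) _; exact: ltW.
  (* Only the step of index [j] moves at time [t]. Multiplied by the bound [m j] for [q], its speed
     gives (c / c') (S / N), and S <= c' N. *)
  have dsj : derive1 s t <= c / c' * S / (N%:R * m j).
    rewrite ds (bigD1 (Ordinal jN))//= big1 ?addr0.
      have /andP[_ h1] := dx (y j t).
      rewrite [leRHS](_ : _ = N%:R^-1 * ((tau j)^-1 * (c / c'))); last first.
        by rewrite /tau invf_div; field; rewrite !gt_eqF.
      rewrite ler_pM2l ?invr_gt0// ler_pM2l ?invr_gt0//.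
      by apply: le_trans h1 _; lra.
    move=> i; rewrite -val_eqE/= neq_ltn => /orP[ij|ij].
      by rewrite dx1 ?mulr0//; exact: yl.
    by rewrite dx0 ?mulr0//; exact: yr.
  apply: le_trans (_ : c / c' * S / (N%:R * m j) * m j <= _).
    by apply: ler_pM => //; exact: qm.
  rewrite [leLHS](_ : _ = c / c' * (S / N%:R)); last by field; rewrite !gt_eqF.
  apply: le_trans (_ : c / c' * c' <= _); last by rewrite divfK// gt_eqF.
  rewrite ler_pM2l ?divr_gt0//; first by rewrite ler_pdivrMr.
  exact: lt_trans c'c.
Unshelve. all: by end_near. Qed.

Lemma reparametrization (q : R -> R) (a b c : R) : continuous q -> (forall x, 0 <= q x) ->
  (\int[lebesgue_measure]_(t in `[0%R, 1%R]) (q t)%:E < c%:E)%E -> a < b ->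
  exists (e : R) (s : R -> R), [/\ 0 < e, smooth_on setT s,
    forall t, t <= a + e -> s t = 0, forall t, b - e <= t -> s t = 1 &
    forall t, [/\ 0 <= s t <= 1, 0 <= derive1 s t & derive1 s t * q (s t) <= c / (b - a)]].
Proof.
move=> cq q0 /(reparametrization_unit cq q0)[e [s [e0 ss s0 s1 hs]]] ab.
have ba : 0 < b - a by rewrite subr_gt0.
pose y t := (b - a)^-1 * t + - (a / (b - a)).
have yE t : y t = (t - a) / (b - a) by rewrite /y mulrBl mulrC.
have sy : smooth_on setT (fun t => s (y t)) by apply: smooth_compR => //; exact: smooth_affine.
have dsy t : derive1 (fun t => s (y t)) t = (b - a)^-1 * derive1 s (y t).
  have dy : is_derive t 1 y (b - a)^-1.
    rewrite /y -[X in is_derive _ _ _ X]addr0; apply: is_deriveD.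
    by rewrite -[X in is_derive _ _ _ X]mulr1; exact: is_deriveZ.
  rewrite derive1E mulrC.
  have H := @is_derive1_comp _ s y t _ _ (smooth_is_derive (y t) ss) dy.
  exact: (@derive_val _ _ _ _ _ _ _ H).
exists (e * (b - a)), (fun t => s (y t)); split.
- exact: mulr_gt0.
- exact: sy.
- by move=> t te; apply: s0; rewrite yE ler_pdivrMr//; lra.
- by move=> t te; apply: s1; rewrite yE ler_pdivlMr// mulrBl mul1r; lra.
- move=> t; have [h1 h2 h3] := hs (y t); rewrite dsy; split; first exact: h1.
    by rewrite mulr_ge0// invr_ge0 ltW.
  by rewrite -mulrA [leRHS]mulrC ler_pM2l// invr_gt0.
Qed.

End Reparametrization.

(** * Smooth families and contact isotopies *)

Section Differentials.
Context {R : realType}.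

Lemma diff_compE (V W Z : normedModType R) (f : V -> W) (g : W -> Z) x v :
  differentiable f x -> differentiable g (f x) ->
  'd (fun y => g (f y)) x v = 'd g (f x) ('d f x v).
Proof. by move=> df dg; rewrite -[LHS]/('d (g \o f) x v) (diff_comp df dg). Qed.

Lemma diff_pairE (V W Z : normedModType R) (f : V -> W) (g : V -> Z) x v :
  differentiable f x -> differentiable g x ->
  'd (fun y => (f y, g y)) x v = ('d f x v, 'd g x v).
Proof. by move=> df dg; rewrite (diff_pair df dg). Qed.

Lemma differentiable_fst (V W : normedModType R) (p : V * W) :
  differentiable (fun p : V * W => p.1) p.
Proof. exact: (smooth_differentiable (@smooth_fst _ _ _ setT)). Qed.

Lemma differentiable_snd (V W : normedModType R) (p : V * W) :
  differentiable (fun p : V * W => p.2) p.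
Proof. exact: (smooth_differentiable (@smooth_snd _ _ _ setT)). Qed.

Lemma diff_fstE (V W : normedModType R) (p q : V * W) :
  'd (fun p : V * W => p.1) p q = q.1.
Proof. by rewrite (diff_lin (f := fst))//= => x; exact: cvg_fst. Qed.

Lemma diff_sndE (V W : normedModType R) (p q : V * W) :
  'd (fun p : V * W => p.2) p q = q.2.
Proof. by rewrite (diff_lin (f := snd))//= => x; exact: cvg_snd. Qed.

Lemma diff_split (V W Z : normedModType R) (G : V * W -> Z) p v w :
  'd G p (v, w) = 'd G p (v, 0) + 'd G p (0, w).
Proof. by rewrite -linearD; congr ('d G p _); congr pair; rewrite ?addr0 ?add0r. Qed.

Lemma diff_graph (V W X Z : normedModType R) (G : V * W -> X) (H : V * X -> Z) p q :
  differentiable G p -> differentiable H (p.1, G p) ->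
  'd (fun p => H (p.1, G p)) p q = 'd H (p.1, G p) (q.1, 'd G p q).
Proof.
move=> dG dH; have d1 := @differentiable_fst V W p.
have dk : differentiable (fun p : V * W => (p.1, G p)) p by exact: differentiable_pair.
by rewrite (diff_compE q dk dH) (diff_pairE q d1 dG) diff_fstE.
Qed.

Lemma diff_time (W Z : normedModType R) (s : R -> R) (G : R * W -> Z) p :
  differentiable s p.1 -> differentiable G (s p.1, p.2) ->
  'd (fun p => G (s p.1, p.2)) p (1, 0) = derive1 s p.1 *: 'd G (s p.1, p.2) (1, 0).
Proof.
move=> ds dG; have d1 := @differentiable_fst R W p; have d2 := @differentiable_snd R W p.
have dsp : differentiable (fun p : R * W => s p.1) p.
  exact: (differentiable_comp d1 ds).
have dk : differentiable (fun p : R * W => (s p.1, p.2)) p by exact: differentiable_pair.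
have E1 : 'd (fun p : R * W => s p.1) p (1, 0) = derive1 s p.1.
  apply: (etrans (diff_compE _ d1 ds)); rewrite diff_fstE deriv1E; last exact/derivable1_diffP.
  by rewrite /GRing.scale /= mul1r.
have E2 : 'd (fun p : R * W => (s p.1, p.2)) p (1, 0) = (derive1 s p.1, 0).
  by apply: (etrans (diff_pairE _ dsp d2)); rewrite E1 diff_sndE.
apply: (etrans (diff_compE _ dk dG)); rewrite E2 -linearZ; congr ('d G _ _).
transitivity (derive1 s p.1 *: (1 : R), derive1 s p.1 *: (0 : W)); last by [].
by rewrite scaler0 /GRing.scale /= mulr1.
Qed.

Lemma diff_slice (W Z : normedModType R) (G : R * W -> Z) (t : R) (w v : W) :
  differentiable G (t, w) ->
  differentiable (fun w => G (t, w)) w /\ 'd (fun w => G (t, w)) w v = 'd G (t, w) (0, v).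
Proof.
move=> dG; have dc : differentiable (fun _ : W => t) w by exact: differentiable_cst.
have di : differentiable (fun w : W => w) w.
  exact: (smooth_differentiable (@smooth_id _ _ setT)).
have dk : differentiable (fun w : W => (t, w)) w by exact: differentiable_pair.
split; first exact: (differentiable_comp dk dG).
rewrite (diff_compE _ dk dG) (diff_pairE _ dc di); congr ('d G _ (_, _)).
  by rewrite -[fun=> t]/(cst t) diff_cst.
by rewrite (diff_lin (f := idfun))//= => ?; exact: cvg_id.
Qed.

Lemma diff_path (W Z : normedModType R) (G : R * W -> Z) (t : R) (w : W) :
  differentiable G (t, w) ->
  differentiable (fun s => G (s, w)) t /\ 'd (fun s => G (s, w)) t 1 = 'd G (t, w) (1, 0).
Proof.
move=> dG; have dc : differentiable (fun _ : R => w) t by exact: differentiable_cst.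
have di : differentiable (fun s : R => s) t.
  exact: (smooth_differentiable (@smooth_id _ _ setT)).
have dk : differentiable (fun s : R => (s, w)) t by exact: differentiable_pair.
split; first exact: (differentiable_comp dk dG).
rewrite (diff_compE _ dk dG) (diff_pairE _ di dc); congr ('d G _ (_, _)).
  by rewrite (diff_lin (f := idfun))//= => ?; exact: cvg_id.
by rewrite -[fun=> w]/(cst w) diff_cst.
Qed.

End Differentials.

Section ProductNeighbourhoods.
Variables (X Y Z : topologicalType).

Lemma near_fst (x : X) (y : Y) (P : set X) : nbhs x P -> \forall q \near (x, y), P q.1.
Proof.
move=> nP; exists (P, setT) => /=; last by move=> q [].
by split=> //; exact: filterT.
Qed.

Lemma near_snd (x : X) (y : Y) (P : set Y) : nbhs y P -> \forall q \near (x, y), P q.2.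
Proof.
move=> nP; exists (setT, P) => /=; last by move=> q [].
by split=> //; exact: filterT.
Qed.

Lemma near_map_snd (k : Y -> Z) (x : X) (y : Y) (P : set (X * Z)) :
  {for y, continuous k} -> nbhs (x, k y) P -> \forall q \near (x, y), P (q.1, k q.2).
Proof.
move=> ck [[P1 P2] [/= n1 n2] PP].
have n2' : nbhs y [set z | P2 (k z)] := ck _ n2.
apply: filterS2 (near_fst y n1) (near_snd x n2') => q q1 q2.
exact: (PP (q.1, k q.2)).
Qed.

Lemma near_map_fst (k : X -> Z) (x : X) (y : Y) (P : set (Z * Y)) :
  {for x, continuous k} -> nbhs (k x, y) P -> \forall q \near (x, y), P (k q.1, q.2).
Proof.
move=> ck [[P1 P2] [/= n1 n2] PP].
have n1' : nbhs x [set z | P1 (k z)] := ck _ n1.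
apply: filterS2 (near_fst y n1') (near_snd x n2) => q q1 q2.
exact: (PP (k q.1, q.2)).
Qed.

End ProductNeighbourhoods.

Lemma open_nbhs_of (X : topologicalType) (x : X) (P : set X) : nbhs x P ->
  exists W, [/\ open W, W x & W `<=` P].
Proof. by rewrite nbhsE => -[W [oW Wx] WP]; exists W. Qed.

Section Manifold.
Context {R : realType} {m : nat} {M : topologicalType} (A : atlas R m M).
Implicit Types (T : set R) (phi psi : R -> M -> M) (f : R -> M -> R) (c : chart A).
Notation V := (R * 'rV[R]_m)%type.

Lemma within_continuousP (X : topologicalType) T (phi : R -> M -> X) :
  {within T `*` [set: M], continuous (fun p : R * M => phi p.1 p.2)} <->
  forall t x, T t -> forall W : set X, open W -> W (phi t x) ->
    \forall q \near (t, x), T q.1 -> W (phi q.1 q.2).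
Proof.
split=> [/subspace_continuousP h t x Tt W oW Wx|h].
  have N : nbhs (t, x) [set q : R * M | (T `*` [set: M]) q -> W (phi q.1 q.2)].
    exact: (h (t, x) (conj Tt I) W (open_nbhs_nbhs (conj oW Wx))).
  by apply: filterS N => q /= h1 Tq; exact: h1.
apply/subspace_continuousP => -[t x] [/= Tt _] W.
rewrite nbhsE => -[W' [oW' W'x] W'W].
have N : nbhs (t, x) [set q : R * M | T q.1 -> W' (phi q.1 q.2)] := h t x Tt W' oW' W'x.
by apply: (filterS _ N) => q hq [/hq /W'W].
Qed.

Lemma param_coord c (u : 'rV[R]_m) : img c u -> coord c (param c u) = u.
Proof. by move=> [x dx <-]; rewrite coordK. Qed.

Lemma param_dom c (u : 'rV[R]_m) : img c u -> dom c (param c u).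
Proof. by move=> [x dx <-]; rewrite coordK. Qed.

Lemma img_coord c x : dom c x -> img c (coord c x).
Proof. by move=> dx; exists x. Qed.

(** Since [T] need not be open, derivatives are taken of a smooth [G] on an open set of R x R^m that
    agrees with the chart expression at times in [T]. Keeping the whole of [U] inside the charts
    lets such expressions be composed. *)
Definition family_rep T phi c c' (U : set V) (G : V -> 'rV[R]_m) :=
  [/\ open U, smooth_on U G & forall s w, T s -> U (s, w) ->
    [/\ img c w, dom c' (phi s (param c w)) & coord c' (phi s (param c w)) = G (s, w)]].

Definition function_rep T f c (U : set V) (G : V -> R) :=
  [/\ open U, smooth_on U G & forall s w, T s -> U (s, w) ->
    img c w /\ f s (param c w) = G (s, w)].

Lemma near_img c (t : R) (u : 'rV[R]_m) : img c u -> \forall q \near (t, u), img c q.2.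
Proof.
by move=> cu; apply: near_snd; apply: open_nbhs_nbhs; split=> //; exact: img_open.
Qed.

(** Continuity of the family is what allows [U] to be shrunk until the images stay in the chart
    [c']. *)
Lemma family_repP T phi :
  smooth_family A T phi <->
  {within T `*` [set: M], continuous (fun p : R * M => phi p.1 p.2)} /\
  forall c c' t u, T t -> img c u -> dom c' (phi t (param c u)) ->
    exists U G, U (t, u) /\ family_rep T phi c c' U G.
Proof.
split=> -[cphi h]; split=> //.
- move=> c c' t u Tt cu c'u.
  have [U [g [oU Utu sg gE]]] := h c c' (t, u) (And3 Tt cu c'u).
  have n1 := (within_continuousP T phi).1 cphi _ _ Tt _ (dom_open c') c'u.
  have n2 : \forall q \near (t, u), T q.1 -> dom c' (phi q.1 (param c q.2)).
    exact: near_map_snd (param_continuous cu) n1.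
  have n3 := near_img t cu.
  have : nbhs (t, u) ([set q | (T q.1 -> dom c' (phi q.1 (param c q.2))) /\ img c q.2] `&` U).
    by apply: filterI; [exact: filterI|exact: open_nbhs_nbhs].
  rewrite nbhsE => -[W [oW Wtu] WU]; exists W, g; split=> //; split=> //.
    by apply: smooth_sub sg => q /WU[].
  move=> s w Ts /WU[[/= /(_ Ts) h1 h2] Uw]; split=> //.
  exact: (gE (s, w)).
- move=> c c' [t u] [/= Tt cu c'u]; have [U [G [Utu [oU sG GE]]]] := h c c' t u Tt cu c'u.
  by exists U, G; split=> // -[s w] [/= Ts _ _] Usw; have [] := GE s w Ts Usw.
Qed.

Lemma function_repP T f : smooth_function A T f <->
  forall c t u, T t -> img c u -> exists U G, U (t, u) /\ function_rep T f c U G.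
Proof.
split=> h.
- move=> c t u Tt cu; have [U [g [oU Utu sg gE]]] := h c (t, u) (conj Tt cu).
  have n3 := near_img t cu.
  have : nbhs (t, u) ([set q | img c q.2] `&` U).
    by apply: filterI => //; exact: open_nbhs_nbhs.
  rewrite nbhsE => -[W [oW Wtu] WU]; exists W, g; split=> //; split=> //.
    by apply: smooth_sub sg => q /WU[].
  by move=> s w Ts /WU[/= h2 Uw]; split=> //; exact: (gE (s, w)).
- move=> c [t u] [/= Tt cu]; have [U [G [Utu [oU sG GE]]]] := h c t u Tt cu.
  by exists U, G; split=> // -[s w] [/= Ts _] Usw; have [] := GE s w Ts Usw.
Qed.

Lemma finite_basis_V : finite_basis (V : normedModType R).
Proof. by apply: finite_basis_pair; [exact: finite_basis_R|exact: finite_basis_rV]. Qed.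

Lemma open_setI_preimage (X Y : topologicalType) (U : set X) (W : set Y) (k : X -> Y) :
  open U -> open W -> (forall x, U x -> {for x, continuous k}) ->
  open (U `&` k @^-1` W).
Proof.
rewrite !openE => oU oW ck x [Ux Wx]; apply: filterI; first exact: oU.
exact: ck _ Ux _ (oW _ Wx).
Qed.

Section Composition.
Variables (T : set R) (c c' c'' : chart A) (psi : R -> M -> M).
Variables (U : set V) (G : V -> 'rV[R]_m).
Hypothesis rG : family_rep T psi c c'' U G.
Let k (p : V) : V := (p.1, G p).

Lemma rep_graph_smooth : smooth_on U k.
Proof.
have [oU sG _] := rG; apply: smooth_pair => //; exact: smooth_fst.
Qed.

Lemma rep_graph_open (U2 : set V) : open U2 -> open (U `&` k @^-1` U2).
Proof.
move=> oU2; have [oU sG _] := rG; apply: open_setI_preimage => // x Ux.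
exact: smooth_continuous rep_graph_smooth Ux.
Qed.

Lemma family_rep_comp phi U2 G2 : family_rep T phi c'' c' U2 G2 ->
  family_rep T (fun t x => phi t (psi t x)) c c' (U `&` k @^-1` U2) (G2 \o k).
Proof.
move=> [oU2 sG2 G2E]; have [oU sG GE] := rG; split.
- exact: rep_graph_open.
- apply: (smooth_comp finite_basis_V (rep_graph_open oU2) _ _ sG2) => [p []//|].
  by apply: smooth_sub rep_graph_smooth => p [].
- move=> s w Ts [Usw U2sw]; have [cw dw E] := GE s w Ts Usw.
  have [c''w] := G2E s _ Ts U2sw.
  by rewrite -E coordK//= E; split.
Qed.

Lemma function_rep_comp f U2 g : function_rep T f c'' U2 g ->
  function_rep T (fun t x => f t (psi t x)) c (U `&` k @^-1` U2) (g \o k).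
Proof.
move=> [oU2 sG2 G2E]; have [oU sG GE] := rG; split.
- exact: rep_graph_open.
- apply: (smooth_comp finite_basis_V (rep_graph_open oU2) _ _ sG2) => [p []//|].
  by apply: smooth_sub rep_graph_smooth => p [].
- move=> s w Ts [Usw U2sw]; have [cw dw E] := GE s w Ts Usw.
  have [c''w] := G2E s _ Ts U2sw.
  by rewrite -E coordK//= E.
Qed.

Lemma diff_rep_comp (W : normedModType R) U2 (G2 : V -> W) p q :
  smooth_on U2 G2 -> U p -> U2 (k p) ->
  'd (G2 \o k) p q = 'd G2 (k p) (q.1, 'd G p q).
Proof.
move=> sG2 Up U2p; have [oU sG GE] := rG.
apply: diff_graph; first exact: smooth_differentiable sG Up.
exact: smooth_differentiable sG2 U2p.
Qed.

End Composition.

Lemma smooth_family_comp T phi psi : smooth_family A T phi -> smooth_family A T psi ->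
  smooth_family A T (fun t x => phi t (psi t x)).
Proof.
move=> /family_repP[c1 r1] /family_repP[c2 r2]; apply/family_repP; split.
  apply/(within_continuousP T (fun t x => phi t (psi t x))) => t x Tt W oW Wx.
  have [[P Q] [/= nP nQ] PQ] := (within_continuousP T phi).1 c1 _ _ Tt _ oW Wx.
  move: nQ; rewrite nbhsE => -[Q' [oQ' Q'x] Q'Q].
  have n2 := (within_continuousP T psi).1 c2 _ _ Tt _ oQ' Q'x.
  have n1 : \forall q \near (t, x), P q.1 by exact: near_fst.
  near=> q => Tq; apply: (PQ (q.1, psi q.1 q.2)) => //; split=> /=.
    by near: q.
  by apply: Q'Q; move: Tq; near: q.
move=> c c' t u Tt cu c'u; have [c'' d''] := dom_cover A (psi t (param c u)).
have [U [G [Utu rG]]] := r2 c c'' t u Tt cu d''.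
have [_ _ GE] := rG; have [_ _ E] := GE t u Tt Utu.
have := r1 c'' c' t (coord c'' (psi t (param c u))) Tt (img_coord d'').
rewrite coordK// => /(_ c'u)[U2 [G2 [U2tu rG2]]].
have H := family_rep_comp rG rG2.
eexists; eexists; split; last exact: H.
by split=> //=; rewrite -E.
Unshelve. all: by end_near. Qed.

Lemma smooth_function_comp T f psi : smooth_function A T f -> smooth_family A T psi ->
  smooth_function A T (fun t x => f t (psi t x)).
Proof.
move=> /function_repP r1 /family_repP[_ r2]; apply/function_repP.
move=> c t u Tt cu; have [c'' d''] := dom_cover A (psi t (param c u)).
have [U [G [Utu rG]]] := r2 c c'' t u Tt cu d''.
have [_ _ GE] := rG; have [_ _ E] := GE t u Tt Utu.
have := r1 c'' t (coord c'' (psi t (param c u))) Tt (img_coord d'').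
move=> [U2 [G2 [U2tu rG2]]].
have H := function_rep_comp rG rG2.
eexists; eexists; split; last exact: H.
by split=> //=; rewrite -E.
Qed.

Lemma smooth_function_op2 T f1 f2 (op : R -> R -> R) :
  (forall (U : set V) g1 g2, open U -> smooth_on U g1 -> smooth_on U g2 ->
    smooth_on U (fun p => op (g1 p) (g2 p))) ->
  smooth_function A T f1 -> smooth_function A T f2 ->
  smooth_function A T (fun t x => op (f1 t x) (f2 t x)).
Proof.
move=> sop /function_repP r1 /function_repP r2; apply/function_repP => c t u Tt cu.
have [U1 [g1 [U1t [oU1 sU1 E1]]]] := r1 c t u Tt cu.
have [U2 [g2 [U2t [oU2 sU2 E2]]]] := r2 c t u Tt cu.
exists (U1 `&` U2), (fun p => op (g1 p) (g2 p)); split=> //; split.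
- exact: openI.
- by apply: sop; [exact: openI|apply: smooth_sub sU1 => p []|apply: smooth_sub sU2 => p []].
- move=> s w Ts [h1 h2]; have [? <-] := E1 s w Ts h1.
  by have [_ <-] := E2 s w Ts h2.
Qed.

Lemma smooth_functionD T f1 f2 : smooth_function A T f1 -> smooth_function A T f2 ->
  smooth_function A T (fun t x => f1 t x + f2 t x).
Proof. by apply: smooth_function_op2 => U g1 g2; exact: smoothD. Qed.

Lemma smooth_functionM T f1 f2 : smooth_function A T f1 -> smooth_function A T f2 ->
  smooth_function A T (fun t x => f1 t x * f2 t x).
Proof. by apply: smooth_function_op2 => U g1 g2; exact: smoothM. Qed.

Lemma smooth_functionN T f : smooth_function A T f ->
  smooth_function A T (fun t x => - f t x).
Proof.
move=> h; apply: (@smooth_function_op2 T f f (fun a _ => - a)) => // U g1 g2 oU h1 _.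
exact: smoothN.
Qed.

Lemma smooth_function_exp T f : smooth_function A T f ->
  smooth_function A T (fun t x => expR (f t x)).
Proof.
move=> h; apply: (@smooth_function_op2 T f f (fun a _ => expR a)) => // U g1 g2 oU h1 _.
apply: (@smooth_comp _ _ _ _ U setT _ _ finite_basis_R) => //.
by apply: smooth_expR; exact: openT.
Qed.

Lemma smooth_function_time T (a : R -> R) : smooth_on setT a ->
  smooth_function A T (fun t _ => a t).
Proof.
move=> sa; apply/function_repP => c t u Tt cu.
have oI : open [set p : V | img c p.2].
  by apply: open_comp => [p _|]; [exact: cvg_snd|exact: img_open].
exists [set p | img c p.2], (fun p => a p.1); split=> //; split=> //.
apply: (@smooth_comp _ _ _ _ _ setT _ _ finite_basis_R) => //.
exact: smooth_fst.
Qed.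

Lemma smooth_family_local T phi :
  (forall t, T t -> exists e T' psi, [/\ 0 < e, smooth_family A T' psi &
    forall s, T s -> `|s - t| < e -> T' s /\ phi s = psi s]) ->
  smooth_family A T phi.
Proof.
move=> h; have nt (t e : R) (X : topologicalType) (x : X) : 0 < e ->
    \forall q \near (t, x), `|q.1 - t| < e.
  move=> e0; apply: (@near_fst _ _ _ _ (fun s => `|s - t| < e)).
  by near=> s; rewrite distrC; near: s; apply: cvgr_dist_lt e0; exact: cvg_id.
apply/family_repP; split.
  apply/within_continuousP => t x Tt W oW Wx.
  have [e [T' [psi [e0 /family_repP[cpsi _] E]]]] := h t Tt.
  have [T't Et] := E t Tt ltac:(by rewrite subrr normr0).
  have n := nt t e M x e0.
  rewrite Et in Wx.
  have := (within_continuousP T' psi).1 cpsi _ _ T't _ oW Wx.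
  apply: filterS2 n => q q1 q2 Tq.
  by have [T'q ->] := E _ Tq q1; exact: q2.
move=> c c' t u Tt cu c'u.
have [e [T' [psi [e0 /family_repP[_ rpsi] E]]]] := h t Tt.
have [T't Et] := E t Tt ltac:(by rewrite subrr normr0).
rewrite Et in c'u; have [U [G [Utu [oU sG GE]]]] := rpsi c c' t u T't cu c'u.
have : nbhs (t, u) (U `&` [set q | `|q.1 - t| < e]).
  by apply: filterI; [exact: open_nbhs_nbhs|exact: nt].
rewrite nbhsE => -[W [oW Wt] WU]; exists W, G; split=> //; split=> //.
  by apply: smooth_sub sG => p /WU[].
by move=> s w Ts /WU[/= Usw sw]; have [T's ->] := E s Ts sw; exact: GE.
Unshelve. all: by end_near. Qed.

Lemma smooth_function_local T f :
  (forall t, T t -> exists e T' g, [/\ 0 < e, smooth_function A T' g &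
    forall s, T s -> `|s - t| < e -> T' s /\ f s = g s]) ->
  smooth_function A T f.
Proof.
move=> h; apply/function_repP => c t u Tt cu.
have [e [T' [psi [e0 /function_repP rpsi E]]]] := h t Tt.
have [T't Et] := E t Tt ltac:(by rewrite subrr normr0).
have [U [G [Utu [oU sG GE]]]] := rpsi c t u T't cu.
have nt : \forall q \near (t, u), `|q.1 - t| < e.
  apply: (@near_fst _ _ _ _ (fun s => `|s - t| < e)).
  by near=> s; rewrite distrC; near: s; apply: cvgr_dist_lt e0; exact: cvg_id.
have : nbhs (t, u) (U `&` [set q | `|q.1 - t| < e]).
  by apply: filterI; [exact: open_nbhs_nbhs|exact: nt].
rewrite nbhsE => -[W [oW Wt] WU]; exists W, G; split=> //; split=> //.
  by apply: smooth_sub sG => p /WU[].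
by move=> s w Ts /WU[/= Usw sw]; have [T's ->] := E s Ts sw; exact: GE.
Unshelve. all: by end_near. Qed.

Section TimeChange.
Variables (T T' : set R) (s : R -> R).
Hypotheses (ss : smooth_on setT s) (sT : forall t, T' t -> T (s t)).
Let k (p : V) : V := (s p.1, p.2).

Lemma time_change_smooth (U : set V) : open U -> smooth_on U k.
Proof.
move=> oU; apply: smooth_pair => //; last exact: smooth_snd.
apply: (@smooth_comp _ _ _ _ _ setT _ _ finite_basis_R) => //.
exact: smooth_fst.
Qed.

Lemma time_change_open (U : set V) : open U -> open (k @^-1` U).
Proof.
move=> oU; apply: open_comp => // p _.
exact: (smooth_continuous (time_change_smooth openT)).
Qed.

Lemma family_rep_time phi c c' U G : family_rep T phi c c' U G ->
  family_rep T' (fun t => phi (s t)) c c' (k @^-1` U) (G \o k).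
Proof.
move=> [oU sG GE]; split; first exact: time_change_open.
- apply: (@smooth_comp _ _ _ _ _ U _ _ finite_basis_V) => //.
    exact: time_change_open.
  by apply: time_change_smooth; exact: time_change_open.
- by move=> t w T't Usw; apply: GE => //; exact: sT.
Qed.

Lemma smooth_family_time phi : smooth_family A T phi ->
  smooth_family A T' (fun t => phi (s t)).
Proof.
move=> /family_repP[c1 r1]; apply/family_repP; split.
  apply/(within_continuousP T' (fun t => phi (s t))) => t x Tt W oW Wx.
  have n1 := (within_continuousP T phi).1 c1 _ _ (sT Tt) _ oW Wx.
  have ct : {for t, continuous s} by exact: smooth_cts.
  have cs := near_map_fst ct n1.
  by apply: filterS cs => q /= h /sT.
move=> c c' t u Tt cu c'u.
have [U [G [Utu rG]]] := r1 c c' (s t) u (sT Tt) cu c'u.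
by eexists; eexists; split; last exact: family_rep_time rG.
Qed.

Lemma smooth_function_reparam f : smooth_function A T f ->
  smooth_function A T' (fun t => f (s t)).
Proof.
move=> /function_repP r; apply/function_repP => c t u Tt cu.
have [U [G [Utu [oU sG GE]]]] := r c (s t) u (sT Tt) cu.
exists (k @^-1` U), (G \o k); split=> //; split; first exact: time_change_open.
- apply: (@smooth_comp _ _ _ _ _ U _ _ finite_basis_V) => //.
    exact: time_change_open.
  by apply: time_change_smooth; exact: time_change_open.
- by move=> s' w T't Usw; apply: GE => //; exact: sT.
Qed.

Lemma diff_time_change (W : normedModType R) U (G : V -> W) p :
  smooth_on U G -> U (k p) ->
  'd (G \o k) p (1, 0) = derive1 s p.1 *: 'd G (k p) (1, 0).
Proof.
move=> sG Up; apply: diff_time; last exact: smooth_differentiable sG Up.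
by apply/derivable1_diffP; have [] := smooth_is_derive p.1 ss.
Qed.

End TimeChange.

End Manifold.

(** * Time and space derivatives of a family in charts *)

Section TimeDerivative.
Context {R : realType}.

Lemma difference_quotient (W : normedModType R) (f : R -> W) (t : R) : differentiable f t ->
  (s - t)^-1 *: (f s - f t) @[s --> t^'] --> 'd f t 1.
Proof.
move=> df; have dv : derivable f t 1 by exact: diff_derivable.
have := dv; rewrite -(@deriveE _ _ _ f t 1 df) => /cvg_ex[l hl].
have -> : 'D_1 f t = l by exact: cvg_lim.
have c : (s - t) @[s --> t^'] --> (0 : R)^'.
  move=> P nP; have nP' : nbhs (0 : R) [set h | h != 0 -> P h] := nP.
  have c0 : (s - t) @[s --> t] --> (0 : R).
    by rewrite -[X in _ --> X](subrr t); apply: cvgB; [exact: cvg_id|exact: cvg_cst].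
  have h : nbhs t [set s | s - t != 0 -> P (s - t)] := c0 _ nP'.
  change (nbhs t [set s | s != t -> P (s - t)]).
  by apply: filterS h => s hs st; apply: hs; rewrite subr_eq0.
have := cvg_comp _ _ c hl; apply: cvg_trans; apply: near_eq_cvg.
by near=> s; rewrite /= /GRing.scale /= mulr1 subrK.
Unshelve. all: by end_near. Qed.

(** This makes the possibly one-sided limits in [contact_hamiltonian] unique, so that the vector
    there, given only by existence, is the time derivative of any chart expression. *)
Lemma within01_proper (t : R) : t \in `[0, 1] -> ProperFilter (within `[(0:R), 1] t^').
Proof.
move=> t01; apply: Build_ProperFilter_ex => P.
rewrite /dnbhs /within /= => /nbhs_ballP[e /= e0 he].
move: t01; rewrite in_itv/= => /andP[t0 t1].
pose d := Num.min e 1 / 2.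
have d0 : 0 < d by rewrite divr_gt0// lt_min e0 ltr01.
have de : d < e.
  have : Num.min e 1 <= e by rewrite ge_min lexx.
  have : 0 < Num.min e 1 by rewrite lt_min e0 ltr01.
  by rewrite /d; lra.
have d1 : d <= 1 / 2.
  have : Num.min e 1 <= 1 by rewrite ge_min lexx orbT.
  by rewrite /d; lra.
pose s := if t <= 1 / 2 then t + d else t - d.
have std : `|t - s| = d.
  rewrite /s; case: ifP => _; first by rewrite opprD addNKr normrN gtr0_norm.
  by rewrite opprB addrCA subrr addr0 gtr0_norm.
exists s; apply: he.
- by rewrite /ball /= std.
- by rewrite -subr_eq0 -normr_eq0 distrC std gt_eqF.
- rewrite in_itv/= /s; case: (leP t (1 / 2)) => h; apply/andP; split; lra.
Qed.

End TimeDerivative.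

Section Pairing.
Context {R : realType} {m : nat}.
Implicit Types a v w : 'rV[R]_m.

Lemma pairingD a v w : pairing a (v + w) = pairing a v + pairing a w.
Proof. by rewrite /pairing -big_split/=; apply: eq_bigr => i _; rewrite mxE mulrDr. Qed.

Lemma pairingZ a k v : pairing a (k *: v) = k * pairing a v.
Proof. by rewrite /pairing mulr_sumr; apply: eq_bigr => i _; rewrite mxE mulrCA. Qed.

Lemma pairing0 a : pairing a 0 = 0.
Proof. by rewrite -(scale0r 0) pairingZ mul0r. Qed.

End Pairing.

Section FamilyDerivatives.
Context {R : realType} {m : nat} {M : ptopologicalType} (A : atlas R m M).
Notation V := (R * 'rV[R]_m)%type.
Notation I01 := [set` `[(0 : R), 1]].

Lemma rep_spatial (T : set R) (phi : R -> M -> M) (c c' : chart A) (U : set V) G (t : R) u v :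
  family_rep T phi c c' U G -> T t -> U (t, u) ->
  'D_v (fun w => coord c' (phi t (param c w))) u = 'd G (t, u) (0, v).
Proof.
move=> [oU sG GE] Tt Utu.
have dG := smooth_differentiable sG Utu.
have [d1 <-] := diff_slice v dG; rewrite -deriveE//; apply: near_eq_derive.
have : \forall w \near u, U (t, w).
  have : nbhs (t, u) U by exact: open_nbhs_nbhs.
  move=> [[P Q] [/= nP nQ] PQ]; apply: filterS nQ => w Qw; apply: PQ; split=> //=.
  exact: nbhs_singleton.
by apply: filterS => w Uw; have [] := GE t w Tt Uw.
Qed.

Lemma rep_time (phi : R -> M -> M) (c c' : chart A) (U : set V) G (t : R) u :
  family_rep I01 phi c c' U G -> t \in `[0, 1] -> U (t, u) ->
  (s - t)^-1 *: (coord c' (phi s (param c u)) - coord c' (phi t (param c u)))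
    @[s --> within `[0, 1] t^'] --> 'd G (t, u) (1, 0).
Proof.
move=> [oU sG GE] Tt Utu.
have dG := smooth_differentiable sG Utu.
have [d1 <-] := diff_path dG.
have h : (s - t)^-1 *: (G (s, u) - G (t, u)) @[s --> within `[0, 1] t^'] --> 'd (fun s => G (s, u)) t 1.
  apply: (@cvg_trans _ ((s - t)^-1 *: (G (s, u) - G (t, u)) @[s --> t^'])).
    by apply: cvg_app; exact: cvg_within.
  exact: difference_quotient d1.
apply: cvg_trans h; apply: near_eq_cvg.
have nU : \forall s \near t, U (s, u).
  have : nbhs (t, u) U by exact: open_nbhs_nbhs.
  move=> [[P Q] [/= nP nQ] PQ]; apply: filterS nP => w Pw; apply: PQ; split=> //=.
  exact: nbhs_singleton.
have [_ _ ->] := GE t u Tt Utu.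
rewrite /dnbhs; apply: filterS nU => s Us _ s01.
by have [_ _ ->] := GE s u s01 Us.
Qed.

Lemma rep_time_unique (phi : R -> M -> M) (c c' : chart A) (U : set V) G (t : R) u w :
  family_rep I01 phi c c' U G -> t \in `[0, 1] -> U (t, u) ->
  (s - t)^-1 *: (coord c' (phi s (param c u)) - coord c' (phi t (param c u)))
    @[s --> within `[0, 1] t^'] --> w -> w = 'd G (t, u) (1, 0).
Proof.
move=> rG Tt Utu hw; have := rep_time rG Tt Utu.
have pf := within01_proper Tt.
exact: (@cvg_unique _ (@norm_hausdorff R 'rV[R]_m) _ (fmap_proper_filter _ pf) _ _ hw).
Qed.

Variable alpha : one_form A.

Lemma conformal_rep (Phi : isotopy R M) h (c c' : chart A) (U : set V) G (t : R) u v :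
  conformal_factor alpha Phi h -> family_rep I01 (fwd Phi) c c' U G ->
  t \in `[0, 1] -> U (t, u) ->
  pairing (form_coef alpha c' (G (t, u))) ('d G (t, u) (0, v)) =
  expR (h t (param c u)) * pairing (form_coef alpha c u) v.
Proof.
move=> hc rG Tt Utu; have [_ _ GE] := rG; have [cu c'u E] := GE t u Tt Utu.
by rewrite -(hc t c c' u v)// -E -(rep_spatial v rG Tt Utu).
Qed.

Lemma conformal_of_rep (Phi : isotopy R M) h :
  (forall (t : R) (c c' : chart A) u, t \in `[0, 1] -> img c u -> dom c' (fwd Phi t (param c u)) ->
    exists (U : set V) G, [/\ U (t, u), family_rep I01 (fwd Phi) c c' U G &
    forall v, pairing (form_coef alpha c' (G (t, u))) ('d G (t, u) (0, v)) =
      expR (h t (param c u)) * pairing (form_coef alpha c u) v]) ->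
  conformal_factor alpha Phi h.
Proof.
move=> hr t c c' u v Tt cu c'u; have [U [G [Utu rG <-]]] := hr t c c' u Tt cu c'u.
have [_ _ GE] := rG; have [_ _ E] := GE t u Tt Utu.
by rewrite -E -(rep_spatial v rG Tt Utu).
Qed.

Lemma hamiltonian_rep (Phi : isotopy R M) H (c c' : chart A) (U : set V) G (t : R) u :
  contact_hamiltonian alpha Phi H -> family_rep I01 (fwd Phi) c c' U G ->
  t \in `[0, 1] -> U (t, u) ->
  H t (fwd Phi t (param c u)) = pairing (form_coef alpha c' (G (t, u))) ('d G (t, u) (1, 0)).
Proof.
move=> hH rG Tt Utu; have [_ _ GE] := rG; have [cu c'u E] := GE t u Tt Utu.
have [w hw ->] := hH t (param c u) c' Tt c'u.
by rewrite E (rep_time_unique rG Tt Utu hw).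
Qed.

Lemma hamiltonian_of_rep (Phi : isotopy R M) H :
  (forall (t : R) x (c' : chart A), t \in `[0, 1] -> dom c' (fwd Phi t x) ->
    exists (c : chart A) (U : set V) G, [/\ dom c x, U (t, coord c x),
      family_rep I01 (fwd Phi) c c' U G &
      H t (fwd Phi t x) = pairing (form_coef alpha c' (G (t, coord c x)))
        ('d G (t, coord c x) (1, 0))]) ->
  contact_hamiltonian alpha Phi H.
Proof.
move=> hr t x c' Tt c'x; have [c [U [G [cx Utu rG E]]]] := hr t x c' Tt c'x.
exists ('d G (t, coord c x) (1, 0)).
  by have := rep_time rG Tt Utu; rewrite coordK.
have [_ _ GE] := rG; have [_ _ EG] := GE t (coord c x) Tt Utu.
by rewrite E -EG coordK.
Qed.

End FamilyDerivatives.

(* The data of a contact isotopy at one time: the diffeomorphism, its inverse, the Hamiltonian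
   and the conformal factor. *)
Record slice (R : realType) (M : Type) := Slice {
  sfwd : M -> M; sbwd : M -> M; sham : M -> R; sconf : M -> R }.

(** * Composition, inversion, reparametrization and gluing of contact isotopies *)

Section ContactPaths.
Context {R : realType} {m : nat} {M : ptopologicalType} (A : atlas R m M).
Variable alpha : one_form A.
Notation V := (R * 'rV[R]_m)%type.
Notation I01 := [set` `[(0 : R), 1]].
Implicit Types X Y : R -> slice R M.

Definition path_isotopy X : isotopy R M :=
  Isotopy (fun t => sfwd (X t)) (fun t => sbwd (X t)).

Definition contact_path X :=
  [/\ isotopy_inverse (path_isotopy X),
      smooth_family A I01 (fun t => sfwd (X t)) /\ smooth_family A I01 (fun t => sbwd (X t)),
      smooth_function A I01 (fun t => sham (X t)), smooth_function A I01 (fun t => sconf (X t))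
    & contact_hamiltonian alpha (path_isotopy X) (fun t => sham (X t)) /\
      conformal_factor alpha (path_isotopy X) (fun t => sconf (X t))].

(** The vector field of phi_t psi_t is that of phi_t plus the image under phi_t of that of psi_t; on
    the latter alpha takes the value e^h times the Hamiltonian of psi, both transported by phi_t.
    The conformal factors add up as in a cocycle. *)
Definition path_comp X Y (t : R) : slice R M :=
  Slice (fun x => sfwd (X t) (sfwd (Y t) x)) (fun x => sbwd (Y t) (sbwd (X t) x))
    (fun x => sham (X t) x + expR (sconf (X t) (sbwd (X t) x)) * sham (Y t) (sbwd (X t) x))
    (fun x => sconf (Y t) x + sconf (X t) (sfwd (Y t) x)).

(** These are the formulas that make the composition with [X] have Hamiltonian and conformal factor
    0. *)
Definition path_inv X (t : R) : slice R M :=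
  Slice (sbwd (X t)) (sfwd (X t))
    (fun x => - (expR (- sconf (X t) x) * sham (X t) (sfwd (X t) x)))
    (fun x => - sconf (X t) (sbwd (X t) x)).

Definition path_reparam (s : R -> R) X (t : R) : slice R M :=
  Slice (sfwd (X (s t))) (sbwd (X (s t))) (fun x => derive1 s t * sham (X (s t)) x)
    (sconf (X (s t))).

Lemma contact_path_comp X Y : contact_path X -> contact_path Y -> contact_path (path_comp X Y).
Proof.
move=> [iX [fX bX] HX hX [cHX chX]] [iY [fY bY] HY hY [cHY chY]].
have [_ rX] := (family_repP _ _ _).1 fX; have [_ rY] := (family_repP _ _ _).1 fY.
have key (t : R) (c c' : chart A) u : t \in `[0, 1] -> img c u ->
    dom c' (sfwd (X t) (sfwd (Y t) (param c u))) ->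
    exists c'' U1 G1 U2 G2, [/\ U1 (t, u), U2 (t, G1 (t, u)),
      family_rep I01 (fun t => sfwd (Y t)) c c'' U1 G1,
      family_rep I01 (fun t => sfwd (X t)) c'' c' U2 G2 &
      param c'' (G1 (t, u)) = sfwd (Y t) (param c u)].
  move=> Tt cu c'u; have [c'' d''] := dom_cover A (sfwd (Y t) (param c u)).
  have [U [G [Utu rG]]] := rY c c'' t u Tt cu d''.
  have [_ _ GE] := rG; have [_ _ E] := GE t u Tt Utu.
  have := rX c'' c' t (coord c'' (sfwd (Y t) (param c u))) Tt (img_coord d'').
  rewrite coordK// => /(_ c'u)[U2 [G2 [U2tu rG2]]].
  by exists c'', U, G, U2, G2; split=> //; rewrite -E ?coordK.
split.
- move=> t t01; have [a1 a2] := iX t t01; have [b1 b2] := iY t t01.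
  move: a1 a2 b1 b2; rewrite /cancel /= => a1 a2 b1 b2.
  by split=> x; [rewrite a1 b1|rewrite b2 a2].
- by split; [exact: (smooth_family_comp fX fY)|exact: (smooth_family_comp bY bX)].
- apply: smooth_functionD => //; apply: smooth_functionM.
    exact: (smooth_function_exp (smooth_function_comp hX bX)).
  exact: (smooth_function_comp HY bX).
- exact: (smooth_functionD hY (smooth_function_comp hX fY)).
- split.
  + apply: hamiltonian_of_rep => t x c' t01 /= d'.
    have [c dx] := dom_cover A x; have cu := img_coord dx.
    have := key t c c' _ t01 cu; rewrite coordK// => /(_ d').
    move=> [c'' [U1 [G1 [U2 [G2 [h1 h2 r1 r2 E1]]]]]].
    have rr := family_rep_comp r1 r2.
    have [_ sG1 _] := r1; have [_ sG2 _] := r2.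
    have D := diff_rep_comp r1 (1, 0) sG2 h1 h2.
    exists c, (U1 `&` (fun p : V => (p.1, G1 p)) @^-1` U2), (G2 \o (fun p : V => (p.1, G1 p))).
    split=> //; apply: etrans (congr1 (pairing (form_coef alpha c' (G2 (t, G1 (t, coord c x))))) (esym D)).
    (* The time derivative of the composition splits into a pure time direction, measured by the
       Hamiltonian of [X], and a space direction, on which the conformal factor of [X] acts. *)
    rewrite /= diff_split pairingD.
    rewrite -(hamiltonian_rep cHX r2 t01 h2) (conformal_rep _ chX r2 t01 h2).
    rewrite -(hamiltonian_rep cHY r1 t01 h1) E1 /= !coordK//.
    by have [a1 _] := iX t t01; rewrite [sbwd _ _]a1.
  + apply: conformal_of_rep => t c c' u t01 cu /= d'.
    have [c'' [U1 [G1 [U2 [G2 [h1 h2 r1 r2 E1]]]]]] := key t c c' u t01 cu d'.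
    have rr := family_rep_comp r1 r2.
    exists (U1 `&` (fun p : V => (p.1, G1 p)) @^-1` U2), (G2 \o (fun p : V => (p.1, G1 p))).
    split=> // v; have [_ sG1 _] := r1; have [_ sG2 _] := r2.
    have D := diff_rep_comp r1 (0, v) sG2 h1 h2.
    apply: (etrans (congr1 (pairing (form_coef alpha c' (G2 (t, G1 (t, u))))) D)).
    by rewrite /= (conformal_rep _ chX r2 t01 h2) (conformal_rep _ chY r1 t01 h1) E1 /= addrC expRD mulrA.
Qed.

Lemma contact_path_inv X : contact_path X -> contact_path (path_inv X).
Proof.
move=> [iX [fX bX] HX hX [cHX chX]].
have [_ rX] := (family_repP _ _ _).1 fX; have [_ rY] := (family_repP _ _ _).1 bX.
have key (t : R) (c c' : chart A) u : t \in `[0, 1] -> img c u ->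
    dom c' (sbwd (X t) (param c u)) ->
    exists U1 G1 U2 G2, [/\ U1 (t, u), U2 (t, G1 (t, u)),
      family_rep I01 (fun t => sbwd (X t)) c c' U1 G1,
      family_rep I01 (fun t => sfwd (X t)) c' c U2 G2 &
      param c' (G1 (t, u)) = sbwd (X t) (param c u)].
  move=> Tt cu c'u; have [U [G [Utu rG]]] := rY c c' t u Tt cu c'u.
  have [_ _ GE] := rG; have [_ _ E] := GE t u Tt Utu.
  have := rX c' c t (coord c' (sbwd (X t) (param c u))) Tt (img_coord c'u).
  have [_ a2] := iX t Tt.
  rewrite coordK// [sfwd _ _]a2 => /(_ (param_dom cu))[U2 [G2 [U2tu rG2]]].
  by exists U, G, U2, G2; split=> //; rewrite -E ?coordK.
split.
- by move=> t t01; have [a1 a2] := iX t t01; split.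
- by split.
- apply: smooth_functionN; apply: smooth_functionM.
    by apply: smooth_function_exp; exact: smooth_functionN.
  exact: (smooth_function_comp HX fX).
- exact: (smooth_functionN (smooth_function_comp hX bX)).
- split.
  + apply: hamiltonian_of_rep => t x c' t01 /= d'.
    have [c dx] := dom_cover A x; have cu := img_coord dx.
    have := key t c c' _ t01 cu; rewrite coordK// => /(_ d').
    move=> [U1 [G1 [U2 [G2 [h1 h2 r1 r2 E1]]]]].
    have rr := family_rep_comp r1 r2; exists c, U1, G1; split=> //.
    have [_ sG1 _] := r1; have [_ sG2 _] := r2; have [_ a2] := iX t t01.
    (* The map followed by its inverse is constant in time, so its time derivative is 0; splitting
       this derivative as for a composition and pairing with the form gives an equation for the
       Hamiltonian of the inverse. *)
    have z : 0 = 'd (G2 \o (fun p => (p.1, G1 p))) (t, coord c x) (1, 0).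
      apply: (rep_time_unique rr t01) => //.
      apply: (@cvg_trans _ (cst 0 @ (within `[0, 1] t^'))); last exact: cvg_cst.
      have n : \forall s \near t, True by exact: filterT.
      apply: near_eq_cvg; rewrite /dnbhs; apply: filterS n => s _ _ s01.
      have [_ b2] := iX s s01.
      by rewrite [sfwd (X s) _]b2 [sfwd (X t) _]a2 subrr scaler0.
    have {z} := etrans (etrans z (diff_rep_comp r1 (1, 0) sG2 h1 h2)) (diff_split _ _ _ _).
    rewrite /=.
    move=> /(congr1 (pairing (form_coef alpha c (G2 (t, G1 (t, coord c x)))))).
    rewrite pairing0 pairingD.
    rewrite -(hamiltonian_rep cHX r2 t01 h2) (conformal_rep _ chX r2 t01 h2).
    rewrite !E1 /= [sfwd _ _]a2 => z.
    rewrite expRN; set e := expR _ in z *; set P := pairing _ _ in z *.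
    have -> : sham (X t) x = - (e * P) by apply/eqP; rewrite -addr_eq0 -z.
    by rewrite mulrN opprK mulKf// gt_eqF// expR_gt0.
  + apply: conformal_of_rep => t c c' u t01 cu /= d'.
    have [U1 [G1 [U2 [G2 [h1 h2 r1 r2 E1]]]]] := key t c c' u t01 cu d'.
    have rr := family_rep_comp r1 r2; exists U1, G1; split=> // v.
    have [oU1 sG1 _] := r1; have [_ sG2 _] := r2; have [_ a2] := iX t t01.
    have H := conformal_rep ('d G1 (t, u) (0, v)) chX r2 t01 h2.
    (* The space differentials of the inverse and of the map compose to the identity; the conformal
       equation of [X] at the image vector can then be solved for that of the inverse. *)
    have Ed : 'd G2 (t, G1 (t, u)) (0, 'd G1 (t, u) (0, v)) = v.
      have := rep_spatial v rr t01 (conj h1 h2).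
      move=> Ev; have {}Ev := etrans Ev (diff_rep_comp r1 (0, v) sG2 h1 h2).
      apply: (etrans (esym Ev)); rewrite -[RHS](derive_id u v); apply: near_eq_derive.
      have : \forall w \near u, img c w by apply: open_nbhs_nbhs; split=> //; exact: img_open.
      by apply: filterS => w cw; rewrite [sfwd _ _]a2 param_coord.
    have {H} := etrans (congr1 (pairing _) (esym Ed)) H.
    have [_ _ GE2] := r2; have [_ _ <-] := GE2 t _ t01 h2.
    rewrite E1 /= [sfwd _ _]a2 param_coord// => ->.
    by rewrite mulrA -expRD addrC subrr expR0 mul1r.
Qed.

Lemma contact_path_reparam (s : R -> R) X : smooth_on setT s ->
  (forall t, t \in `[(0 : R), 1] -> s t \in `[(0 : R), 1]) ->
  contact_path X -> contact_path (path_reparam s X).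
Proof.
move=> ss s01 [iX [fX bX] HX hX [cHX chX]].
have [_ rX] := (family_repP _ _ _).1 fX.
split.
- by move=> t t01; exact: iX (s01 t t01).
- by split; [exact: (smooth_family_time ss s01 fX)|exact: (smooth_family_time ss s01 bX)].
- apply: smooth_functionM; last exact: (smooth_function_reparam ss s01 HX).
  by apply: smooth_function_time; exact: smooth_derive1.
- exact: (smooth_function_reparam ss s01 hX).
- split.
  + apply: hamiltonian_of_rep => t x c' t01 /= d'.
    have [c dx] := dom_cover A x; have cu := img_coord dx.
    have := rX c c' (s t) (coord c x) (s01 t t01) cu; rewrite coordK// => /(_ d').
    move=> [U [G [Utu rG]]]; have [_ sG _] := rG.
    have rr := family_rep_time ss s01 rG.
    exists c, ((fun p => (s p.1, p.2)) @^-1` U), (G \o (fun p => (s p.1, p.2))); split=> //.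
    rewrite (diff_time_change ss (p := (t, coord c x)) sG Utu) pairingZ /=.
    by rewrite -(hamiltonian_rep cHX rG (s01 t t01) Utu)/= coordK.
  + by move=> t c c' u v t01; exact: chX (s01 t t01).
Qed.

Lemma contact_path_local X : (forall t, t \in `[(0 : R), 1] -> exists e Y,
    [/\ 0 < e, contact_path Y & forall s, s \in `[(0 : R), 1] -> `|s - t| < e -> X s = Y s]) ->
  contact_path X.
Proof.
move=> h; have tt (t e : R) : 0 < e -> `|t - t| < e by rewrite subrr normr0.
split.
- move=> t t01; have [e [Y [e0 [iY _ _ _ _] E]]] := h t t01.
  have := iY t t01; by rewrite /path_isotopy/= E// tt.
- split; apply: smooth_family_local => t t01; have [e [Y [e0 [_ [fY bY] _ _ _] E]]] := h t t01.
    by exists e, I01, (fun t => sfwd (Y t)); split=> // s s01 st; rewrite E.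
  by exists e, I01, (fun t => sbwd (Y t)); split=> // s s01 st; rewrite E.
- apply: smooth_function_local => t t01; have [e [Y [e0 [_ _ HY _ _] E]]] := h t t01.
  by exists e, I01, (fun t => sham (Y t)); split=> // s s01 st; rewrite E.
- apply: smooth_function_local => t t01; have [e [Y [e0 [_ _ _ hY _] E]]] := h t t01.
  by exists e, I01, (fun t => sconf (Y t)); split=> // s s01 st; rewrite E.
- split.
  + move=> t x c t01 /= cx; have [e [Y [e0 [_ _ _ _ [cHY _]] E]]] := h t t01.
    rewrite E ?tt// in cx *; have [w hw ->] := cHY t x c t01 cx; exists w => //.
    apply: cvg_trans hw; apply: near_eq_cvg; rewrite /dnbhs.
    have n : \forall s \near t, `|s - t| < e.
      by near=> s; rewrite distrC; near: s; apply: cvgr_dist_lt e0; exact: cvg_id.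
    by apply: filterS n => s st _ s01; rewrite /path_isotopy /= E.
  + move=> t c c' u v t01 cu /= c'u; have [e [Y [e0 [_ _ _ _ [_ chY]] E]]] := h t t01.
    by rewrite E ?tt// in c'u *; exact: chY.
Unshelve. all: by end_near. Qed.

End ContactPaths.

(** * The Riemannian distance *)

(** The integral of a nonnegative function is a supremum over the simple functions below it, hence
    monotone whether or not the functions are measurable. It serves for speeds of curves, iterated
    integrals and norms of Hamiltonians alike. *)
Lemma ge0_le_integral_nonmeasurable d (T : measurableType d) (R : realType)
    (mu : {measure set T -> \bar R}) (D : set T) (f1 f2 : T -> \bar R) :
  (forall x, D x -> (0 <= f1 x)%E) -> (forall x, D x -> (f1 x <= f2 x)%E) ->
  (\int[mu]_(x in D) f1 x <= \int[mu]_(x in D) f2 x)%E.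
Proof.
move=> f10 f12; have f20 x : D x -> (0 <= f2 x)%E.
  by move=> Dx; apply: le_trans (f12 x Dx); exact: f10.
rewrite !ge0_integralE//; apply: le_ereal_sup.
apply: image_subset => h hf x; apply: le_trans (hf x) _.
by rewrite /patch; case: ifPn => //; rewrite inE => /f12.
Qed.

Section QuadraticForms.
Context {R : realType} {m : nat}.
Implicit Types u v w : 'rV[R]_m.

Lemma for_continuous_sum (X : topologicalType) n (f : 'I_n -> X -> R) (x : X) :
  (forall i, {for x, continuous (f i)}) -> {for x, continuous (fun y => \sum_(i < n) f i y)}.
Proof.
elim: n f => [|n IH] f h.
  have -> : (fun y => \sum_(i < 0) f i y) = (fun _ : X => 0 : R).
    by apply/funext => y; rewrite big_ord0.
  exact: cst_continuous.
have -> : (fun y => \sum_(i < n.+1) f i y) =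
    (fun y => \sum_(i < n) f (widen_ord (leqnSn n) i) y + f ord_max y).
  by apply/funext => y; rewrite big_ord_recr.
by apply: continuousD => //; exact: IH.
Qed.

Lemma for_continuous_coord (X : topologicalType) k l (f : X -> 'M[R]_(k, l)) (x : X) i j :
  {for x, continuous f} -> {for x, continuous (fun y => f y i j)}.
Proof. move=> cf.
have h := @matrix_normedtype.coord_continuous R k l i j (f x).
exact: (cvg_comp f (fun N : 'M[R]_(k, l) => N i j) cf h). Qed.

Lemma qformE (G : 'M[R]_m) v w :
  qform G v w = \sum_(j < m) (\sum_(i < m) v 0 i * G i j) * w 0 j.
Proof. by rewrite /qform mxE; apply: eq_bigr => j _; rewrite !mxE. Qed.

Lemma qformZ (G : 'M[R]_m) k v : qform G (k *: v) (k *: v) = k ^+ 2 * qform G v v.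
Proof.
by rewrite /qform linearZ/= -!scalemxAl -scalemxAr scalerA mxE expr2.
Qed.

Lemma for_continuous_qform (X : topologicalType) (G : X -> 'M[R]_m) (v w : X -> 'rV[R]_m) x :
  {for x, continuous G} -> {for x, continuous v} -> {for x, continuous w} ->
  {for x, continuous (fun y => qform (G y) (v y) (w y))}.
Proof.
move=> cG cv cw.
have -> : (fun y => qform (G y) (v y) (w y)) =
    (fun y => \sum_(j < m) (\sum_(i < m) v y 0 i * G y i j) * w y 0 j).
  by apply/funext => y; rewrite qformE.
apply: for_continuous_sum => j; apply: continuousM; last exact: for_continuous_coord.
by apply: for_continuous_sum => i; apply: continuousM; exact: for_continuous_coord.
Qed.

(** Both functions are homogeneous of degree 2 in the vector, so it suffices to bound [F / P] on the
    product of [K] with the unit sphere, which is compact. The maximum with 1 only ensures a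
    positive constant. *)
Lemma homogeneous_bound (K : set 'rV[R]_m) (F P : 'rV[R]_m -> 'rV[R]_m -> R) :
  compact K ->
  (forall u v, K u -> {for (u, v), continuous (fun p : 'rV[R]_m * 'rV[R]_m => F p.1 p.2)}) ->
  (forall u v, K u -> {for (u, v), continuous (fun p : 'rV[R]_m * 'rV[R]_m => P p.1 p.2)}) ->
  (forall u v, K u -> v != 0 -> 0 < P u v) ->
  (forall u k v, F u (k *: v) = k ^+ 2 * F u v) ->
  (forall u k v, P u (k *: v) = k ^+ 2 * P u v) ->
  exists2 C, 0 < C & forall u v, K u -> F u v <= C * P u v.
Proof.
move=> cK cF cP P0 hF hP; pose S := [set v : 'rV[R]_m | `|v| = 1].
have cS : compact S.
  apply: bounded_closed_compact.
    by exists 1; split; [exact: num_real|move=> x x1 v /= ->; exact: ltW].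
  apply: (@preimage_closed _ _ (fun v : 'rV[R]_m => `|v|) [set (1 : R)]) => [v _|].
    exact: norm_continuous.
  exact: closed_eq.
have cKS := compact_setX cK cS.
have [C0 hC0] : exists C0, forall u v, K u -> `|v| = 1 -> F u v / P u v <= C0.
  have [[p0 Kp0]|/nonemptyPn e] := pselect ((K `*` S) !=set0); last first.
    by exists 0 => u v Ku v1; have : (K `*` S) (u, v) by []; rewrite e.
  have vn0 v : `|v| = 1 -> v != 0 by move=> v1; rewrite -normr_eq0 v1 oner_eq0.
  have cFP : {within K `*` S, continuous (fun p : 'rV[R]_m * 'rV[R]_m => F p.1 p.2 / P p.1 p.2)}.
    apply: continuous_in_subspaceT => -[u v]; rewrite inE => -[/= Ku /vn0 v0].
    have h2 : {for (u, v), continuous (fun p : 'rV[R]_m * 'rV[R]_m => (P p.1 p.2)^-1)}.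
      by apply: continuousV; [rewrite gt_eqF// P0|exact: cP].
    exact: (continuousM (cF u v Ku) h2).
  have [c _ hc] := compact_EVT_max (ex_intro _ p0 Kp0) cKS cFP.
  by exists (F c.1 c.2 / P c.1 c.2) => u v Ku v1; apply: (hc (u, v)); rewrite inE.
exists (Num.max C0 1); first by rewrite lt_max ltr01 orbT.
move=> u v Ku; have [->|v0] := eqVneq v 0.
  have -> : F u 0 = 0 by rewrite -(scale0r 0) hF expr0n mul0r.
  have -> : P u 0 = 0 by rewrite -(scale0r 0) hP expr0n mul0r.
  by rewrite mulr0.
have nv : 0 < `|v| by rewrite normr_gt0.
pose w := `|v|^-1 *: v; have w1 : `|w| = 1.
  by rewrite normrZ normfV normr_id mulVf// gt_eqF.
have vE : v = `|v| *: w by rewrite scalerA divff ?scale1r// gt_eqF.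
rewrite vE hF hP mulrCA ler_pM2l ?exprn_gt0//.
have w0 : w != 0 by rewrite -normr_eq0 w1 oner_eq0.
rewrite -ler_pdivrMr ?P0//; apply: le_trans (hC0 u w Ku w1) _.
by rewrite le_max lexx.
Qed.

Lemma closed_ball_compact u (r : R) : compact [set v | `|u - v| <= r].
Proof.
apply: bounded_closed_compact.
  exists (`|u| + r); split; first exact: num_real.
  move=> x x1 v /= uv; apply: ltW; apply: le_lt_trans x1.
  rewrite -[v](subrK u) addrC; apply: le_trans (ler_normD _ _) _.
  by rewrite lerD2l distrC.
apply: (@preimage_closed _ _ (fun v : 'rV[R]_m => `|u - v|) [set x | x <= r]) => [v _|].
  by apply: continuous_comp; [apply: continuousB; [exact: cst_continuous|exact: cvg_id]|exact: norm_continuous].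
exact: closed_le.
Qed.

End QuadraticForms.

Lemma near_diagonal (X : topologicalType) (x : X) (P : X -> X -> Prop) :
  (\forall y \near x & z \near x, P y z) -> P x x.
Proof.
by move=> [[B C] [/= nB nC] BC]; apply: (BC (x, x)); split; exact: nbhs_singleton.
Qed.

Section Distance.
Context {R : realType} {m : nat} {M : ptopologicalType} (A : atlas R m M) (g : riemannian A).
Implicit Types (x y z : M) (c : chart A).
Notation d := (riem_dist g).

Lemma metric_continuous c (u : 'rV[R]_m) : img c u -> {for u, continuous (metric_coef g c)}.
Proof. by move=> cu; exact: smooth_continuous (@metric_smooth _ _ _ _ g c) cu. Qed.

Lemma qform_bound c (K : set 'rV[R]_m) (F : 'rV[R]_m -> 'rV[R]_m -> R) :
  compact K -> K `<=` img c ->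
  (forall u v, K u -> {for (u, v), continuous (fun p : 'rV[R]_m * 'rV[R]_m => F p.1 p.2)}) ->
  (forall u k v, F u (k *: v) = k ^+ 2 * F u v) ->
  exists2 C, 0 < C & forall u v, K u -> F u v <= C * qform (metric_coef g c u) v v.
Proof.
move=> cK Kc cF hF; apply: (homogeneous_bound cK cF) => //.
- move=> u v Ku; apply: for_continuous_qform; last 2 first.
  + exact: cvg_snd.
  + exact: cvg_snd.
  apply: (@continuous_comp _ _ _ (fun p : 'rV[R]_m * 'rV[R]_m => p.1)); first exact: cvg_fst.
  by apply: metric_continuous; exact: Kc.
- by move=> u v /Kc cu v0; exact: metric_pos.
- by move=> u k v; exact: qformZ.
Qed.

Lemma qform_upper c (K : set 'rV[R]_m) : compact K -> K `<=` img c ->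
  exists2 C, 0 < C & forall u v, K u -> qform (metric_coef g c u) v v <= C * `|v| ^+ 2.
Proof.
move=> cK Kc.
have cn (u v : 'rV[R]_m) : {for (u, v), continuous (fun p : 'rV[R]_m * 'rV[R]_m => `|p.2| ^+ 2)}.
  have cv : {for (u, v), continuous (fun p : 'rV[R]_m * 'rV[R]_m => `|p.2|)}.
    by apply: continuous_comp; [exact: cvg_snd|exact: norm_continuous].
  have -> : (fun p : 'rV[R]_m * 'rV[R]_m => `|p.2| ^+ 2) = (fun p => `|p.2| * `|p.2|).
    by apply/funext => p; rewrite expr2.
  exact: (continuousM cv cv).
apply: (@homogeneous_bound _ _ K (fun u v => qform (metric_coef g c u) v v) (fun u v => `|v| ^+ 2)) => //.
- move=> u v Ku; apply: for_continuous_qform; last 2 first.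
  + exact: cvg_snd.
  + exact: cvg_snd.
  apply: (@continuous_comp _ _ _ (fun p : 'rV[R]_m * 'rV[R]_m => p.1)); first exact: cvg_fst.
  by apply: metric_continuous; exact: Kc.
- by move=> u v _ v0; rewrite exprn_gt0// normr_gt0.
- by move=> u k v; exact: qformZ.
- by move=> u k v; rewrite normrZ exprMn real_normK// num_real.
Qed.

Lemma path_length_ge0 x y L : path_length g x y L -> 0 <= L.
Proof.
elim=> [gam L' _ [s [hs ->]]|x' y' z' L1 L2 _ h1 _ h2]; last exact: addr_ge0.
apply: fine_ge0; apply: integral_ge0 => t /= t01.
have [c cx] := dom_cover A (gam t).
by rewrite lee_fin (hs t c)// sqrtr_ge0.
Qed.

Lemma chart_domain_open c c' : open (coord c @` (dom c `&` dom c')).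
Proof.
have -> : coord c @` (dom c `&` dom c') = img c `&` param c @^-1` dom c'.
  apply/seteqP; split=> [_ [x [cx c'x] <-]|u [[x cx <-] /=]]; last by rewrite coordK//; exists x.
  by split; [exists x|rewrite /= coordK].
apply: open_setI_preimage; [exact: img_open|exact: dom_open|].
by move=> u cu; exact: param_continuous.
Qed.

(** The path is the image of the straight segment, whose velocity in the chart is constantly
    [v - u]; by [metric_compat] its speed may be computed in [c] alone, where it is at most
    [Num.sqrt C * |v - u|]. *)
Lemma segment_length c (K : set 'rV[R]_m) (C : R) (u v : 'rV[R]_m) : 0 < C ->
  (forall u v, K u -> qform (metric_coef g c u) v v <= C * `|v| ^+ 2) ->
  (forall t, 0 <= t <= 1 -> K (u + t *: (v - u))) -> K `<=` img c ->
  exists2 L, path_length g (param c u) (param c v) L & L <= Num.sqrt C * `|v - u|.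
Proof.
move=> C0 hC hK Kc; pose l (t : R) := u + t *: (v - u).
have sl : smooth_on [set: R] l.
  apply: smoothD; [exact: openT|exact: smooth_cst|].
  by apply: smoothZ; [exact: openT|exact: smooth_id|exact: smooth_cst].
have dl t : differentiable l t /\ 'D_1 l t = v - u.
  have := smooth_differentiable sl (I : [set: R] t); split=> //.
  have h : is_derive t 1 (fun t : R => t *: (v - u)) (1 *: (v - u)).
    apply: DeriveDef.
      by apply/derivable1_diffP; apply: (@smooth_differentiable _ _ _ setT) => //;
        apply: smoothZ; [exact: openT|exact: smooth_id|exact: smooth_cst].
    have di : differentiable (fun t : R => t) t.
      exact: (smooth_differentiable (@smooth_id _ _ setT)).
    have dc : differentiable (fun _ : R => v - u) t by exact: differentiable_cst.
    rewrite (diff_scale di dc).2 derive_cst scaler0 add0r.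
    by rewrite [X in X *: _](derive_id t 1).
  rewrite scale1r in h; have hc := is_derive_cst u t (1 : R).
  have := is_deriveD hc h; rewrite add0r => -[_ <-]; congr ('D_1 _ t).
pose gam t := param c (l t).
have cl t : continuous_at t l by exact: (smooth_continuous sl).
have cgam t : 0 <= t <= 1 -> {for t, continuous gam}.
  move=> t01; apply: continuous_comp; first exact: cl.
  by apply: param_continuous; exact/Kc/hK.
(* Smoothness and speed must be checked in every chart [c']; near [t] the segment stays where the
   change of charts from [c] to [c'] is smooth. *)
have trans t c' : 0 <= t <= 1 -> dom c' (gam t) ->
    exists U, [/\ open U, U t & forall s, U s -> (coord c @` (dom c `&` dom c')) (l s)].
  move=> t01 c't; exists (l @^-1` (coord c @` (dom c `&` dom c'))); split=> //.
    by apply: open_comp => //; exact: chart_domain_open.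
  exists (gam t); last by rewrite param_coord//; exact/Kc/hK.
  by split=> //; apply: param_dom; exact/Kc/hK.
have sgam : smooth_curve A gam.
  split; first by apply: continuous_in_subspaceT => t; rewrite inE/= in_itv/=; exact: cgam.
  move=> c' t /= []; rewrite in_itv/= => t01 c't; have [U [oU Ut UE]] := trans t c' t01 c't.
  exists U, (coord c' \o gam); split=> //.
  apply: (smooth_comp (finite_basis_rV m) oU UE _ (@transition_smooth _ _ _ A c c')).
  exact: smooth_sub sl.
have len : curve_length g gam (\int[lebesgue_measure]_(t in `]0, 1[)
    Num.sqrt (qform (metric_coef g c (l t)) (v - u) (v - u))).
  exists (fun t => Num.sqrt (qform (metric_coef g c (l t)) (v - u) (v - u))); split=> //.
  move=> t c' t01 c't; have t01' : 0 <= t <= 1.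
    by move: t01; rewrite in_itv/= => /andP[/ltW -> /ltW ->].
  have [U [oU Ut UE]] := trans t c' t01' c't; congr Num.sqrt.
  have [d1 d2] := dl t; have ds := smooth_differentiable (@transition_smooth _ _ _ A c c') (UE t Ut).
  have dcomp : differentiable ((coord c' \o param c) \o l) t by exact: differentiable_comp.
  have Ed : derive1 (coord c' \o gam) t = 'D_(v - u) (coord c' \o param c) (l t).
    have E1 : 'D_1 ((coord c' \o param c) \o l) t = 'd ((coord c' \o param c) \o l) t 1 := deriveE _ dcomp.
    apply: (etrans (derive1E _ _)); apply: (etrans E1).
    apply: (etrans (diff_compE _ d1 ds)); apply: (etrans _ (esym (deriveE _ ds))).
    by rewrite -d2 (deriveE _ d1).
  rewrite Ed; exact: (metric_compat g _ _ (UE t Ut)).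
have := PathSmooth sgam len.
rewrite /gam /l scale0r addr0 scale1r addrC subrK => pl; exists (\int[lebesgue_measure]_(t in `]0, 1[)
    Num.sqrt (qform (metric_coef g c (l t)) (v - u) (v - u))) => //.
rewrite /Rintegral -[leRHS]/(fine (Num.sqrt C * `|v - u|)%:E).
have le1 : (\int[lebesgue_measure]_(t in `]0%R, 1%R[) (Num.sqrt (qform (metric_coef g c (l t)) (v - u) (v - u)))%:E
    <= (Num.sqrt C * `|v - u|)%:E)%E.
  apply: (@le_trans _ _ (\int[lebesgue_measure]_(t in `]0%R, 1%R[) (Num.sqrt C * `|v - u|)%:E)%E).
    apply: ge0_le_integral_nonmeasurable => t /=; rewrite in_itv/= => /andP[/ltW t0 /ltW t1].
      by rewrite lee_fin sqrtr_ge0.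
    rewrite lee_fin -[`|v - u|]ger0_norm// -sqrtr_sqr -sqrtrM ?(ltW C0)// ler_wsqrtr//.
    by apply: hC; apply: hK; rewrite t0 t1.
  by rewrite integral_cst//= lebesgue_measure_itv/= lte_fin ltr01 -EFinD subr0 mule1.
apply: fine_le => //; rewrite ge0_fin_numE ?(le_lt_trans le1) ?ltry//.
by apply: integral_ge0 => t _; rewrite lee_fin sqrtr_ge0.
Qed.

Lemma chart_ball c (u : 'rV[R]_m) (W : set 'rV[R]_m) : open W -> W u ->
  exists2 r, 0 < r & [set v | `|u - v| <= r] `<=` W.
Proof.
move=> oW Wu; have /nbhs_normP[e /= e0 he] : nbhs u W by exact: open_nbhs_nbhs.
exists (e / 2); first exact: divr_gt0.
by move=> v /= uv; apply: he => /=; apply: le_lt_trans uv _; lra.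
Qed.

Lemma local_length x : exists C c, [/\ 0 < C, dom c x & \forall y \near x & z \near x,
  [/\ dom c y, dom c z & exists2 L, path_length g y z L & L <= C * `|coord c z - coord c y|]].
Proof.
have [c cx] := dom_cover A x; have cu := img_coord cx.
have [r r0 hr] := chart_ball c (img_open (a := A) (c := c)) cu.
have [C C0 hC] := qform_upper (@closed_ball_compact _ _ (coord c x) r) hr.
exists (Num.sqrt C), c; split=> //; first by rewrite sqrtr_gt0.
have n : \forall y \near x, dom c y /\ `|coord c x - coord c y| <= r.
  apply: filterI; first by apply: open_nbhs_nbhs; split=> //; exact: dom_open.
  have := coord_continuous cx => /cvgrPdist_le /(_ r r0); exact.
exists ([set y | dom c y /\ `|coord c x - coord c y| <= r],
        [set y | dom c y /\ `|coord c x - coord c y| <= r]) => //=.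
move=> [y z] /= [[cy ry] [cz rz]]; split=> //.
have [|L] := segment_length (u := coord c y) (v := coord c z) C0 hC _ hr.
  move=> t /andP[t0 t1] /=.
  have -> : coord c x - (coord c y + t *: (coord c z - coord c y)) =
      (1 - t) *: (coord c x - coord c y) + t *: (coord c x - coord c z).
    by apply/rowP => i; rewrite !mxE; ring.
  apply: le_trans (ler_normD _ _) _; rewrite !normrZ !ger0_norm//; last by lra.
  apply: le_trans (_ : (1 - t) * r + t * r <= _); last by lra.
  by apply: lerD; apply: ler_wpM2l => //; lra.
by rewrite !coordK// => pl le; exists L.
Qed.

Hypothesis M_connected : connected [set: M].

(** The set of points that can be reached from [x] is nonempty, open and closed, because near each
    point any two points are joined by a path. *)
Lemma path_exists x y : exists L, path_length g x y L.
Proof.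
suff : [set y | exists L, path_length g x y L] = [set: M].
  by move=> /seteqP[_ /(_ y I)].
have link z : \forall z1 \near z & z2 \near z, exists L, path_length g z1 z2 L.
  have [C [c [_ _ h]]] := local_length z.
  by apply: filterS h => -[a b] [_ _ [L pl _]]; exists L.
apply: M_connected.
- by have [L pl] := near_diagonal (link x); exists x, L.
- exists [set y | exists L, path_length g x y L]; last by rewrite setTI.
  rewrite openE => z [L pl].
  have [[P Q] [/= nP nQ] PQ] := link z.
  apply: filterS nQ => w Qw; have [|L' pl'] := PQ (z, w).
    by split=> //=; exact: nbhs_singleton nP.
  by exists (L + L'); exact: PathConcat pl pl'.
- exists [set y | exists L, path_length g x y L]; last by rewrite setTI.
  rewrite -[X in closed X]setCK; apply: open_closedC; rewrite openE => z nz.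
  have [[P Q] [/= nP nQ] PQ] := link z.
  apply: filterS nP => w Pw [L pl]; apply: nz; have [|L' pl'] := PQ (w, z).
    by split=> //=; exact: nbhs_singleton nQ.
  by exists (L + L'); exact: PathConcat pl pl'.
Qed.

Lemma dist_le x y L : path_length g x y L -> d x y <= L.
Proof.
move=> pl; apply: ge_inf => //; exists 0 => L' /=; exact: path_length_ge0.
Qed.

Lemma dist_ge x y (C : R) : (forall L, path_length g x y L -> C <= L) -> C <= d x y.
Proof.
move=> h; apply: lb_le_inf; first exact: path_exists.
by move=> L /=; exact: h.
Qed.

Lemma dist_ge0 x y : 0 <= d x y.
Proof. by apply: dist_ge => L; exact: path_length_ge0. Qed.

Lemma dist_triangle x y z : d x z <= d x y + d y z.
Proof.
rewrite -lerBlDl; apply: dist_ge => L' pl'; rewrite lerBlDl -lerBlDr.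
apply: dist_ge => L pl; rewrite lerBlDr; apply: dist_le; exact: PathConcat pl pl'.
Qed.

Lemma dist_local x (e : R) : 0 < e -> \forall y \near x & z \near x, d y z < e.
Proof.
move=> e0; have [C [c [C0 cx h]]] := local_length x.
have e2 : 0 < e / C / 2 by rewrite !divr_gt0.
have n : \forall y \near x, `|coord c x - coord c y| < e / C / 2.
  by have := coord_continuous cx => /cvgrPdist_lt /(_ _ e2); exact.
have n1 := near_fst x n; have n2 := near_snd x n.
apply: filterS3 h n1 n2 => -[y z] /= [_ _ [L pl le]] y1 z1.
apply: le_lt_trans (dist_le pl) _; apply: le_lt_trans le _.
rewrite -ltr_pdivlMl// mulrC.
have -> : coord c z - coord c y = (coord c x - coord c y) - (coord c x - coord c z).
  by apply/rowP => i; rewrite !mxE; ring.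
by apply: le_lt_trans (ler_normB _ _) _; lra.
Qed.

Lemma dist_xx x : d x x = 0.
Proof.
apply/eqP; rewrite eq_le dist_ge0 andbT; apply/ler_addgt0Pl => e e0; rewrite addr0 ltW//.
exact: near_diagonal (dist_local x e0).
Qed.

Lemma dist_continuous : continuous (fun p : M * M => d p.1 p.2).
Proof.
move=> [x y]; apply/cvgrPdist_lt => e e0 /=.
have e2 : 0 < e / 2 by exact: divr_gt0.
have [[P Q] [/= nP nQ] PQ] := dist_local x e2.
have [[P' Q'] [/= nP' nQ'] PQ'] := dist_local y e2.
have nPQ : nbhs x (P `&` Q) by exact: filterI.
have nPQ' : nbhs y (P' `&` Q') by exact: filterI.
have n1 := near_fst y nPQ; have n2 := near_snd x nPQ'.
suff h (p : M * M) : (P `&` Q) p.1 -> (P' `&` Q') p.2 -> `|d x y - d p.1 p.2| < e.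
  by near=> p; apply: h; near: p.
move: p => [a b] /= [Pa Qa] [Pb Qb].
have a1 : d x a < e / 2 by apply: (PQ (x, a)); split=> //=; exact: nbhs_singleton.
have a2 : d a x < e / 2 by apply: (PQ (a, x)); split=> //=; exact: nbhs_singleton.
have b1 : d y b < e / 2 by apply: (PQ' (y, b)); split=> //=; exact: nbhs_singleton.
have b2 : d b y < e / 2 by apply: (PQ' (b, y)); split=> //=; exact: nbhs_singleton.
have := dist_triangle x a y; have := dist_triangle a b y.
have := dist_triangle a x b; have := dist_triangle x y b.
by rewrite ltr_norml => *; apply/andP; split; lra.
Unshelve. all: by end_near. Qed.

End Distance.

(** * Lower bounds for lengths: the distance induces the topology *)

Section LengthBound.
Context {R : realType}.

(** The speed [s] is controlled on the open interval only. So [f - C F], with [F] a primitive of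
    [s], is shown to be nonincreasing on each [a, b] inside it, and the ends are reached by
    continuity of [f]; boundedness of [s] keeps its integral finite. *)
Lemma length_bound (f s : R -> R) (C B : R) : 0 <= C -> {within `[0, 1], continuous f} ->
  (forall t, t \in `](0 : R), 1[ -> derivable f t 1 /\ derive1 f t <= C * s t) ->
  (forall t, t \in `](0 : R), 1[ -> {for t, continuous s}) ->
  (forall t, t \in `](0 : R), 1[ -> 0 <= s t <= B) ->
  f 1 - f 0 <= C * \int[lebesgue_measure]_(t in `]0, 1[) s t.
Proof.
move=> C0 cf df cs sB; set L := (X in _ <= _ * X).
have ms : measurable_fun `](0:R), 1[ s.
  apply: subspace_continuous_measurable_fun => //.
  by apply: continuous_in_subspaceT => t; rewrite inE; exact: cs.
have is01 : lebesgue_measure.-integrable `](0:R), 1[ (EFin \o s).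
  apply: measurable_bounded_integrable => //.
    by rewrite /= lebesgue_measure_itv/= lte_fin ltr01 -EFinD ltry.
  exists B; split; first exact: num_real.
  by move=> x Bx t /= /sB/andP[t0 tB]; rewrite ger0_norm// (le_trans tB)// ltW.
have key (a b : R) : 0 < a -> a < b -> b < 1 -> f b - f a <= C * L.
  move=> a0 ab b1.
  have sub : `[a, b] `<=` `](0:R), 1[.
    by move=> t; rewrite /= !in_itv/= => /andP[t1 t2]; apply/andP; split; lra.
  have csab : {within `[a, b], continuous s}.
    by apply: continuous_in_subspaceT => t; rewrite inE => /sub/cs.
  have iab : lebesgue_measure.-integrable `[a, b] (EFin \o s).
    by apply: continuous_compact_integrable => //; exact: segment_compact.
  pose F x := (\int[lebesgue_measure]_(t in `[a, x]) s t)%R.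
  have cF : {within `[a, b], continuous F}.
    exact: (parameterized_integral_continuous (ltW ab) iab).
  have dF x : x \in `]a, b[ -> is_derive x 1 F (s x).
    rewrite in_itv/= => /andP[ax xb].
    have cx : {for x, continuous s} by apply: cs; rewrite in_itv/=; apply/andP; split; lra.
    have [d <-] := continuous_FTC1_closed xb iab ax cx.
    by rewrite derive1E; exact: derivableP.
  pose h x := f x - C * F x.
  have dh x : x \in `]a, b[ -> is_derive x 1 h (derive1 f x - C * s x).
    move=> xab; have x01 : x \in `](0:R), 1[.
      by apply: sub; move: xab; rewrite /= !in_itv/= => /andP[/ltW -> /ltW ->].
    have [d _] := df x x01; rewrite derive1E.
    have h1 := derivableP d; have h2 := is_deriveZ C (dF x xab).
    exact: (is_deriveB h1 h2).
  have hab : h b <= h a.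
    apply: (@ler0_derive1_nincr _ h a b) => //; last exact: ltW.
    - by move=> x /dh[].
    - move=> x xab; have [_ E] := dh x xab; rewrite derive1E E subr_le0.
      apply: (df x _).2; apply: sub; move: xab.
      by rewrite /= !in_itv/= => /andP[/ltW -> /ltW ->].
    - have cfab : {within `[a, b], continuous f}.
        apply: continuous_subspaceW cf => t /sub /=.
        by rewrite !in_itv/= => /andP[/ltW -> /ltW ->].
      have /subspace_continuousP cfab' := cfab; have /subspace_continuousP cF' := cF.
      apply/subspace_continuousP => x xab; apply: cvgB; first exact: cfab'.
      by apply: cvgM; [exact: cvg_cst|exact: cF'].
  have Fa : F a = 0 by rewrite /F set_itv1 Rintegral_set1.
  rewrite /h Fa mulr0 subr0 in hab.
  apply: le_trans (_ : C * F b <= _); first lra.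
  rewrite ler_wpM2l// /F /L /Rintegral fine_le//.
  - exact: integrable_fin_num.
  - exact: integrable_fin_num.
  - apply: ge0_subset_integral => //; first exact/measurable_EFinP.
    by move=> t /sB/andP[]; rewrite lee_fin.
have [c1 c2 c3] := (continuous_within_itvP f (ltr01 : (0:R) < 1)).1 cf.
apply/ler_addgt0Pl => e e0.
have e2 : 0 < e / 2 by exact: divr_gt0.
have [a [a0 a1 fa]] : exists a, [/\ 0 < a, a < 1 / 2 & `|f 0 - f a| < e / 2].
  move: c2 => /cvgrPdist_lt /(_ _ e2) h.
  suff : \forall a \near (0:R)^'+, [/\ 0 < a, a < 1 / 2 & `|f 0 - f a| < e / 2].
    by move=> /filter_ex.
  near=> a; split; near: a => //; [exact: nbhs_right_gt|apply: nbhs_right_lt; lra].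
have [b [b0 b1 fb]] : exists b, [/\ 1 / 2 < b, b < 1 & `|f 1 - f b| < e / 2].
  move: c3 => /cvgrPdist_lt /(_ _ e2) h.
  suff : \forall a \near (1:R)^'-, [/\ 1 / 2 < a, a < 1 & `|f 1 - f a| < e / 2].
    by move=> /filter_ex.
  near=> b; split; near: b => //; [apply: nbhs_left_gt; lra|exact: nbhs_left_lt].
have := key a b a0 (lt_trans a1 b0) b1.
by move: fa fb; rewrite !ltr_norml => /andP[? ?] /andP[? ?] ?; lra.
Unshelve. all: by end_near. Qed.

End LengthBound.

Section Bump.
Context {R : realType} {m : nat} {M : ptopologicalType} (A : atlas R m M) (g : riemannian A).
Hypothesis M_hausdorff : hausdorff_space M.
Implicit Types (x y z : M) (c : chart A).

Lemma curve_rep gam c (t0 : R) : smooth_curve A gam -> t0 \in `[0, 1] -> dom c (gam t0) ->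
  exists (U : set R) G, [/\ open U, U t0, smooth_on U G & forall t, U t -> t \in `[0, 1] ->
    dom c (gam t) /\ coord c (gam t) = G t].
Proof.
move=> [cgam sgam] t01 ct; have [U [G [oU Ut sG GE]]] := sgam c t0 (conj t01 ct).
have n : nbhs t0 [set t | t \in `[0, 1] -> dom c (gam t)].
  have /subspace_continuousP h := cgam.
  exact: (h t0 t01 _ (open_nbhs_nbhs (conj (@dom_open _ _ _ A c) ct))).
have [V [oV Vt VU]] := open_nbhs_of (filterI n (open_nbhs_nbhs (conj oU Ut))).
exists V, G; split=> //; first by apply: smooth_sub sG => t /VU[].
move=> t /VU[/= h Ut'] t01'; split; first exact: h.
by apply: GE => //; split=> //; exact: h.
Qed.

Definition speed_of (gam s : R -> _) := forall (t : R) c, t \in `](0 : R), 1[ -> dom c (gam t) ->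
  s t = Num.sqrt (qform (metric_coef g c (coord c (gam t)))
    (derive1 (coord c \o gam) t) (derive1 (coord c \o gam) t)).

Lemma speed_local gam s c (t0 : R) : smooth_curve A gam -> speed_of gam s ->
  t0 \in `[0, 1] -> dom c (gam t0) ->
  exists (U : set R) G, [/\ open U, U t0, smooth_on U G,
    forall t, U t -> t \in `[0, 1] -> dom c (gam t) /\ coord c (gam t) = G t &
    forall t, U t -> t \in `](0 : R), 1[ -> derive1 (coord c \o gam) t = 'D_1 G t /\
      s t = Num.sqrt (qform (metric_coef g c (G t)) ('D_1 G t) ('D_1 G t))].
Proof.
move=> sgam hs t01 ct; have [U [G [oU Ut sG GE]]] := curve_rep sgam t01 ct.
exists U, G; split=> // t Ut' t01'.
have sub (u : R) : u \in `](0:R), 1[ -> u \in `[0, 1].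
  by rewrite !in_itv/= => /andP[/ltW -> /ltW ->].
have E : derive1 (coord c \o gam) t = 'D_1 G t.
  rewrite derive1E; apply: near_eq_derive.
  have n1 : nbhs t U by exact: open_nbhs_nbhs.
  have n2 : nbhs t [set` `](0:R), 1[].
    by apply: open_nbhs_nbhs; split=> //; exact: interval_open.
  by apply: filterS2 n1 n2 => u Uu /= /sub u01; have [] := GE u Uu u01.
split=> //; have [cx cE] := GE t Ut' (sub _ t01').
by rewrite (hs t c t01' cx) E cE.
Qed.

Lemma sqrt_qform_continuous c (G v : R -> 'rV[R]_m) (t : R) : img c (G t) ->
  {for t, continuous G} -> {for t, continuous v} ->
  {for t, continuous (fun t => Num.sqrt (qform (metric_coef g c (G t)) (v t) (v t)))}.
Proof.
move=> cG ctG ctv; apply: continuous_comp; last exact: sqrt_continuous.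
apply: for_continuous_qform => //; apply: continuous_comp => //.
exact: metric_continuous.
Qed.

(** At 0 and 1 the value of [s] is arbitrary, but on ]0, 1[ it agrees locally with expressions that
    remain continuous at the ends; compactness of [0, 1] then gives one bound. *)
Lemma speed_bounded gam s : smooth_curve A gam -> speed_of gam s ->
  exists B, forall t, t \in `](0 : R), 1[ -> 0 <= s t <= B.
Proof.
move=> sgam hs.
have /compact_near_coveringP cI : compact [set` `[(0:R), 1]] by exact: segment_compact.
have : \forall B \near +oo, [set` `[(0:R), 1]] `<=` (fun t => t \in `](0:R), 1[ -> s t <= B).
  apply: cI => t0 t01; have [c ct] := dom_cover A (gam t0).
  have [U [G [oU Ut sG GE sE]]] := speed_local sgam hs t01 ct.
  have [cx cE] := GE t0 Ut t01.
  pose sig t := Num.sqrt (qform (metric_coef g c (G t)) ('D_1 G t) ('D_1 G t)).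
  have csig : {for t0, continuous sig}.
    apply: sqrt_qform_continuous; first by rewrite -cE; exact: img_coord.
      exact: smooth_continuous sG Ut.
    have sD : smooth_on U ('D_1 G) := smooth_derive _ sG.
    exact: (smooth_continuous sD Ut).
  have n1 : \forall t \near t0, sig t < sig t0 + 1.
    have aux (p q : R) : `|p - q| < 1 -> q < p + 1 by rewrite ltr_norml => /andP[? ?]; lra.
    by have := csig => /cvgrPdist_lt /(_ 1 ltr01); apply: filterS => t; exact: aux.
  have n2 : \forall B \near +oo, sig t0 + 1 < B by apply: nbhs_pinfty_gt; exact: num_real.
  have n3 : nbhs t0 U by exact: open_nbhs_nbhs.
  exists ([set t | sig t < sig t0 + 1 /\ U t], [set B | sig t0 + 1 < B]) => /=.
    by split=> //; exact: filterI.
  move=> [t B] /= [[h1 Ut'] h2] t01'.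
  by have [_ ->] := sE t Ut' t01'; apply: ltW; apply: lt_trans h2.
move=> /filter_ex[B hB]; exists B => t t01; apply/andP; split.
  by have [c ct] := dom_cover A (gam t); rewrite (hs t c)// sqrtr_ge0.
by apply: hB => //=; move: t01; rewrite !in_itv/= => /andP[/ltW -> /ltW ->].
Qed.

Lemma speed_continuous gam s (t : R) : smooth_curve A gam -> speed_of gam s ->
  t \in `](0 : R), 1[ -> {for t, continuous s}.
Proof.
move=> sgam hs t01; have [c ct] := dom_cover A (gam t).
have t01' : t \in `[0, 1] by move: t01; rewrite !in_itv/= => /andP[/ltW -> /ltW ->].
have [U [G [oU Ut sG GE sE]]] := speed_local sgam hs t01' ct.
have [cx cE] := GE t Ut t01'.
have csig : {for t, continuous (fun t => Num.sqrt (qform (metric_coef g c (G t)) ('D_1 G t) ('D_1 G t)))}.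
  apply: sqrt_qform_continuous; first by rewrite -cE; exact: img_coord.
    exact: smooth_continuous sG Ut.
  have sD : smooth_on U ('D_1 G) := smooth_derive _ sG.
  exact: (smooth_continuous sD Ut).
have [_ Es] := sE t Ut t01.
suff : s u @[u --> t] --> Num.sqrt (qform (metric_coef g c (G t)) ('D_1 G t) ('D_1 G t)).
  by rewrite -Es.
apply: cvg_trans csig; apply: near_eq_cvg.
have n1 : nbhs t U by exact: open_nbhs_nbhs.
have n2 : nbhs t [set` `](0:R), 1[].
  by apply: open_nbhs_nbhs; split=> //; exact: interval_open.
by apply: filterS2 n1 n2 => u Uu /= u01; have [] := sE u Uu u01.
Qed.

Section BumpLipschitz.
Variables (c : chart A) (K : set 'rV[R]_m) (b : 'rV[R]_m -> R).
Hypotheses (cK : compact K) (Kc : K `<=` img c) (sb : smooth_on setT b).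
Hypothesis bK : forall u, ~ K u -> b u = 0.

Definition chart_bump (x : M) : R := if `[< dom c x >] then b (coord c x) else 0.

Let K' := param c @` K.

Lemma bump_support_closed : closed K'.
Proof.
apply: compact_closed => //; apply: continuous_compact => //.
by apply: continuous_in_subspaceT => u; rewrite inE => /Kc; exact: param_continuous.
Qed.

Lemma chart_bump_dom x : dom c x -> chart_bump x = b (coord c x).
Proof. by rewrite /chart_bump => dx; case: asboolP. Qed.

Lemma chart_bump0 x : ~ K' x -> chart_bump x = 0.
Proof.
rewrite /chart_bump; case: asboolP => // dx nK; apply: bK => Kx; apply: nK.
by exists (coord c x) => //; rewrite coordK.
Qed.

Lemma chart_bump_near0 x : ~ K' x -> \forall y \near x, chart_bump y = 0.
Proof.
move=> nK; have : nbhs x (~` K').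
  by apply: open_nbhs_nbhs; split=> //; apply: closed_openC; exact: bump_support_closed.
by apply: filterS => y; exact: chart_bump0.
Qed.

Lemma bump_support_dom x : K' x -> dom c x /\ K (coord c x).
Proof. move=> [u Ku <-]; have cu := Kc Ku.
by rewrite param_coord//; split=> //; exact: param_dom. Qed.

Lemma chart_bump_continuous : continuous chart_bump.
Proof.
move=> x; have [Kx|nK] := pselect (K' x).
  have [dx Kx'] := bump_support_dom Kx; rewrite /continuous_at chart_bump_dom//.
  have h : b (coord c y) @[y --> x] --> b (coord c x).
    apply: (continuous_comp (coord_continuous dx)).
    exact: (smooth_continuous sb).
  apply: cvg_trans h; apply: near_eq_cvg.
  have : nbhs x (dom c) by apply: open_nbhs_nbhs; split=> //; exact: dom_open.
  by apply: filterS => y dy; rewrite chart_bump_dom.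
rewrite /continuous_at chart_bump0//.
apply: (@cvg_trans _ (cst (0:R) @ x)); last exact: cvg_cst.
by apply: near_eq_cvg; apply: filterS (chart_bump_near0 nK) => y ->.
Qed.

(** Along a curve the bump changes at the rate of [b] in the direction of the velocity. On the
    compact support this is at most a constant times the Riemannian speed, by [qform_bound], and
    elsewhere it is 0; [length_bound] integrates the inequality. *)
Lemma chart_bump_lipschitz : exists2 C, 0 < C &
  forall x y L, path_length g x y L -> `|chart_bump y - chart_bump x| <= C * L.
Proof.
have db u : differentiable b u by exact: (smooth_differentiable sb).
pose Dv (p : 'rV[R]_m * 'rV[R]_m) := \sum_(k < m) p.2 0 k * 'D_(delta_mx 0 k) b p.1.
have DvE u v : 'D_v b u = Dv (u, v).
  rewrite deriveE// {1}(row_sum_delta v) linear_sum; apply: eq_bigr => k _.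
  by rewrite linearZ deriveE.
have cDv p : {for p, continuous Dv}.
  apply: for_continuous_sum => k; apply: continuousM.
    by apply: for_continuous_coord; exact: cvg_snd.
  have sD : smooth_on setT ('D_(delta_mx 0 k) b) := smooth_derive _ sb.
  have cD : {for p.1, continuous ('D_(delta_mx 0 k) b)} by exact: (smooth_continuous sD).
  case: p cD => u v cD P nP; exact: near_fst (cD _ nP).
have [C0 C00 hC0] : exists2 C, 0 < C & forall u v, K u ->
    ('D_v b u) ^+ 2 <= C * qform (metric_coef g c u) v v.
  apply: (qform_bound g (F := fun u v => ('D_v b u) ^+ 2) cK Kc).
    move=> u v Ku; have -> : (fun p : 'rV[R]_m * 'rV[R]_m => ('D_(p.2) b p.1) ^+ 2) =
        (fun p => Dv p * Dv p).
      by apply/funext => -[p q]; rewrite expr2 DvE.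
    exact: (continuousM (cDv (u, v)) (cDv (u, v))).
  by move=> u k v; rewrite !deriveE// linearZ exprMn.
exists (Num.sqrt C0); first by rewrite sqrtr_gt0.
move=> x y L; elim=> [gam L' sgam [s [hs ->]]|x' y' z' L1 L2 _ h1 _ h2]; last first.
  have -> : chart_bump z' - chart_bump x' =
    (chart_bump z' - chart_bump y') + (chart_bump y' - chart_bump x') by ring.
  by rewrite mulrDr; apply: le_trans (ler_normD _ _) _; rewrite addrC lerD.
have cgam : {within `[0, 1], continuous gam} by case: sgam.
have cf : {within `[0, 1], continuous (chart_bump \o gam)}.
  by apply: within_continuous_comp => // z _; exact: chart_bump_continuous.
have df t : t \in `](0 : R), 1[ -> derivable (chart_bump \o gam) t 1 /\
    `|derive1 (chart_bump \o gam) t| <= Num.sqrt C0 * s t.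
  move=> t01; have t01' : t \in `[0, 1] by move: t01; rewrite !in_itv/= => /andP[/ltW -> /ltW ->].
  have n2 : nbhs t [set` `](0:R), 1[].
    by apply: open_nbhs_nbhs; split=> //; exact: interval_open.
  have [Kt|nK] := pselect (K' (gam t)).
    have [dt Kt'] := bump_support_dom Kt.
    have [U [G [oU Ut sG GE sE]]] := speed_local sgam hs t01' dt.
    have [_ Es] := sE t Ut t01; have [_ EG] := GE t Ut t01'.
    have dG := smooth_differentiable sG Ut.
    have dbG : differentiable (b \o G) t by exact: differentiable_comp.
    have n : \near t, (b \o G) t = (chart_bump \o gam) t.
      have n1 : nbhs t U by exact: open_nbhs_nbhs.
      apply: filterS2 n1 n2 => u Uu /= u01.
      have [du <-] := GE u Uu ltac:(by move: u01; rewrite !in_itv/= => /andP[/ltW -> /ltW ->]).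
      by rewrite chart_bump_dom.
    split; first by apply/derivable1_diffP; exact: near_differentiable n dbG.
    rewrite derive1E -(near_eq_derive _ n).
    have -> : 'D_1 (b \o G) t = 'D_('D_1 G t) b (G t).
      apply: (etrans (deriveE _ dbG)); apply: (etrans (diff_compE _ dG (db _))).
      by apply: (etrans _ (esym (deriveE _ (db _)))); congr ('d b _ _); rewrite deriveE.
    rewrite Es -sqrtrM ?(ltW C00)// -[leLHS]ger0_norm// -sqrtr_sqr ler_wsqrtr//.
    by rewrite real_normK ?num_real//; apply: hC0; rewrite -EG.
  have n : \near t, chart_bump (gam t) = 0.
    have /subspace_continuousP hh := cgam.
    have n3 : nbhs t [set u | u \in `[0, 1] -> chart_bump (gam u) = 0].
      exact: (hh t t01' _ (chart_bump_near0 nK)).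
    apply: filterS2 n3 n2 => u hu /= u01; apply: hu.
    by move: u01; rewrite !in_itv/= => /andP[/ltW -> /ltW ->].
  have [d E] := is_derive_near0 n; split=> //.
  rewrite derive1E [X in `|X|]E normr0 mulr_ge0 ?sqrtr_ge0//.
  by have [c' ct] := dom_cover A (gam t); rewrite (hs t c')// sqrtr_ge0.
have [B hB] := speed_bounded sgam hs.
have sc t (t01 : t \in `](0 : R), 1[) := speed_continuous sgam hs t01.
have l1 := @length_bound _ (chart_bump \o gam) s (Num.sqrt C0) B (sqrtr_ge0 _) cf
  (fun t t01 => conj (df t t01).1 (le_trans (ler_norm _) (df t t01).2)) sc hB.
(* [length_bound] is one-sided, so it is applied to the bump and to its opposite. *)
have cf' : {within `[0, 1], continuous (fun t => - chart_bump (gam t))}.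
  have /subspace_continuousP cf'' := cf.
  by apply/subspace_continuousP => t t01; apply: cvgN; exact: cf''.
have df' t : t \in `](0 : R), 1[ -> derivable (fun t => - chart_bump (gam t)) t 1 /\
    derive1 (fun t => - chart_bump (gam t)) t <= Num.sqrt C0 * s t.
  move=> t01; have [d1 d2] := df t t01; split; first exact: (derivableN d1).
  rewrite derive1E (deriveN d1) -derive1E; apply: le_trans d2.
  by rewrite -normrN ler_norm.
have l2 := @length_bound _ _ s (Num.sqrt C0) B (sqrtr_ge0 _) cf' df' sc hB.
by rewrite ler_norml /= in l1 l2 *; apply/andP; split; lra.
Qed.

End BumpLipschitz.

Lemma sqr_norm_le m' (v : 'rV[R]_m') : `|v| ^+ 2 <= \sum_(k < m') v 0 k ^+ 2.
Proof.
have [->|v0] := eqVneq v 0.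
  by rewrite normr0 expr0n sumr_ge0// => k _; exact: sqr_ge0.
have [[i j] /= E] : exists i : 'I_1 * 'I_m', `|v| = `|v i.1 i.2|.
  by apply: mx_norm_neq0; rewrite -[mx_norm v]/(`|v|) normr_eq0.
rewrite E (ord1 i) (bigD1 j)//= real_normK ?num_real// lerDl sumr_ge0// => k _.
exact: sqr_ge0.
Qed.

Hypothesis M_connected : connected [set: M].
Notation d := (riem_dist g).

(** A bump equal to 1 at [x0] and supported in [W] is Lipschitz for [d]. Where it exceeds 1/2, which
    holds near [x0], a displacement shorter than 1 / (2 C) keeps it positive and hence stays in [W].
    The uniformity in [x] is what limits of maps require. *)
Lemma dist_nbhs (x0 : M) (W : set M) : open W -> W x0 ->
  exists2 e, 0 < e & \forall x \near x0, forall y, d x y < e -> W y.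
Proof.
move=> oW Wx0; have [c cx] := dom_cover A x0; set u0 := coord c x0.
have oI : open (img c `&` param c @^-1` W).
  by apply: open_setI_preimage => // [|u cu]; [exact: img_open|exact: param_continuous].
have [|r r0 hr] := @chart_ball _ _ _ A c u0 _ oI.
  by split; [exact: img_coord|rewrite /= coordK].
have [l [sl l01 l0 l1 lp]] := @smooth_step R.
(* The Euclidean square is smooth, and by [sqr_norm_le] it dominates the square of the maximum norm
   used for [K]; hence [b] vanishes off [K]. *)
pose b (u : 'rV[R]_m) := l (1 - r ^- 2 * \sum_(k < m) (u 0 k - u0 0 k) ^+ 2).
have sb : smooth_on setT b.
  apply: (@smooth_comp _ _ _ _ setT setT _ _ (finite_basis_R (R := R))) => //; first exact: openT.
  apply: smoothD; [exact: openT|exact: smooth_cst|apply: smoothN; first exact: openT].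
  apply: smoothM; [exact: openT|exact: smooth_cst|].
  apply: smooth_sum => [|k]; first exact: openT.
  have sk : smooth_on setT (fun u : 'rV[R]_m => u 0 k - u0 0 k).
    apply: smoothD; [exact: openT| |exact: smooth_cst].
    pose L : {linear 'rV[R]_m -> R} := HB.pack (fun v : 'rV[R]_m => v 0 k : R)
      (GRing.isLinear.Build R 'rV[R]_m R *:%R _ (coord_is_linear k)).
    by apply: (@smooth_linear _ _ _ _ L); exact: matrix_normedtype.coord_continuous.
  apply: (@smooth_eq _ _ _ _ (fun u : 'rV[R]_m => (u 0 k - u0 0 k) * (u 0 k - u0 0 k))).
  - exact: openT.
  - by move=> u _; rewrite expr2.
  - by apply: smoothM => //; exact: openT.
pose K := [set u | `|u0 - u| <= r].
have cK : compact K by exact: closed_ball_compact.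
have Kc : K `<=` img c by move=> u /hr[].
have bK u : ~ K u -> b u = 0.
  move=> /negP; rewrite -ltNge => ru; apply: l0; rewrite subr_le0 ler_pdivlMl ?exprn_gt0// mulr1.
  apply: le_trans (_ : `|u - u0| ^+ 2 <= _).
    by rewrite distrC lerXn2r ?nnegrE ?(ltW r0) ?(ltW ru).
  apply: le_trans (sqr_norm_le _) _; apply: ler_sum => k _; by rewrite !mxE.
have [C C0 hC] := chart_bump_lipschitz cK Kc sb bK.
have b1 : chart_bump c b x0 = 1.
  rewrite chart_bump_dom// /b -/u0 big1 ?mulr0 ?subr0 ?l1// => k _.
  by rewrite subrr expr0n.
have hd x y : `|chart_bump c b y - chart_bump c b x| <= C * d x y.
  rewrite -ler_pdivrMl//; apply: dist_ge => // L pl.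
  by rewrite ler_pdivrMl//; exact: hC.
exists (1 / 2 / C); first by rewrite !divr_gt0.
have := chart_bump_continuous cK Kc sb bK (x := x0); rewrite /continuous_at b1.
have h2 : (0 : R) < 1 / 2 by lra.
move=> /cvgrPdist_lt /(_ _ h2); apply: filterS => x hx y dxy.
have hy : 0 < chart_bump c b y.
  have := hd x y; have : C * d x y < 1 / 2 by rewrite -ltr_pdivlMl// mulrC.
  by move: hx; rewrite ltr_norml ler_norml => /andP[? ?] ? /andP[? ?]; lra.
have [Ky|nK] := pselect ((param c @` K) y); last by rewrite (chart_bump0 bK nK) ltxx in hy.
by case: Ky => u /hr[_ /= Wu] <-.
Qed.

Lemma dist_eq0 x y : d x y = 0 -> x = y.
Proof.
move=> dxy; apply: contrapT => /eqP xy.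
move: M_hausdorff; rewrite open_hausdorff => /(_ x y xy)[[P Q] /= [xP yQ] [oP oQ PQ]].
rewrite !inE in xP yQ.
have [e e0 he] := dist_nbhs oP xP.
have Py : P y by apply: (nbhs_singleton he); rewrite dxy.
by move/eqP: PQ => /seteqP[h _]; exact: (h y (conj Py yQ)).
Qed.

End Bump.

(** * The norm of a Hamiltonian *)

Section IteratedIntegral.
Context {R : realType}.

Lemma iterated_integral_ge0 m (f : 'rV[R]_m -> \bar R) :
  (forall v, (0 <= f v)%E) -> (0 <= iterated_integral f)%E.
Proof.
elim: m f => [|m IH] f f0 /=; first exact: f0.
by apply: integral_ge0 => x _; exact: IH.
Qed.

Lemma iterated_integral_le m (f g : 'rV[R]_m -> \bar R) :
  (forall v, (0 <= f v)%E) -> (forall v, (f v <= g v)%E) ->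
  (iterated_integral f <= iterated_integral g)%E.
Proof.
elim: m f g => [|m IH] f g f0 fg /=; first exact: fg.
apply: ge0_le_integral_nonmeasurable => x _; first exact: iterated_integral_ge0.
by apply: IH => v; [exact: f0|exact: fg].
Qed.

Definition box m (a : 'rV[R]_m) (r : R) : set 'rV[R]_m :=
  [set v | forall i, `|v 0 i - a 0 i| < r].

(** The indicator of a box is the product of that of an interval in the first coordinate and that of
    a box in the others. The factor [k] is there for the induction, where it absorbs the first
    indicator. *)
Lemma iterated_integral_box m (a : 'rV[R]_m) (r k : R) : 0 < r -> 0 <= k ->
  iterated_integral (fun v => (k * \1_(box a r) v)%:E) = (k * (2 * r) ^+ m)%:E.
Proof.
move=> r0; elim: m a k => [|m IH] a k k0 /=.
  by rewrite indicE mem_set ?mulr1 ?expr0 ?mulr1//; case.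
pose i0 : 'I_(1 + m) := lshift m (ord0 : 'I_1).
pose a0 := (a : 'rV[R]_(1 + m)) 0 i0.
pose a' : 'rV[R]_m := rsubmx (a : 'rV[R]_(1 + m)).
pose J := [set x : R | `|x - a0| < r].
have E x v : \1_(box a r) (row_mx (x%:M : 'rV_1) v) = \1_J x * \1_(box a' r) v :> R.
  rewrite !indicE -natrM mulnb; congr (_%:R); congr nat_of_bool.
  apply/idP/andP; rewrite !inE.
    move=> h; split; rewrite ?inE.
      by have := h i0; rewrite [X in `|X - _|](row_mxEl (x%:M : 'rV_1) v 0 ord0) mxE eqxx mulr1n.
    by move=> i; have := h (rshift 1 i); rewrite [X in `|X - _|](row_mxEr (x%:M : 'rV_1) v 0 i) !mxE.
  move=> [h1 h2] i; rewrite -[i]/(i : 'I_(1 + m)).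
  have := splitP (i : 'I_(1 + m)) => -[j Ej|j Ej].
    have -> : i = lshift m j by exact: val_inj.
    rewrite -[X in `|X - _|]/((row_mx _ _) 0 (lshift m j)) row_mxEl (ord1 j) mxE eqxx mulr1n.
    exact: h1.
  have -> : i = rshift 1 j by exact: val_inj.
  rewrite -[X in `|X - _|]/((row_mx _ _) 0 (rshift 1 j)) row_mxEr.
  by have := h2 j; rewrite mxE.
have -> : (fun x : R => iterated_integral (fun v : 'rV[R]_m =>
    (k * \1_(box a r) (row_mx (x%:M : 'rV_1) v))%:E)) =
    (fun x => ((k * (2 * r) ^+ m)%:E * (\1_J x)%:E)%E).
  apply/funext => x; have -> : (fun v : 'rV[R]_m => (k * \1_(box a r) (row_mx (x%:M : 'rV_1) v))%:E) =
      (fun v => ((k * \1_J x) * \1_(box a' r) v)%:E).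
    by apply/funext => v; rewrite E mulrA.
  rewrite IH; last by rewrite mulr_ge0// indicE ler0n.
  by rewrite -EFinM mulrAC.
have JE : J = `]a0 - r, a0 + r[%classic.
  apply/seteqP; split=> x; rewrite /J /= in_itv/= ltr_norml; lra.
have mJ : measurable J by rewrite JE; exact: measurable_itv.
rewrite ge0_integralZl_EFin//; last 2 first.
- by apply/measurable_EFinP; exact: measurable_indic.
- by rewrite mulr_ge0// exprn_ge0// mulr_ge0// ltW.
have mE : (lebesgue_measure (J : set R) = (2 * r)%:E)%E.
  rewrite JE lebesgue_measure_itv/= lte_fin ifT; last lra.
  by rewrite -EFinB; congr EFin; ring.
by rewrite integral_indic// setIT [X in (_ * X)%E]mE -EFinM -mulrA -exprSr.
Qed.

End IteratedIntegral.

(** * The volume measure and the norm of functions on M *)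

Section VolumeMeasure.
Context {R : realType} {n : nat} {M : ptopologicalType}.
Variables (A : atlas R n.*2.+1 M) (alpha : one_form A).
Variable mu : {measure set (borel M) -> \bar R}.
Hypotheses (M_compact : compact [set: M]) (alpha_contact : contact_form alpha).
Hypothesis mu_volume : volume_measure alpha mu.

Lemma finite_subcover (O : M -> set M) : (forall x, open (O x) /\ O x x) ->
  exists s : seq M, forall y, exists2 x, x \in s & O x y.
Proof.
move=> h; have := M_compact; rewrite compact_cover => /(_ M setT O).
case=> [i _|y _|D' _ hD].
- by have [] := h i.
- by exists y => //; have [] := h y.
- by exists (finmap.enum_fset D') => y; have [x /= xD Oxy] := hD y I; exists x.
Qed.

Lemma for_continuous_prod (X : topologicalType) k (f : 'I_k -> X -> R) (x : X) :
  (forall i, {for x, continuous (f i)}) -> {for x, continuous (fun y => \prod_(i < k) f i y)}.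
Proof.
elim: k f => [|k IH] f h.
  have -> : (fun y => \prod_(i < 0) f i y) = (fun _ : X => 1 : R).
    by apply/funext => y; rewrite big_ord0.
  exact: cst_continuous.
have -> : (fun y => \prod_(i < k.+1) f i y) =
    (fun y => (\prod_(i < k) f (widen_ord (leqnSn k) i) y) * f ord_max y).
  by apply/funext => y; rewrite big_ord_recr.
by apply: continuousM => //; exact: IH.
Qed.

Lemma for_continuous_bigsum (X : topologicalType) (J : Type) (s : seq J) (f : J -> X -> R) (x : X) :
  (forall i, {for x, continuous (f i)}) -> {for x, continuous (fun y => \sum_(i <- s) f i y)}.
Proof.
move=> h; elim: s => [|i s IH].
  have -> : (fun y => \sum_(i <- [::]) f i y) = (fun _ : X => 0 : R).
    by apply/funext => y; rewrite big_nil.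
  exact: cst_continuous.
have -> : (fun y => \sum_(i <- i :: s) f i y) = (fun y => f i y + \sum_(i <- s) f i y).
  by apply/funext => y; rewrite big_cons.
by apply: continuousD.
Qed.

Lemma volume_coef_continuous (c : chart A) (u : 'rV[R]_(n.*2.+1)) : img c u ->
  {for u, continuous (volume_coef (form_coef alpha c))}.
Proof.
move=> cu; have sa := @form_smooth _ _ _ _ alpha c.
have ca : {for u, continuous (form_coef alpha c)} by exact: smooth_continuous sa cu.
have ck q : smooth_on (img c) (fun w => form_coef alpha c w 0 q).
  pose L : {linear 'rV[R]_(n.*2.+1) -> R} := HB.pack (fun v : 'rV[R]_(n.*2.+1) => v 0 q : R)
    (GRing.isLinear.Build R 'rV[R]_(n.*2.+1) R *:%R _ (coord_is_linear q)).
  move=> k; apply: (@Ck_linear _ _ _ _ k (img c) L) => //; first exact: img_open.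
  exact: matrix_normedtype.coord_continuous.
have ce p q : {for u, continuous (fun w => ext_deriv (form_coef alpha c) w p q)}.
  have s1 : smooth_on (img c) ('D_(delta_mx 0 p) (fun w => form_coef alpha c w 0 q)).
    exact: smooth_derive.
  have s2 : smooth_on (img c) ('D_(delta_mx 0 q) (fun w => form_coef alpha c w 0 p)).
    exact: smooth_derive.
  apply: (continuousB (f := 'D_(delta_mx 0 p) (fun w => form_coef alpha c w 0 q))).
    exact: smooth_continuous s1 cu.
  exact: smooth_continuous s2 cu.
apply: continuousM; first exact: cst_continuous.
apply: for_continuous_bigsum => s; apply: continuousM; last first.
  by apply: for_continuous_prod => k; exact: ce.
by apply: continuousM; [exact: cst_continuous|exact: for_continuous_coord].
Qed.

(* Near each point the density of [mu] is bounded, and bounded away from 0. *)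
Lemma volume_local (x : M) : exists B : set M,
  [/\ open B, B x, (0 < mu B)%E & (mu B < +oo)%E].
Proof.
have [c cx] := dom_cover A x; have cu := img_coord cx; set u0 := coord c x.
pose w u := `|volume_coef (form_coef alpha c) u|.
have w0 : 0 < w u0 by rewrite /w normr_gt0; exact: alpha_contact.
have cw : {for u0, continuous w}.
  apply: (continuous_comp (volume_coef_continuous cu)); exact: norm_continuous.
have n1 : \forall u \near u0, w u0 / 2 < w u /\ w u < 2 * w u0.
  have aux (p q : R) : 0 < p -> `|p - q| < p / 2 -> p / 2 < q /\ q < 2 * p.
    by rewrite ltr_norml => p0 /andP[? ?]; split; lra.
  have w2 : 0 < w u0 / 2 by exact: divr_gt0.
  by have := cw => /cvgrPdist_lt /(_ _ w2); apply: filterS => u; exact: aux.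
have n2 : nbhs u0 (img c) by apply: open_nbhs_nbhs; split=> //; exact: img_open.
have [W [oW Wu WP]] := open_nbhs_of (filterI n1 n2).
have [r r0 hr] := chart_ball c oW Wu.
have boxball v : box u0 r v -> `|u0 - v| <= r.
  move=> bv; have [->|nz] := eqVneq (u0 - v) 0; first by rewrite normr0 ltW.
  have [[i j] /= E] : exists i : 'I_1 * 'I_(n.*2.+1), `|u0 - v| = `|(u0 - v) i.1 i.2|.
    by apply: mx_norm_neq0; rewrite -[mx_norm _]/(`|u0 - v|) normr_eq0.
  by rewrite E (ord1 i) !mxE distrC ltW.
have boxW v : box u0 r v -> W v by move=> /boxball/hr.
have oB : open (dom c `&` coord c @^-1` (box u0 r)).
  apply: open_setI_preimage; [exact: dom_open| |by move=> y; exact: coord_continuous].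
  rewrite openE => v bv; rewrite /interior.
  have h (i : 'I_(n.*2.+1)) : nbhs (v : 'rV[R]_(n.*2.+1)) [set v' : 'rV[R]_(n.*2.+1) | `|v' 0 i - u0 0 i| < r].
    have : {for v, continuous (fun v' : 'rV[R]_(n.*2.+1) => `|v' 0 i - u0 0 i|)}.
      apply: continuous_comp; last exact: norm_continuous.
      apply: continuousB; last exact: cst_continuous.
      exact: matrix_normedtype.coord_continuous.
    by move=> /(_ _ (near_lt (bv i))).
  exact: (@filter_forall _ _ _ _ (nbhs_filter (v : 'rV[R]_(n.*2.+1))) h).
exists (dom c `&` coord c @^-1` (box u0 r)).
have mB : measurable (dom c `&` coord c @^-1` (box u0 r) : set (borel M)).
  exact: sub_sigma_algebra.
have imgE : coord c @` (dom c `&` coord c @^-1` (box u0 r)) = box u0 r.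
  apply/seteqP; split=> [_ [y [_ /= by_] <-]//|v bv].
  have cv : img c v by have [] := WP v (boxW v bv).
  exists (param c v); last exact: param_coord.
  by split; [exact: param_dom|rewrite /= param_coord].
have muE := mu_volume mB (fun y (h : (dom c `&` coord c @^-1` (box u0 r)) y) => h.1).
rewrite imgE in muE.
have d1 v : (0 <= (\1_(box u0 r) v * `|volume_coef (form_coef alpha c) v|)%:E)%E.
  by rewrite lee_fin mulr_ge0// indicE ler0n.
split=> //.
- split=> //= i; by rewrite subrr normr0.
- rewrite muE; apply: (@lt_le_trans _ _ (iterated_integral (fun v => (w u0 / 2 * \1_(box u0 r) v)%:E))).
    rewrite iterated_integral_box//; last by rewrite divr_ge0// ltW.
    by rewrite lte_fin mulr_gt0// ?divr_gt0// exprn_gt0// mulr_gt0.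
  apply: iterated_integral_le => v; first by rewrite lee_fin mulr_ge0 ?indicE ?ler0n// divr_ge0// ltW.
  rewrite lee_fin indicE; have [/set_mem bv|_] := boolP (v \in box u0 r); last by rewrite mulr0 mul0r.
  by rewrite mulr1 mul1r ltW//; have [[]] := WP v (boxW v bv).
- rewrite muE; apply: (@le_lt_trans _ _ (iterated_integral (fun v => (2 * w u0 * \1_(box u0 r) v)%:E))).
    apply: iterated_integral_le => v //.
    rewrite lee_fin indicE; have [/set_mem bv|_] := boolP (v \in box u0 r); last by rewrite mulr0 mul0r.
    by rewrite mulr1 mul1r ltW//; have [[]] := WP v (boxW v bv).
  by rewrite iterated_integral_box ?ltry// mulr_ge0// ltW.
Qed.

Lemma volume_gt0 : (0 < mu setT)%E.
Proof.
have [B [oB _ B0 _]] := volume_local point; apply: lt_le_trans B0 _.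
by apply: le_measure => //; rewrite inE; [exact: sub_sigma_algebra|exact: measurableT].
Qed.

(** By compactness, finitely many of the open sets of finite measure from [volume_local] cover
    [M]. *)
Lemma volume_finite : (mu setT < +oo)%E.
Proof.
case: (boolp.choice volume_local) => O hO.
have [s hs] := finite_subcover (fun x => let: And4 a b _ _ := hO x in conj a b).
pose U (t : seq M) := [set y | exists2 x, x \in t & O x y].
have mO x : measurable (O x : set (borel M)) by have [oO _ _ _] := hO x; exact: sub_sigma_algebra.
suff h t : measurable (U t : set (borel M)) /\ (mu (U t) < +oo)%E.
  by have [_] := h s; rewrite (_ : U s = setT)//; apply/seteqP; split=> // y _; exact: hs.
elim: t => [|x t [mt ft]].
  have -> : U [::] = set0 by apply/seteqP; split=> // y [].
  by split; [exact: measurable0|rewrite measure0].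
have -> : U (x :: t) = O x `|` U t.
  apply/seteqP; split=> y.
    by move=> [z]; rewrite inE => /orP[/eqP ->|zt Oz]; [left|right; exists z].
  by move=> [Ox|[z zt Oz]]; [exists x => //; rewrite mem_head|exists z => //; rewrite inE zt orbT].
split; first exact: (measurableU _ _ (mO x) mt).
apply: le_lt_trans (measureU2 _ (mO x) mt) _.
by have [_ _ _ fx] := hO x; exact: lte_add_pinfty.
Qed.

Section Norm.

Lemma continuous_borel_measurable (f : M -> R) : continuous f ->
  measurable_fun setT (f : borel M -> R).
Proof.
move=> cf; apply: (measurability _ (RGenOpens.measurableE R)) => _ [_ [a [b ->] <-]].
rewrite setTI; apply: sub_sigma_algebra.
by apply: open_comp => [x _|]; [exact: cf|exact: interval_open].
Qed.

Lemma continuous_has_sup (f : M -> R) : continuous f -> has_sup (range f) /\ has_inf (range f).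
Proof.
move=> cf; have h (k : M -> R) : continuous k -> has_sup (range k).
  move=> ck; apply: compact_has_sup; first by exists (k point), point.
  by apply: continuous_compact => //; exact: continuous_subspaceT.
split; first exact: h.
have := h (fun x => - f x) (fun x => continuousN (cf x)) => -[_ [b hb]].
split; first by exists (f point), point.
exists (- b) => _ [y _ <-]; rewrite lerNl; apply: hb; by exists y.
Qed.

Lemma continuous_borel_integrable (f : M -> R) : continuous f ->
  mu.-integrable setT (EFin \o (f : borel M -> R)).
Proof.
move=> cf; apply: measurable_bounded_integrable => //.
- exact: volume_finite.
- exact: continuous_borel_measurable.
- have [[_ [a ha]] [_ [b hb]]] := continuous_has_sup cf.
  exists (Num.max `|a| `|b|); split; first exact: num_real.
  move=> x hx y _ /=; apply: ltW; apply: le_lt_trans hx.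
  have ya : f y <= a by apply: ha; exists y.
  have yb : b <= f y by apply: hb; exists y.
  have := ler_norm a; have := ler_norm (- b); rewrite normrN le_max => h1 h2.
  by rewrite !ler_norml; apply/orP; have [y0|y0] := leP 0 (f y); [left|right]; apply/andP; split; lra.
Qed.

Notation avg f := ((fine (mu setT))^-1 * \int[mu]_x f x).

Let vol0 : 0 < fine (mu setT).
Proof. by rewrite fine_gt0// volume_gt0 volume_finite. Qed.

Lemma average_between (f : M -> R) (a b : R) : continuous f -> (forall x, a <= f x <= b) ->
  a <= avg f <= b.
Proof.
move=> cf hab; have cint (k : R) : mu.-integrable setT (EFin \o (fun _ : borel M => k)).
  by apply: continuous_borel_integrable => x; exact: cst_continuous.
have hf := continuous_borel_integrable cf.
apply/andP; split.
  rewrite ler_pdivlMl// mulrC -Rintegral_cst; last exact: measurableT.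
  by apply: le_Rintegral => // x _; case/andP: (hab x).
rewrite ler_pdivrMl// mulrC -Rintegral_cst; last exact: measurableT.
by apply: le_Rintegral => // x _; case/andP: (hab x).
Qed.

Lemma range_between (f : M -> R) x : continuous f -> inf (range f) <= f x <= sup (range f).
Proof.
move=> cf; have [h1 h2] := continuous_has_sup cf; apply/andP; split.
  by apply: ge_inf; [case: h2|exists x].
by apply: ub_le_sup; [case: h1|exists x].
Qed.

(** The average lies between the extreme values of [f], so no value differs from it by more than the
    oscillation. *)
Lemma norm_le_osc_norm (f : M -> R) x : continuous f -> `|f x| <= osc_norm mu f.
Proof.
move=> cf; have := average_between cf (fun x => range_between x cf).
have := range_between x cf; rewrite /osc_norm; set a := avg f => /andP[? ?] /andP[? ?].
have := ler_norm a; have := ler_norm (- a); rewrite normrN => ? ?.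
by rewrite ler_norml; apply/andP; split; lra.
Qed.

Lemma osc_norm_ge0 (f : M -> R) : continuous f -> 0 <= osc_norm mu f.
Proof. by move=> cf; apply: le_trans (norm_le_osc_norm point cf). Qed.

(** The maximum, the minimum and the average contribute [C] each. *)
Lemma osc_norm_le (f : M -> R) (C : R) : continuous f -> (forall x, `|f x| <= C) ->
  osc_norm mu f <= 3 * C.
Proof.
move=> cf fC; have fC' x : - C <= f x <= C by rewrite -ler_norml.
have := average_between cf fC'; rewrite -ler_norml /osc_norm => h.
have [h1 h2] := continuous_has_sup cf.
have s1 : sup (range f) <= C.
  by apply: ge_sup; [case: h1|move=> _ [x _ <-]; case/andP: (fC' x)].
have s2 : - C <= inf (range f).
  by apply: lb_le_inf; [case: h2|move=> _ [x _ <-]; case/andP: (fC' x)].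
by move: h; set a := `|_|; lra.
Qed.

Lemma osc_normD (f k : M -> R) : continuous f -> continuous k ->
  osc_norm mu (fun x => f x + k x) <= osc_norm mu f + osc_norm mu k.
Proof.
move=> cf ck; have cfk : continuous (fun x => f x + k x) by move=> x; exact: (continuousD (cf x) (ck x)).
have [h1 h2] := continuous_has_sup cfk.
have s1 : sup (range (fun x => f x + k x)) <= sup (range f) + sup (range k).
  apply: ge_sup; first by case: h1.
  move=> _ [x _ <-]; have /andP[_ a1] := range_between x cf.
  by have /andP[_ a2] := range_between x ck; exact: lerD.
have s2 : inf (range f) + inf (range k) <= inf (range (fun x => f x + k x)).
  apply: lb_le_inf; first by case: h2.
  move=> _ [x _ <-]; have /andP[a1 _] := range_between x cf.
  by have /andP[a2 _] := range_between x ck; exact: lerD.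
have E : avg (fun x => f x + k x) = avg f + avg k.
  by rewrite (RintegralD measurableT (continuous_borel_integrable cf) (continuous_borel_integrable ck)) mulrDr.
rewrite /osc_norm E; have := ler_normD (avg f) (avg k).
set a := `|_ + _|; set b := `|_ * _|; set d := `|_ * _|; lra.
Qed.

(** The factor is exactly [k], whereas a detour through the supremum norm would cost a factor 3; the
    second alternative depends on this. *)
Lemma osc_normZ (f : M -> R) (k : R) : 0 <= k -> continuous f ->
  osc_norm mu (fun x => k * f x) <= k * osc_norm mu f.
Proof.
move=> k0 cf; have ckf : continuous (fun x => k * f x).
  by move=> x; apply: continuousM; [exact: cst_continuous|exact: cf].
have [h1 h2] := continuous_has_sup ckf.
have s1 : sup (range (fun x => k * f x)) <= k * sup (range f).
  apply: ge_sup; first by case: h1.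
  by move=> _ [x _ <-]; have /andP[_ a1] := range_between x cf; exact: ler_wpM2l.
have s2 : k * inf (range f) <= inf (range (fun x => k * f x)).
  apply: lb_le_inf; first by case: h2.
  by move=> _ [x _ <-]; have /andP[a1 _] := range_between x cf; exact: ler_wpM2l.
have E : avg (fun x => k * f x) = k * avg f.
  by rewrite (RintegralZl k measurableT (continuous_borel_integrable cf)) [LHS]mulrCA.
rewrite /osc_norm E normrM (ger0_norm k0) mulrDr mulrBr.
set a := k * `|_|; lra.
Qed.

End Norm.

End VolumeMeasure.

(** * Uniform control *)

Section Clamp.
Context {R : realType}.

(** The retraction of R onto [0, 1]: composing with it turns families that are continuous within
    [0, 1] x M into functions continuous on all of R x M. *)
Definition clamp (t : R) : R := Num.max 0 (Num.min 1 t).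

Lemma clamp_id t : t \in `[(0 : R), 1] -> clamp t = t.
Proof. by rewrite in_itv/= /clamp => /andP[t0 t1]; rewrite (min_idPr t1) (max_idPr t0). Qed.

Lemma clamp_in t : clamp t \in `[(0 : R), 1].
Proof. by rewrite in_itv/= /clamp le_max lexx/= ge_max ler01 ge_min lexx. Qed.

Lemma clamp_continuous : continuous clamp.
Proof.
have c1 : continuous (fun t : R => Num.min 1 t).
  by move=> x; have := @continuous_min R R (fun _ => 1) id x (@cst_continuous _ _ _ _) (@cvg_id _ _).
by move=> x; have := @continuous_max R R (fun _ => 0) _ x (@cst_continuous _ _ _ _) (c1 x).
Qed.

Lemma continuous_clamp (M X : topologicalType) (phi : R -> M -> X) :
  {within `[0, 1] `*` [set: M], continuous (fun p : R * M => phi p.1 p.2)} ->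
  continuous (fun p : R * M => phi (clamp p.1) p.2).
Proof.
move=> /(within_continuousP [set` `[0, 1]]) h [t x] W; rewrite nbhsE => -[N [oN Nx] NW].
have n := h (clamp t) x (clamp_in t) N oN Nx.
have : nbhs (t, x) [set q : R * M | [set` `[0, 1]] (clamp q.1) -> N (phi (clamp q.1) q.2)].
  exact: (near_map_fst (@clamp_continuous t) n).
by apply: filterS => q /= /(_ (clamp_in _)) /NW.
Qed.

Lemma continuous_slice (M X : topologicalType) (phi : R -> M -> X) t :
  {within `[0, 1] `*` [set: M], continuous (fun p : R * M => phi p.1 p.2)} ->
  t \in `[(0 : R), 1] -> continuous (phi t).
Proof.
move=> /continuous_clamp h t01 x.
have -> : phi t = (fun p : R * M => phi (clamp p.1) p.2) \o (fun y => (t, y)).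
  by apply/funext => y /=; rewrite clamp_id.
apply: (@continuous_comp _ _ _ (fun y => (t, y)) (fun p : R * M => phi (clamp p.1) p.2)); last exact: h.
move=> P [[P1 P2] [/= n1 n2] PP]; apply: filterS n2 => y P2y.
by apply: (PP (t, y)); split=> //; exact: nbhs_singleton.
Qed.

End Clamp.

Lemma smooth_function_continuous (R : realType) (m : nat) (M : ptopologicalType) (A : atlas R m M)
    (T : set R) (f : R -> M -> R) : smooth_function A T f ->
  {within T `*` [set: M], continuous (fun p : R * M => f p.1 p.2)}.
Proof.
move=> /function_repP r; apply/within_continuousP => t x Tt W oW Wx.
have [c cx] := dom_cover A x.
have [U [G [Utu [oU sG GE]]]] := r c t (coord c x) Tt (img_coord cx).
have cG : {for (t, coord c x), continuous G} by exact: smooth_continuous sG Utu.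
have [_ E0] := GE _ _ Tt Utu; rewrite coordK// in E0.
have n1 : nbhs (t, coord c x) (G @^-1` W).
  by apply: cG; rewrite -E0; apply: open_nbhs_nbhs.
have n2 : nbhs (t, coord c x) U by exact: open_nbhs_nbhs.
have n3 : nbhs (t, x) [set q : R * M | (G @^-1` W `&` U) (q.1, coord c q.2)].
  exact: (near_map_snd (@coord_continuous _ _ _ A c x cx) (filterI n1 n2)).
have n4 : nbhs (t, x) [set q : R * M | dom c q.2].
  by apply: near_snd; apply: open_nbhs_nbhs; split=> //; exact: dom_open.
apply: filterS2 n3 n4 => q [/= q1 q2] cq Tq.
by have [_] := GE _ _ Tq q2; rewrite coordK// => ->.
Qed.

Section Metric.
Context {R : realType} {m : nat} {M : ptopologicalType} (A : atlas R m M) (g : riemannian A).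
Hypotheses (M_compact : compact [set: M]) (M_hausdorff : hausdorff_space M).
Hypothesis M_connected : connected [set: M].
Notation d := (riem_dist g).

(* The symmetry of the Riemannian distance is never needed: this symmetrization suffices. *)
Definition sym_dist (x y : M) : R := d x y + d y x.
Notation D := sym_dist.

Lemma sym_dist_ge0 x y : 0 <= D x y.
Proof. by rewrite addr_ge0// dist_ge0. Qed.

Lemma sym_dist_xx x : D x x = 0.
Proof. by rewrite /D dist_xx// addr0. Qed.

Lemma sym_distC x y : D x y = D y x.
Proof. exact: addrC. Qed.

Lemma sym_dist_triangle x y z : D x z <= D x y + D y z.
Proof.
by have := dist_triangle g M_connected x y z; have := dist_triangle g M_connected z y x; rewrite /D; lra.
Qed.

Lemma dist_le_sym x y : d x y <= D x y.
Proof. by rewrite lerDl dist_ge0. Qed.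

Lemma sym_dist_eq0 x y : D x y = 0 -> x = y.
Proof.
move=> h; apply: (@dist_eq0 _ _ _ _ g) => //.
by apply/eqP; rewrite eq_le dist_ge0// andbT -h dist_le_sym.
Qed.

Lemma sym_dist_continuous : continuous (fun p : M * M => D p.1 p.2).
Proof.
move=> p; apply: (@continuousD _ _ _ (fun p : M * M => d p.1 p.2) (fun p : M * M => d p.2 p.1)).
  exact: dist_continuous.
apply: (@continuous_comp _ _ _ (fun p : M * M => (p.2, p.1)) (fun p => d p.1 p.2)).
  by apply: cvg_pair => /=; [exact: cvg_snd|exact: cvg_fst].
exact: dist_continuous.
Qed.

Lemma dist_bounded : exists B, forall x y, d x y <= B.
Proof.
have : has_sup (range (fun p : M * M => d p.1 p.2)).
  apply: compact_has_sup; first by exists (d point point), (point, point).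
  apply: continuous_compact; first exact: continuous_subspaceT (@dist_continuous _ _ _ _ g M_connected).
  by rewrite -setXTT; exact: compact_setX.
by move=> [_ [B hB]]; exists B => x y; apply: hB; exists (x, y).
Qed.

(** On the compact product of [M] with itself, [d x y = 0] forces [x = y] and thus [D x y = 0];
    compactness makes this quantitative. *)
Lemma sym_dist_control e : 0 < e -> exists2 r, 0 < r & forall x y, d x y < r -> D x y < e.
Proof.
move=> e0; have cK : compact ([set: M] `*` [set: M]) by exact: compact_setX.
have [] := @compact_control R _ _ _ _ cK (@dist_continuous _ _ _ _ g M_connected) sym_dist_continuous _ _ e e0.
- by move=> p _; exact: dist_ge0.
- by move=> [x y] _ /= /(dist_eq0 M_hausdorff M_connected) ->; rewrite sym_dist_xx.
- by move=> r r0 h; exists r => // x y xy; apply: (h (x, y)).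
Qed.

(** Uniform continuity on [0, 1] x M, by [compact_control] on the square of this compact set. The
    function [rho] stands for a distance on [Y], so that real-valued functions and maps to [M] are
    treated at once. *)
Lemma uniform_control (Y : topologicalType) (rho : Y * Y -> R) (k : R -> M -> Y) :
  continuous rho -> (forall y, rho (y, y) = 0) ->
  {within `[0, 1] `*` [set: M], continuous (fun p : R * M => k p.1 p.2)} ->
  forall e, 0 < e -> exists2 r, 0 < r & forall s t x y, s \in `[0, 1] -> t \in `[0, 1] ->
    `|s - t| + D x y < r -> rho (k s x, k t y) < e.
Proof.
move=> crho rho0 ck e e0; have ck' := continuous_clamp ck.
pose K := [set` `[(0:R), 1]] `*` [set: M].
have cK : compact (K `*` K) by apply: compact_setX; apply: compact_setX => //; exact: segment_compact.
pose F (p : (R * M) * (R * M)) := `|p.1.1 - p.2.1| + D p.1.2 p.2.2.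
pose G (p : (R * M) * (R * M)) := rho (k (clamp p.1.1) p.1.2, k (clamp p.2.1) p.2.2).
have cF : continuous F.
  move=> p; apply: (@continuousD _ _ _ (fun p : (R * M) * (R * M) => `|p.1.1 - p.2.1|)
    (fun p : (R * M) * (R * M) => D p.1.2 p.2.2)).
    apply: (continuous_comp (f := fun p : (R * M) * (R * M) => p.1.1 - p.2.1)); last exact: norm_continuous.
    apply: (continuousB (f := fun p : (R * M) * (R * M) => p.1.1)).
      by apply: continuous_comp; exact: cvg_fst.
    by apply: continuous_comp; [exact: cvg_snd|exact: cvg_fst].
  apply: (@continuous_comp _ _ _ (fun p : (R * M) * (R * M) => (p.1.2, p.2.2)) (fun p => D p.1 p.2)).
    apply: cvg_pair => /=.
      by apply: continuous_comp; [exact: cvg_fst|exact: cvg_snd].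
    by apply: continuous_comp; exact: cvg_snd.
  exact: sym_dist_continuous.
have cG : continuous G.
  move=> p; apply: (@continuous_comp _ _ _ (fun p : (R * M) * (R * M) =>
    (k (clamp p.1.1) p.1.2, k (clamp p.2.1) p.2.2)) rho); last exact: crho.
  apply: cvg_pair => /=.
    apply: (@continuous_comp _ _ _ (fun p : (R * M) * (R * M) => p.1) (fun p : R * M => k (clamp p.1) p.2)).
      exact: cvg_fst.
    exact: ck'.
  apply: (@continuous_comp _ _ _ (fun p : (R * M) * (R * M) => p.2) (fun p : R * M => k (clamp p.1) p.2)).
    exact: cvg_snd.
  exact: ck'.
have [] := @compact_control R _ _ _ _ cK cF cG _ _ e e0.
- by move=> p _; rewrite addr_ge0// sym_dist_ge0.
- move=> [[s x] [t y]] _; rewrite /F /G /= => /eqP.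
  rewrite paddr_eq0// ?sym_dist_ge0// normr_eq0 subr_eq0 => /andP[/eqP -> /eqP/sym_dist_eq0 ->].
  by rewrite rho0.
- move=> r r0 h; exists r => // s t x y s01 t01 st.
  by have := h ((s, x), (t, y)); rewrite /F /G /= !clamp_id//; exact.
Qed.

Lemma uniform_control_real (k : R -> M -> R) :
  {within `[0, 1] `*` [set: M], continuous (fun p : R * M => k p.1 p.2)} ->
  forall e, 0 < e -> exists2 r, 0 < r & forall s t x y, s \in `[0, 1] -> t \in `[0, 1] ->
    `|s - t| + D x y < r -> `|k s x - k t y| < e.
Proof.
move=> ck; apply: (@uniform_control _ (fun p : R * R => `|p.1 - p.2|)) => //.
  move=> p; apply: (continuous_comp (f := fun p : R * R => p.1 - p.2)); last exact: norm_continuous.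
  by apply: (continuousB (f := fst)); [exact: cvg_fst|exact: cvg_snd].
by move=> y /=; rewrite subrr normr0.
Qed.

Lemma uniform_control_map (k : R -> M -> M) :
  {within `[0, 1] `*` [set: M], continuous (fun p : R * M => k p.1 p.2)} ->
  forall e, 0 < e -> exists2 r, 0 < r & forall s t x y, s \in `[0, 1] -> t \in `[0, 1] ->
    `|s - t| + D x y < r -> D (k s x) (k t y) < e.
Proof.
move=> ck; apply: (@uniform_control _ (fun p : M * M => D p.1 p.2)) => //; first exact: sym_dist_continuous.
by move=> y /=; rewrite sym_dist_xx.
Qed.

Lemma dist_C0_ge (phi psi : M -> M) x : d (phi x) (psi x) <= dist_C0 g phi psi.
Proof.
have [B hB] := dist_bounded; apply: ub_le_sup; last by exists x.
by exists B => _ [y _ <-].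
Qed.

Lemma dist_C0_le (phi psi : M -> M) a : (forall x, d (phi x) (psi x) <= a) -> dist_C0 g phi psi <= a.
Proof.
move=> h; apply: ge_sup; first by exists (d (phi point) (psi point)), point.
by move=> _ [x _ <-].
Qed.

Lemma dist_C0_ge0 (phi psi : M -> M) : 0 <= dist_C0 g phi psi.
Proof. by apply: le_trans (dist_C0_ge phi psi point); exact: dist_ge0. Qed.

Lemma dbar_ge (Phi Psi : isotopy R M) t : t \in `[0, 1] ->
  dist_C0 g (fwd Phi t) (fwd Psi t) + dist_C0 g (bwd Phi t) (bwd Psi t) <= dbar g Phi Psi.
Proof.
move=> t01; have [B hB] := dist_bounded; apply: ub_le_sup; last by exists t.
by exists (B + B) => _ [s _ <-]; apply: lerD; exact: dist_C0_le.
Qed.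

Lemma dbar_le (Phi Psi : isotopy R M) a : (forall t, t \in `[0, 1] ->
  dist_C0 g (fwd Phi t) (fwd Psi t) + dist_C0 g (bwd Phi t) (bwd Psi t) <= a) -> dbar g Phi Psi <= a.
Proof.
move=> h; apply: ge_sup; last by move=> _ [s s01 <-]; exact: h.
by eexists; exists 0; [rewrite /= in_itv/= lexx ler01|reflexivity].
Qed.

Lemma dbar_ge0 (Phi Psi : isotopy R M) : 0 <= dbar g Phi Psi.
Proof.
apply: le_trans (dbar_ge (t := 0) Phi Psi _); first by rewrite addr_ge0// dist_C0_ge0.
by rewrite in_itv/= lexx ler01.
Qed.

Lemma dbar_le_pointwise (Phi Psi : isotopy R M) a :
  (forall t x, t \in `[0, 1] -> D (fwd Phi t x) (fwd Psi t x) <= a) ->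
  (forall t x, t \in `[0, 1] -> D (bwd Phi t x) (bwd Psi t x) <= a) -> dbar g Phi Psi <= 2 * a.
Proof.
move=> h1 h2; apply: dbar_le => t t01; rewrite mulr_natl; apply: lerD; apply: dist_C0_le => x.
  exact: le_trans (dist_le_sym _ _) (h1 _ _ t01).
exact: le_trans (dist_le_sym _ _) (h2 _ _ t01).
Qed.

Lemma dbar_sym_dist e : 0 < e -> exists2 r, 0 < r & forall Phi Psi : isotopy R M,
  dbar g Phi Psi < r -> forall t x, t \in `[0, 1] ->
  D (fwd Phi t x) (fwd Psi t x) < e /\ D (bwd Phi t x) (bwd Psi t x) < e.
Proof.
move=> /sym_dist_control[r r0 h]; exists r => // Phi Psi lt t x t01.
have h1 := dbar_ge Phi Psi t01.
split; apply: h; apply: le_lt_trans lt; apply: le_trans h1.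
  by apply: le_trans (dist_C0_ge _ _ x) _; rewrite lerDl dist_C0_ge0.
by apply: le_trans (dist_C0_ge _ _ x) _; rewrite lerDr dist_C0_ge0.
Qed.

(** A neighbourhood of [l p0] contains a ball of fixed radius around each point close to [l p0], by
    [dist_nbhs]; so closeness of [k] to the continuous map [l] is enough. *)
Lemma dist_limit_continuous (T : topologicalType) (p0 : T) (k : T -> M) (l : T -> M) :
  {for p0, continuous l} -> k p0 = l p0 ->
  (forall e, 0 < e -> \forall p \near p0, D (k p) (l p) < e) -> {for p0, continuous k}.
Proof.
move=> cl E h W; rewrite E nbhsE => -[N [oN Nx] NW].
have [e e0 n] := @dist_nbhs _ _ _ _ g M_hausdorff M_connected _ _ oN Nx.
have n1 : nbhs p0 (l @^-1` [set x | forall y, d x y < e -> N y]) by exact: cl n.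
apply: filterS2 n1 (h e e0) => p /= q1 q2; apply: NW; apply: q1.
by apply: le_lt_trans q2; rewrite sym_distC dist_le_sym.
Qed.

End Metric.

(* The integrand of [norm_1oo] may fail to be measurable, so that its integral must be compared
   directly with integrals of measurable functions. *)
Section LowerIntegrals.
Context d (T : measurableType d) (R : realType) (nu : {measure set T -> \bar R}).
Variables (D N : set T).
Hypotheses (mD : measurable D) (mN : measurable N) (N0 : nu N = 0%E).
Local Open Scope ereal_scope.

(** Off the null set [N] one has 0 <= e <= f. Hence the negative part of [f] lies below the function
    equal to +oo on [N] and to 0 elsewhere, whose integral is 0, and [N] can be removed from the
    integral of [e]. *)
Lemma le_integral_lower (e f : T -> \bar R) : measurable_fun D e -> (forall t, D t -> 0 <= e t) ->
  (forall t, D t -> ~ N t -> e t <= f t) -> \int[nu]_(t in D) e t <= \int[nu]_(t in D) f t.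
Proof.
move=> me e0 ef; have mDN : measurable (D `\` N) by exact: measurableD.
have mDI : measurable (D `&` N) by exact: measurableI.
rewrite (ge0_negligible_integral mN mD me e0 N0).
have -> : \int[nu]_(t in D) f t = \int[nu]_(t in D) (f^\+ t).
  rewrite integralE [X in _ - X](_ : _ = 0) ?sube0//; apply/eqP; rewrite eq_le; apply/andP; split; last first.
    by apply: integral_ge0 => t _; exact: funeneg_ge0.
  have -> : 0 = \int[nu]_(t in D) ((cst +oo) \_ N) t.
    by rewrite -integral_mkcondr null_set_integral//; exact: (subset_measure0 mDI mN).
  apply: ge0_le_integral_nonmeasurable => t Dt; first exact: funeneg_ge0.
  rewrite patchE; case: ifPn => [_|/negP nN]; first by rewrite leey.
  rewrite funenegE ge_max lexx andbT leeNl oppe0; apply: le_trans (e0 t Dt) _; apply: ef => //.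
  by move=> Nt; apply: nN; rewrite inE.
rewrite [X in X <= _]integral_mkcond [X in _ <= X]integral_mkcond.
apply: ge0_le_integral_nonmeasurable => t _; rewrite !patchE.
  by case: ifPn => //; rewrite inE => -[/e0].
case: ifPn => [|_]; first by rewrite inE => -[Dt nN]; rewrite mem_set// funeposE le_max ef.
by case: ifPn => // _; exact: funepos_ge0.
Qed.

(** The positive part of [f] lies below [e + k], with [k] equal to +oo on [N] and to 0 elsewhere: a
    measurable majorant with the same integral as [e]. *)
Lemma le_integral_upper (e f : T -> \bar R) : measurable_fun D e -> (forall t, D t -> 0 <= e t) ->
  (forall t, D t -> ~ N t -> f t <= e t) -> \int[nu]_(t in D) f t <= \int[nu]_(t in D) e t.
Proof.
move=> me e0 fe; rewrite integralE.
have h0 : 0 <= \int[nu]_(t in D) f^\- t by apply: integral_ge0 => t _; exact: funeneg_ge0.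
apply: (@le_trans _ _ (\int[nu]_(t in D) f^\+ t)).
  by rewrite -[leRHS]sube0; apply: leeB.
pose k := (cst +oo : T -> \bar R) \_ N.
have mk : measurable_fun D k.
  apply: (measurable_funS measurableT) => //.
  by apply/(measurable_restrictT _ mN); exact: measurable_cst.
have k0 t : 0 <= k t by rewrite /k patchE; case: ifPn => // _; rewrite leey.
apply: (@le_trans _ _ (\int[nu]_(t in D) (e t + k t))).
  apply: ge0_le_integral_nonmeasurable => t Dt; first exact: funepos_ge0.
  have [Nt|nN] := pselect (N t).
    by rewrite /k patchE mem_set// addey ?leey// gt_eqF// (lt_le_trans _ (e0 t Dt))// ltNy0.
  have h : 0 <= e t + k t by rewrite adde_ge0// e0.
  by rewrite funeposE ge_max h andbT (le_trans (fe t Dt nN))// leeDl.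
rewrite ge0_integralD// [X in _ + X](_ : _ = 0) ?adde0//.
have mDN : measurable (D `&` N) by exact: measurableI.
by rewrite /k -integral_mkcondr null_set_integral//; exact: (subset_measure0 mDN mN).
Qed.

End LowerIntegrals.

Section DenseSequence.
Context {R : realType} {m : nat} {M : ptopologicalType} (A : atlas R m M).

(** Finitely many charts cover [M], and the points with rational coordinates in them are dense.
    Coordinates outside the image of a chart give arbitrary points, which do no harm. *)
Lemma dense_sequence : compact [set: M] ->
  exists D : nat -> M, forall W, open W -> W !=set0 -> exists n, W (D n).
Proof.
move=> cM; case: (boolp.choice (dom_cover A)) => ch hch.
have [s hs] := finite_subcover cM (fun x => conj (@dom_open _ _ _ A (ch x)) (hch x)).
exists (fun n => if unpickle n is Some (k, q) then
  param (ch (nth point s k)) (map_mx ratr (q : 'rV[rat]_m)) else point) => W oW [y Wy].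
have [x xs cy] := hs y; set c := ch x in cy.
have cu := img_coord cy; set u := coord c y in cu.
have n1 : nbhs u (param c @^-1` W).
  by apply: (param_continuous cu); rewrite coordK//; exact: open_nbhs_nbhs.
move: n1 => /nbhs_ballP[e /= e0 he].
have hq i : exists q : rat, ratr q \in `]u 0 i, (u 0 i + e)[.
  by apply: rat_in_itvoo; rewrite ltrDl.
case: (boolp.choice hq) => q hq'.
exists (pickle (index x s, (\row_i q i : 'rV[rat]_m))); rewrite pickleK nth_index//; apply: he.
split=> // i j; rewrite (ord1 i) !mxE /ball/=.
by have := hq' j; rewrite in_itv/= => /andP[q1 q2]; rewrite distrC gtr0_norm; lra.
Qed.

End DenseSequence.

Section Gap.
Context {R : realType} {M : ptopologicalType} (D : nat -> M).
Hypothesis D_dense : forall W, open W -> W !=set0 -> exists n, W (D n).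
Local Open Scope ereal_scope.

(* For a continuous [f] this is the supremum norm; as a countable supremum, it depends measurably
   on parameters. *)
Definition gap (f : M -> R) : \bar R := esups (fun n => `|f (D n)|%:E) 0%N.

Lemma gap_ge (f : M -> R) n : `|f (D n)|%:E <= gap f.
Proof. by apply: ereal_sup_ubound; exists n. Qed.

Lemma gap_ge0 (f : M -> R) : 0 <= gap f.
Proof. by apply: le_trans (gap_ge f 0%N); rewrite lee_fin. Qed.

Lemma gap_le (f : M -> R) a : (forall x, `|f x|%:E <= a) -> gap f <= a.
Proof. by move=> h; apply: ge_ereal_sup => _ [n _ <-]; exact: h. Qed.

Lemma le_of_dense (f : M -> R) a : continuous f -> (forall n, `|f (D n)|%:E <= a) ->
  forall x, `|f x|%:E <= a.
Proof.
case: a => [a| |] cf h x; [|by rewrite leey|by have := h 0%N; rewrite leeNy_eq].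
rewrite lee_fin leNgt; apply/negP => ax.
have oW : open [set y | (a < `|f y|)%R].
  apply: (open_comp (f := fun y => `|f y|%R) (D := [set r | (a < r)%R])).
    by move=> y _; apply: (continuous_comp (cf y)); exact: norm_continuous.
  exact: open_gt.
have [n /=] := D_dense oW (ex_intro _ x ax).
by rewrite ltNge -lee_fin h.
Qed.

Lemma le_gap (f : M -> R) x : continuous f -> `|f x|%:E <= gap f.
Proof. by move=> cf; apply: le_of_dense => // n; exact: gap_ge. Qed.

Lemma gap_measurable (T : set R) (G : R -> M -> R) :
  (forall n, measurable_fun T (fun t => G t (D n))) -> measurable_fun T (fun t => gap (G t)).
Proof.
move=> h; apply: (@measurable_fun_esups _ _ _ T (fun n t => `|G t (D n)|%:E)) => n.
by apply/measurable_EFinP; apply: measurableT_comp => //; exact: h.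
Qed.

End Gap.

(** * Approximation by smooth contact systems *)

Section UniformLimits.
Context {R : realType} {M : ptopologicalType}.
Implicit Types (h : R -> M -> R).

Lemma uniform_limitP (h_ : nat -> R -> M -> R) h : uniform_limit h_ h <->
  forall e, 0 < e -> exists N, forall i t x, (N <= i)%N -> t \in `[0, 1] -> `|h_ i t x - h t x| < e.
Proof.
split=> [u e e0|H].
  pose E : set (R * R) := [set xy | ball xy.1 e xy.2].
  have eE : entourage E by exact: (entourage_ball R (PosNum e0)).
  have nE : nbhs ((fun p : R * M => h p.1 p.2) : {uniform` `[0, 1] `*` [set: M] -> R})
      [set k | forall y, (`[0, 1] `*` [set: M]) y -> E (h y.1 y.2, k y)].
    by apply/uniform_nbhs; exists E; split.
  have [N _ hN] := u _ nE; exists N => i t x Ni t01.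
  by have := hN i Ni (t, x) (conj t01 I); rewrite /E/= /ball/= distrC.
move=> P /uniform_nbhs[E []]; rewrite -entourage_ballE => -[e /= e0 eE] EP.
have [N hN] := H e e0; exists N => // i /= Ni; apply: EP => -[t x] [/= t01 _].
by apply: eE; rewrite /ball/= distrC; exact: hN.
Qed.

Lemma uniform_limit_continuous (h_ : nat -> R -> M -> R) h : uniform_limit h_ h ->
  (forall i, {within `[0, 1] `*` [set: M], continuous (fun p : R * M => h_ i p.1 p.2)}) ->
  {within `[0, 1] `*` [set: M], continuous (fun p : R * M => h p.1 p.2)}.
Proof.
move=> u ch; apply: (uniform_limit_continuous_subspace _ _ u); exact: (@nearW _ \oo _ _ ch).
Qed.

Lemma continuous_family_bounded (k : R -> M -> R) : compact [set: M] ->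
  {within `[0, 1] `*` [set: M], continuous (fun p : R * M => k p.1 p.2)} ->
  exists2 C, 0 < C & forall t x, t \in `[0, 1] -> `|k t x| <= C.
Proof.
move=> cM ck; pose S : set (R * M) := [set` `[(0 : R), 1]] `*` [set: M].
have cK : compact S by apply: compact_setX => //; exact: segment_compact.
have ck' : continuous (fun p : R * M => `|k (clamp p.1) p.2|).
  move=> p; apply: (continuous_comp (f := fun p : R * M => k (clamp p.1) p.2)).
    exact: (continuous_clamp ck).
  exact: norm_continuous.
have K0 : S (0, point) by split=> //=; rewrite in_itv/= lexx ler01.
have [_ [C hC]] := compact_has_sup (image_nonempty _ (ex_intro _ _ K0))
  (continuous_compact (continuous_subspaceT ck') cK).
exists (Num.max C 1); first by rewrite lt_max ltr01 orbT.
by move=> t x t01; rewrite le_max; apply/orP; left; apply: hC; exists (t, x); rewrite /= ?clamp_id.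
Qed.

End UniformLimits.

Section Approximation.
Context {R : realType} {n : nat} {M : ptopologicalType} (A : atlas R n.*2.+1 M).
Variables (alpha : one_form A) (g : riemannian A) (mu : {measure set (borel M) -> \bar R}).
Hypotheses (M_compact : compact [set: M]) (M_hausdorff : hausdorff_space M).
Hypotheses (M_connected : connected [set: M]) (alpha_contact : contact_form alpha).
Hypothesis mu_volume : volume_measure alpha mu.
Notation D := (sym_dist g).
Notation I01 := [set` `[(0 : R), 1]].
Notation leb := (@lebesgue_measure R).

Lemma osc_norm_lee (f : M -> R) a : continuous f -> (forall x, (`|f x|%:E <= a)%E) ->
  ((osc_norm mu f)%:E <= 3%:E * a)%E.
Proof.
case: a => [a| |] cf h.
- by rewrite -EFinM lee_fin; apply: (osc_norm_le M_compact alpha_contact mu_volume).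
- by rewrite gt0_muley ?leey// lte_fin.
- by have := h point; rewrite leeNy_eq.
Qed.

Lemma osc_norm_dist (f k : M -> R) C : continuous f -> continuous k ->
  (forall x, `|f x - k x| <= C) -> osc_norm mu f <= osc_norm mu k + 3 * C.
Proof.
move=> cf ck fk; have cfk : continuous (fun x => f x - k x).
  by move=> x; exact: (continuousB (cf x) (ck x)).
have -> : f = (fun x => k x + (f x - k x)) by apply/funext => x; rewrite addrC subrK.
apply: le_trans (osc_normD M_compact alpha_contact mu_volume ck cfk) _.
by rewrite lerD2l; exact: (osc_norm_le M_compact alpha_contact mu_volume).
Qed.

Lemma osc_norm_continuous (G : R -> M -> R) :
  {within I01 `*` [set: M], continuous (fun p : R * M => G p.1 p.2)} ->
  continuous (fun t => osc_norm mu (G (clamp t))).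
Proof.
move=> cG t; apply/cvgrPdist_lt => e e0.
have e4 : 0 < e / 4 by exact: divr_gt0.
have [r r0 hr] := @uniform_control_real _ _ _ _ g M_compact M_hausdorff M_connected G cG _ e4.
have : nbhs t [set s : R | `|clamp t - clamp s| < r].
  by have := @clamp_continuous R t => /cvgrPdist_lt/(_ r r0).
apply: filterS => s /= ts.
have cc u : continuous (G (clamp u)) by exact: (continuous_slice cG (clamp_in u)).
have k1 x : `|G (clamp t) x - G (clamp s) x| <= e / 4.
  by apply: ltW; apply: hr; rewrite ?clamp_in// sym_dist_xx// addr0.
have k2 x : `|G (clamp s) x - G (clamp t) x| <= e / 4 by rewrite distrC.
have := osc_norm_dist (cc t) (cc s) k1; have := osc_norm_dist (cc s) (cc t) k2.
by move=> h1 h2; rewrite ltr_norml; apply/andP; split; lra.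
Qed.

(** At time 0 the conformal equation reads alpha = e^h alpha, and a contact form vanishes at no
    point, since its volume coefficient would vanish there. This makes the conformal factors of
    consecutive pieces match. *)
Lemma conformal_zero (X : R -> slice R M) : contact_path alpha X ->
  (forall x, sfwd (X 0) x = x) -> forall x, sconf (X 0) x = 0.
Proof.
move=> [_ _ _ _ [_ hc]] X0 x; have [c cx] := dom_cover A x.
have cu := img_coord cx; set u := coord c x in cu.
have xE : param c u = x by rewrite /u coordK.
have [v nv] : exists v, pairing (form_coef alpha c u) v != 0.
  apply: contrapT => h; have := alpha_contact cu; apply/negP/negPn.
  have a0 k : form_coef alpha c u 0 k = 0.
    apply: contrapT => nk; apply: h; exists (delta_mx 0 k).
    rewrite /pairing (bigD1 k)//= big1 => [|j jk]; last by rewrite mxE eqxx (negbTE jk) mulr0.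
    by rewrite mxE !eqxx mulr1 addr0; apply/eqP.
  by rewrite /volume_coef big1 ?mulr0// => s _; rewrite a0 mulr0 mul0r.
have t01 : (0 : R) \in `[0, 1] by rewrite in_itv/= lexx ler01.
have := hc 0 c c u v t01 cu; rewrite /= X0 xE => /(_ cx).
have -> : (fun w => coord c (sfwd (X 0) (param c w))) = (fun w => coord c (param c w)).
  by apply/funext => w; rewrite X0.
have -> : 'D_v (fun w => coord c (param c w)) u = v.
  apply: (etrans _ (derive_id u v)); apply: near_eq_derive; have : nbhs u (img c) by apply: open_nbhs_nbhs; split=> //; exact: img_open.
  by apply: filterS => w cw; rewrite param_coord.
move=> E; apply: (@expR_inj R); rewrite expR0.
by apply: (mulIf nv); rewrite mul1r -E.
Qed.

Variables (PhiH : isotopy R M) (H h : R -> M -> R) (X : nat -> R -> slice R M).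
Hypotheses (cPhi : continuous_isotopy PhiH) (HL1 : L1C0 mu H).
Hypotheses (cX : forall i, contact_path alpha (X i)) (X0 : forall i x, sfwd (X i 0) x = x).
Hypothesis Xdbar : dbar g (path_isotopy (X i)) PhiH @[i --> \oo] --> (0 : R).
Hypothesis Xconf : uniform_limit (fun i t => sconf (X i t)) h.
Hypothesis Xham : norm_1oo mu (fun t x => H t x - sham (X i t) x) @[i --> \oo] --> 0%E.

Lemma ham_continuous i : {within I01 `*` [set: M], continuous (fun p : R * M => sham (X i p.1) p.2)}.
Proof. by have [_ _ s _ _] := cX i; exact: (smooth_function_continuous s). Qed.

Lemma conf_continuous i : {within I01 `*` [set: M], continuous (fun p : R * M => sconf (X i p.1) p.2)}.
Proof. by have [_ _ _ s _] := cX i; exact: (smooth_function_continuous s). Qed.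

Lemma limit_conf_continuous : {within I01 `*` [set: M], continuous (fun p : R * M => h p.1 p.2)}.
Proof. exact: (uniform_limit_continuous Xconf conf_continuous). Qed.

Lemma ham_slice i t : t \in `[0, 1] -> continuous (sham (X i t)).
Proof. by move=> t01; apply: (continuous_slice (phi := fun t => sham (X i t)) _ t01); exact: ham_continuous. Qed.

Lemma ham_bounded i : exists2 C, 0 < C & forall t x, t \in `[0, 1] -> `|sham (X i t) x| <= C.
Proof. exact: (continuous_family_bounded M_compact (k := fun t => sham (X i t)) (@ham_continuous i)). Qed.

Variable Dn : nat -> M.
Hypothesis Dn_dense : forall W, open W -> W !=set0 -> exists k, W (Dn k).
Let ga i t := gap Dn (fun x => H t x - sham (X i t) x).

Let mI : measurable I01. Proof. exact: measurable_itv. Qed.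

Lemma gap_ham_measurable i : measurable_fun I01 (ga i).
Proof.
apply: (gap_measurable (G := fun t x => H t x - sham (X i t) x)) => k.
have [_ mH _] := HL1; apply: measurable_funB; first exact: mH.
apply: (eq_measurable_fun (fun t => sham (X i (clamp t)) (Dn k))) => [t /set_mem t01|].
  by rewrite clamp_id.
apply: (measurable_funS measurableT) => //; apply: continuous_measurable_fun => t.
apply: (@continuous_comp _ _ _ (fun t => (t, Dn k)) (fun p : R * M => sham (X i (clamp p.1)) p.2)).
  move=> P [[P1 P2] [/= n1 n2] PP]; apply: filterS n1 => y P2y.
  by apply: (PP (y, Dn k)); split=> //; exact: nbhs_singleton.
exact: (continuous_clamp (phi := fun t => sham (X i t)) (@ham_continuous i)).
Qed.

Let mga i : measurable_fun I01 (ga i) := @gap_ham_measurable i.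

Let ga0 i t : (0 <= ga i t)%E. Proof. exact: gap_ge0. Qed.

Let ham_continuous_ae : exists N : set R, [/\ measurable N, leb N = 0%E &
  forall t, t \in `[0, 1] -> ~ N t -> continuous (H t)].
Proof.
have [[N [mN N0 hN]] _ _] := HL1; exists N; split=> // t t01 Nt.
by apply: contrapT => nc; apply: Nt; apply: hN => /= /(_ t01).
Qed.

Let ham_sub_continuous i t : t \in `[0, 1] -> continuous (H t) ->
  continuous (fun x => H t x - sham (X i t) x).
Proof. by move=> t01 cH x; exact: (continuousB (cH x) (@ham_slice i t t01 x)). Qed.

(** For almost every [t] the gap is at most the norm of the continuous function H_t - H_i,t, and it
    is measurable in [t], as [le_integral_lower] demands. *)
Lemma gap_integral_small e : 0 < e -> exists N, forall i, (N <= i)%N ->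
  (\int[leb]_(t in I01) ga i t < e%:E)%E.
Proof.
move=> e0; have n0 : nbhs (0%E : \bar R) [set y | (y < e%:E)%E].
  have : nbhs (0 : R) [set r | r < e] by exact: near_lt.
  by apply: filterS => r /=; rewrite lte_fin.
have [N _ hN] := Xham n0; exists N => i Ni; apply: le_lt_trans (hN i Ni).
have [N' [mN N0 cH]] := ham_continuous_ae.
rewrite /norm_1oo; refine (@le_integral_lower _ _ _ leb I01 N' mI mN N0 (ga i) _ (mga i) (fun t _ => ga0 i t) _) => t t01 Nt.
apply: gap_le => x; rewrite lee_fin.
exact: (norm_le_osc_norm M_compact alpha_contact mu_volume x (ham_sub_continuous t01 (cH t t01 Nt))).
Qed.

(** This holds for every [t], even when [H t] is not continuous: the triangle inequality is used at
    the points [Dn k] only and extends by continuity of the two smooth Hamiltonians. *)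
Lemma ham_gap i j t x : t \in `[0, 1] ->
  (`|sham (X i t) x - sham (X j t) x|%:E <= ga i t + ga j t)%E.
Proof.
move=> t01; apply: (le_of_dense Dn_dense (f := fun x => sham (X i t) x - sham (X j t) x)) => [y|k].
  exact: (continuousB (@ham_slice i t t01 y) (@ham_slice j t t01 y)).
apply: le_trans (leeD (gap_ge Dn _ k) (gap_ge Dn _ k)).
rewrite -EFinD lee_fin; set a := H t (Dn k); set b := sham _ _; set c := sham _ _.
have -> : b - c = (a - c) - (a - b) by ring.
by rewrite [leRHS]addrC; exact: ler_normB.
Qed.

(** The norm of [H t] may depend on [t] in a nonmeasurable way, so the triangle inequality cannot be
    integrated as it stands. It is replaced by its measurable minorant [w], the norm of the smooth
    Hamiltonian minus three gaps, truncated at 0. *)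
Lemma norm_1oo_approx k :
  (norm_1oo mu (fun t => sham (X k t)) <= norm_1oo mu H + 3%:E * \int[leb]_(t in I01) ga k t)%E.
Proof.
have [N [mN N0 cH]] := ham_continuous_ae.
pose q t : \bar R := (osc_norm mu (sham (X k (clamp t))))%:E.
have qE : norm_1oo mu (fun t => sham (X k t)) = (\int[leb]_(t in I01) q t)%E.
  by apply: eq_integral => t /set_mem t01; rewrite /q clamp_id.
have mq : measurable_fun I01 q.
  apply/measurable_EFinP; apply: (measurable_funS measurableT) => //.
  by apply: continuous_measurable_fun; exact: (osc_norm_continuous (G := fun t => sham (X k t)) (@ham_continuous k)).
have m3 : measurable_fun I01 (fun t => 3%:E * ga k t)%E.
  by apply: emeasurable_funM; [exact: measurable_cst|exact: mga].
pose w t : \bar R := Order.max (q t - 3%:E * ga k t)%E 0%E.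
have mw : measurable_fun I01 w.
  by apply: measurable_maxe; [exact: emeasurable_funB|exact: measurable_cst].
have w0 t : (0 <= w t)%E by rewrite le_max lexx orbT.
have g30 t : (0 <= 3%:E * ga k t)%E by rewrite mule_ge0// lee_fin.
have mgk := mga k; rewrite qE -ge0_integralZl_EFin//.
apply: (@le_trans _ _ (\int[leb]_(t in I01) w t + \int[leb]_(t in I01) (3%:E * ga k t))%E); last first.
  apply: leeD; last exact: lexx.
  refine (@le_integral_lower _ _ _ leb I01 N mI mN N0 w _ mw (fun t _ => w0 t) _) => t t01 Nt.
  have cHt := cH t t01 Nt; have ck := @ham_slice k t t01.
  have o0 : (0 <= (osc_norm mu (H t))%:E)%E.
    by rewrite lee_fin; exact: (osc_norm_ge0 M_compact alpha_contact mu_volume).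
  rewrite ge_max o0 andbT.
  have hg x : (`|sham (X k t) x - H t x|%:E <= ga k t)%E.
    by rewrite distrC; exact: (le_gap Dn_dense x (ham_sub_continuous t01 cHt)).
  rewrite /q clamp_id//; move: hg; have := ga0 k t; case: (ga k t) => [r| |] // r0 hg.
    rewrite -EFinM -EFinB lee_fin lerBlDr; exact: osc_norm_dist.
  by rewrite gt0_muley ?lte_fin// addeNy leNye.
rewrite -ge0_integralD//; apply: ge0_le_integral_nonmeasurable => t t01.
  by rewrite /q lee_fin; apply: (osc_norm_ge0 M_compact alpha_contact mu_volume); rewrite clamp_id//; exact: ham_slice.
have := ga0 k t; rewrite /w; case: (ga k t) => [r| |] // r0.
  rewrite /q -EFinM -EFinB -EFin_max -EFinD lee_fin -lerBlDr le_max lexx orTb//.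
by rewrite gt0_muley ?lte_fin// addeNy (max_idPr (leNye _)) add0e leey.
Qed.

Lemma norm_1oo_dist k (F : R -> M -> R) (b : R -> R) : (forall t, t \in `[0, 1] -> continuous (F t)) ->
  measurable_fun I01 b -> (forall t, t \in `[0, 1] -> 0 <= b t) ->
  (forall t x, t \in `[0, 1] -> `|F t x - sham (X k t) x| <= b t) ->
  (norm_1oo mu (fun t x => F t x - H t x)%R <=
    3%:E * (\int[leb]_(t in I01) (b t)%:E + \int[leb]_(t in I01) ga k t))%E.
Proof.
move=> cF mb b0 Fb; have [N [mN N0 cH]] := ham_continuous_ae.
have mb' : measurable_fun I01 (EFin \o b) by exact/measurable_EFinP.
have mbg : measurable_fun I01 (fun t => (b t)%:E + ga k t)%E by exact: emeasurable_funD.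
have bg0 t : I01 t -> (0 <= (b t)%:E + ga k t)%E.
  by move=> t01; rewrite adde_ge0// lee_fin; exact: b0.
have mgk := mga k; rewrite -ge0_integralD//.
rewrite -ge0_integralZl_EFin//.
refine (@le_integral_upper _ _ _ leb I01 N mI mN N0 (fun t => 3%:E * ((b t)%:E + ga k t))%E _ _ _ _)
  => [|t t01|t t01 Nt].
- by apply: emeasurable_funM; [exact: measurable_cst|exact: mbg].
- by rewrite mule_ge0 ?lee_fin// bg0.
have cHt := cH t t01 Nt; apply: osc_norm_lee => [x|x].
  exact: (continuousB (cF t t01 x) (cHt x)).
apply: (@le_trans _ _ (`|F t x - sham (X k t) x|%:E + `|H t x - sham (X k t) x|%:E)%E).
  rewrite -EFinD lee_fin; set u := F t x; set v := H t x; set w := sham _ _.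
  have -> : u - v = (u - w) - (v - w) by ring.
  exact: ler_normB.
apply: leeD; first by rewrite lee_fin Fb.
exact: (le_gap Dn_dense x (ham_sub_continuous t01 cHt)).
Qed.

(* The contact isotopy phi_j^s (phi_i^s)^-1 phi_i^1, which joins phi_i^1 to phi_j^1. *)
Definition transition i j := path_comp (path_comp (X j) (path_inv (X i))) (path_reparam (fun _ => 1) (X i)).

Lemma approximation e : 0 < e -> exists N, forall i, (N <= i)%N -> forall t x, t \in `[0, 1] ->
  [/\ D (sfwd (X i t) x) (fwd PhiH t x) < e, D (sbwd (X i t) x) (bwd PhiH t x) < e &
      `|sconf (X i t) x - h t x| < e].
Proof.
move=> e0; have [r r0 hr] := @dbar_sym_dist _ _ _ _ g M_compact M_hausdorff M_connected _ e0.
have := Xdbar; move=> /cvgrPdist_lt /(_ r r0) [N1 _ hN1].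
have [N2 hN2] := (uniform_limitP _ _).1 Xconf e e0.
exists (maxn N1 N2) => i; rewrite geq_max => /andP[i1 i2] t x t01.
have lt : dbar g (path_isotopy (X i)) PhiH < r.
  by have := hN1 i i1; rewrite /= sub0r normrN ger0_norm// dbar_ge0.
by have [h1 h2] := hr _ _ lt t x t01; split=> //; exact: hN2.
Qed.


Lemma expR_near_one C k : 0 <= C -> 0 < k -> exists2 r, 0 < r & forall u : R, `|u| < r ->
  `|1 - expR u| * C <= k /\ expR u <= 2.
Proof.
move=> C0 k0; have d0 : 0 < Num.min 1 (k / (C + 1)) by rewrite lt_min ltr01 divr_gt0// ltr_wpDl.
have := @continuous_expR R 0 => /cvgrPdist_lt/(_ _ d0)/nbhs_ballP[r /= r0 hr].
exists r => // u ur; have := hr u; rewrite /ball/= sub0r normrN expR0 => /(_ ur).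
rewrite lt_min => /andP[u1 u2]; split; last by move: u1; rewrite ltr_norml => /andP[]; lra.
apply: (@le_trans _ _ (k / (C + 1) * (C + 1))); last by rewrite divfK// gt_eqF// ltr_wpDl.
by apply: ler_pM => //; [exact: ltW|rewrite lerDl].
Qed.

(** The arithmetic of [transition_small], separated because the gaps may be infinite. The first 2
    comes from e^u <= 2, the second from two errors of size [k]. *)
Lemma bound_ereal (a b c : \bar R) (x y k : R) : (0 <= a)%E -> (0 <= b)%E -> (0 <= c)%E ->
  (x%:E <= b + c)%E -> (y%:E <= c + a)%E -> 0 <= k ->
  ((x + 2 * y + 2 * k)%:E <= 3%:E * (a + b + c + k%:E))%E.
Proof.
have p3 : (0 < 3%:E :> \bar R)%E by rewrite lte_fin.
case: a => [a| |]//; case: b => [b| |]//; case: c => [c| |]//;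
  rewrite ?addey// ?addye// ?gt0_muley ?leey// => a0 b0 c0.
by move: a0 b0 c0; rewrite -!EFinD -EFinM !lee_fin => a0 b0 c0 h1 h2 k0; lra.
Qed.

Lemma transition_small e : 0 < e -> exists N, forall i j, (N <= i)%N -> (N <= j)%N ->
  [/\ forall t x, t \in `[0, 1] -> D (sfwd (transition i j t) x) (fwd PhiH 1 x) < e,
      forall t x, t \in `[0, 1] -> D (sbwd (transition i j t) x) (bwd PhiH 1 x) < e,
      forall t x, t \in `[0, 1] -> `|sconf (transition i j t) x - h 1 x| < e &
      (norm_1oo mu (fun t => sham (transition i j t)) < e%:E)%E].
Proof.
move=> e0; have one01 : (1 : R) \in `[0, 1] by rewrite in_itv/= lexx ler01.
have k0 : 0 < e / 100 by rewrite divr_gt0.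
set k := e / 100 in k0.
(* [N0] is fixed before [i] and [j], so that the radii [r1] and [r2] below depend on one smooth
   Hamiltonian only. *)
have [N0 hN0] := gap_integral_small k0.
have [C C0 hC] := ham_bounded N0.
have [r1 r10 hr1] := expR_near_one (ltW C0) k0.
have [r2 r20 hr2] := @uniform_control_real _ _ _ _ g M_compact M_hausdorff M_connected (fun t => sham (X N0 t)) (@ham_continuous N0) _ k0.
have e2 : 0 < e / 2 by rewrite divr_gt0.
have [iPhi _ cbPhi] := cPhi.
have [r3 r30 hr3] := @uniform_control_map _ _ _ _ g M_compact M_hausdorff M_connected (bwd PhiH) cbPhi _ e2.
pose r := Num.min (Num.min (e / 4) (r1 / 2)) (Num.min (r2 / 2) (r3 / 2)).
have r0 : 0 < r by rewrite !lt_min !divr_gt0.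
have [ra rb rc rd] : [/\ r <= e / 4, r <= r1 / 2, r <= r2 / 2 & r <= r3 / 2].
  by split; rewrite /r !ge_min lexx ?orbT.
have [N1 hN1] := approximation r0.
exists (maxn N0 N1) => i j; rewrite !geq_max => /andP[i0 i1] /andP[j0 j1].
have hi := hN1 i i1; have hj := hN1 j j1.
have iXi t : t \in `[0, 1] -> cancel (sfwd (X i t)) (sbwd (X i t)) /\ cancel (sbwd (X i t)) (sfwd (X i t)).
  by have [ii _ _ _ _] := cX i; exact: ii.
have iXj t : t \in `[0, 1] -> cancel (sfwd (X j t)) (sbwd (X j t)) /\ cancel (sbwd (X j t)) (sfwd (X j t)).
  by have [ii _ _ _ _] := cX j; exact: ii.
have ji t y : t \in `[0, 1] -> D (sfwd (X j t) y) (sfwd (X i t) y) < 2 * r.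
  move=> t01; have [a1 _ _] := hi t y t01; have [a2 _ _] := hj t y t01.
  apply: le_lt_trans (sym_dist_triangle g M_connected _ (fwd PhiH t y) _) _.
  by rewrite (sym_distC g (fwd PhiH t y)); lra.
have cij t y : t \in `[0, 1] -> `|sconf (X j t) y - sconf (X i t) y| < 2 * r.
  move=> t01; have [_ _ a1] := hi t y t01; have [_ _ a2] := hj t y t01.
  have -> : sconf (X j t) y - sconf (X i t) y = (sconf (X j t) y - h t y) - (sconf (X i t) y - h t y) by ring.
  by apply: le_lt_trans (ler_normB _ _) _; lra.
split=> [t x t01|t x t01|t x t01|].
(* [sfwd (X i t)] takes [y] to [sfwd (X i 1) x]; exchanging [X j] for [X i] at [y] therefore leads
   to the time-one map of [X i]. *)
- rewrite /=; set y := sbwd (X i t) _.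
  have E : sfwd (X i t) y = sfwd (X i 1) x by rewrite /y; have [_ ->] := iXi t t01.
  have [a1 _ _] := hi 1 x one01; have := ji t y t01; rewrite E => a2.
  by apply: le_lt_trans (sym_dist_triangle g M_connected _ (sfwd (X i 1) x) _) _; lra.
- rewrite /=; set y := sbwd (X j t) x.
  have E : sfwd (X j t) y = x by rewrite /y; have [_ ->] := iXj t t01.
  have [_ a1 _] := hi 1 (sfwd (X i t) y) one01; have := ji t y t01; rewrite E sym_distC => a2.
  (* For the inverses the argument itself moves, from [sfwd (X i t) y] to [x]; this is where uniform
     continuity of the inverse limit maps enters. *)
  have a3 : D (bwd PhiH 1 (sfwd (X i t) y)) (bwd PhiH 1 x) < e / 2.
    by apply: hr3 => //; rewrite subrr normr0 add0r; lra.
  by apply: le_lt_trans (sym_dist_triangle g M_connected _ (bwd PhiH 1 (sfwd (X i t) y)) _) _; lra.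
- rewrite /=; set y := sbwd (X i t) _.
  have [_ _ a1] := hi 1 x one01; have a2 := cij t y t01.
  have -> : sconf (X i 1) x + (- sconf (X i t) y + sconf (X j t) y) - h 1 x =
    (sconf (X i 1) x - h 1 x) + (sconf (X j t) y - sconf (X i t) y) by ring.
  by apply: le_lt_trans (ler_normD _ _) _; lra.
(* The Hamiltonian is H_j - e^u (H_i \o sigma) with u close to 0 and sigma close to the identity;
   replacing H_i by the fixed smooth function H_N0 costs two gaps, and H_N0 is almost invariant. *)
pose K t : \bar R := (ga i t + ga j t + ga N0 t + k%:E)%E.
have K0 t : (0 <= K t)%E by rewrite /K !adde_ge0// lee_fin ltW.
have m1 := emeasurable_funD (mga i) (mga j).
have m2 := emeasurable_funD m1 (mga N0).
have m3 : measurable_fun I01 (fun _ : R => k%:E) by exact: measurable_cst.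
have mK : measurable_fun I01 K by exact: (emeasurable_funD m2 m3).
have ct : contact_path alpha (transition i j).
  apply: contact_path_comp; first by apply: contact_path_comp => //; exact: contact_path_inv.
  by apply: contact_path_reparam => //; exact: smooth_cst.
(* One factor 3 stems from [osc_norm_lee], the other from [bound_ereal]. The integral of [K] is
   below 4 [k], so that 100 is ample in the choice of [k]. *)
have main t : t \in `[0, 1] -> ((osc_norm mu (sham (transition i j t)))%:E <= 9%:E * K t)%E.
  move=> t01; have cs : continuous (sham (transition i j t)).
    have [_ _ s _ _] := ct.
    by apply: (continuous_slice (phi := fun t => sham (transition i j t)) _ t01); exact: smooth_function_continuous s.
  have -> : (9%:E * K t = 3%:E * (3%:E * K t))%E by rewrite muleA -EFinM; congr (_%:E * _)%E; ring.
  apply: osc_norm_lee => // p.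
  pose q := sbwd (X j t) p; pose p' := sfwd (X i t) q; pose u := sconf (X j t) q - sconf (X i t) q.
  have E : sfwd (X j t) q = p by rewrite /q; have [_ ->] := iXj t t01.
  have hamE : sham (transition i j t) p = sham (X j t) p - expR u * sham (X i t) p'.
    by rewrite /= derive1_cst mul0r mulr0 addr0 mulrN mulrA -expRD.
  have pp' : D p p' < 2 * r by rewrite -{1}E; exact: ji.
  have [b1 b2] : `|1 - expR u| * C <= k /\ expR u <= 2.
    by apply: hr1; apply: lt_le_trans (cij t q t01) _; lra.
  have b3 : `|sham (X N0 t) p - sham (X N0 t) p'| < k.
    by apply: hr2 => //; rewrite subrr normr0 add0r; lra.
  apply: (le_trans _ (bound_ereal (ga0 i t) (ga0 j t) (ga0 N0 t) (ham_gap j N0 p t01)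
    (ham_gap N0 i p' t01) (ltW k0))).
  rewrite lee_fin hamE.
  have -> : sham (X j t) p - expR u * sham (X i t) p' =
    (sham (X j t) p - sham (X N0 t) p) + expR u * (sham (X N0 t) p' - sham (X i t) p') +
    ((sham (X N0 t) p - sham (X N0 t) p') + (1 - expR u) * sham (X N0 t) p') by ring.
  apply: le_trans (ler_normD _ _) _; apply: lerD.
    apply: le_trans (ler_normD _ _) _; rewrite lerD2l normrM (ger0_norm (expR_ge0 u)).
    by apply: ler_wpM2r.
  apply: le_trans (ler_normD _ _) _; rewrite mulr_natl; apply: lerD; first exact: ltW.
  rewrite normrM; apply: le_trans b1; apply: ler_wpM2l => //; exact: hC.
apply: (@le_lt_trans _ _ (\int[leb]_(t in I01) (9%:E * K t))%E).
  apply: ge0_le_integral_nonmeasurable => t t01; last exact: main.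
  rewrite lee_fin; apply: (osc_norm_ge0 M_compact alpha_contact mu_volume).
  have [_ _ s _ _] := ct.
  by apply: (continuous_slice (phi := fun t => sham (transition i j t)) _ t01); exact: smooth_function_continuous s.
rewrite ge0_integralZl_EFin// /K ge0_integralD//; last 2 first.
- by move=> t _; rewrite !adde_ge0.
- by move=> t _; rewrite lee_fin ltW.
rewrite (@ge0_integralD _ _ _ leb _ mI (fun t => ga i t + ga j t)%E (ga N0)
  (fun t _ => adde_ge0 (ga0 i t) (ga0 j t)) m1 (fun t _ => ga0 N0 t) (mga N0)).
rewrite (@ge0_integralD _ _ _ leb _ mI (ga i) (ga j) (fun t _ => ga0 i t) (mga i) (fun t _ => ga0 j t) (mga j)).
rewrite integral_cst// [X in (k%:E * X)%E](_ : _ = 1%E); last first.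
  by have := lebesgue_measure_itv `[(0:R), 1]; rewrite /= lte_fin ltr01 sube0.
have := hN0 i i0; have := hN0 j j0; have := hN0 N0 (leqnn _).
have p w : (0 <= \int[leb]_(t in I01) ga w t)%E by exact: integral_ge0.
have := p i; have := p j; have := p N0; have kE : k * 100 = e by rewrite /k divfK.
rewrite mule1.
case: (integral _ _ _) => [a| |]//; case: (integral _ _ _) => [b| |]//; case: (integral _ _ _) => [c| |]//.
rewrite -!EFinD -EFinM !lee_fin !lte_fin => p1 p2 p3 p4 p5 p6; rewrite -kE; lra.
Qed.

End Approximation.

(** * Concatenation of infinitely many pieces *)

Section Gluing.
Context {R : realType} {m : nat} {M : ptopologicalType} (A : atlas R m M).
Variable alpha : one_form A.
Variables (G : nat -> R -> slice R M) (K : nat -> slice R M) (tau eta : nat -> R) (L : slice R M).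
Hypotheses (cG : forall j, contact_path alpha (G j)) (eta0 : forall j, 0 < eta j).
Hypothesis G_end : forall j t, tau j - eta j <= t -> G j t = K j.
Hypothesis G_start : forall j t, t <= tau j + eta j -> G j.+1 t = K j.
Hypotheses (tau_incr : forall j, tau j < tau j.+1) (tau_lt1 : forall j, tau j < 1).
Hypothesis tau_cvg : forall t, t < 1 -> exists j, t < tau j.

(** From [tau j] on, [glue_upto j] rests at [K j]: these truncations will be the smooth systems
    approximating the infinite concatenation. *)
Fixpoint glue_upto (j : nat) (t : R) : slice R M :=
  if j is i.+1 then (if t < tau i then glue_upto i t else G i.+1 t) else G 0 t.

Lemma glue_upto_end j : exists2 e, 0 < e & forall t, tau j - e <= t -> glue_upto j t = K j.
Proof.
case: j => [|j]; first by exists (eta 0) => //; exact: G_end.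
exists (Num.min (eta j.+1) (tau j.+1 - tau j)); first by rewrite lt_min eta0 subr_gt0 tau_incr.
move=> t; rewrite lerBlDr -lerBlDl => h /=; move: h; rewrite le_min => /andP[h1 h2].
by rewrite ltNge (_ : tau j <= t)/=; [apply: G_end; lra|lra].
Qed.

Lemma glue_upto_after j t : tau j <= t -> glue_upto j t = K j.
Proof. by have [e e0 h] := glue_upto_end j; move=> tj; apply: h; lra. Qed.

Lemma contact_path_glue j : contact_path alpha (glue_upto j).
Proof.
elim: j => [|j IH]; first exact: cG.
apply: contact_path_local => t t01; case: (ltgtP t (tau j)) => [tj|tj|tj].
- exists (tau j - t), (glue_upto j); split=> //; first by rewrite subr_gt0.
  by move=> s s01; rewrite ltr_norml => /andP[_ h] /=; rewrite ifT//; lra.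
- exists (t - tau j), (G j.+1); split=> //; first by rewrite subr_gt0.
  by move=> s s01; rewrite ltr_norml => /andP[h _] /=; rewrite ltNge (_ : tau j <= s)//; lra.
(* Around [tau j] itself the old and the new piece are both equal to [K j], so the new piece alone
   describes the path there. *)
have [e e0 he] := glue_upto_end j.
exists (Num.min e (eta j)), (G j.+1); split=> //; first by rewrite lt_min e0 eta0.
move=> s s01; rewrite lt_min !ltr_norml => /andP[/andP[h1 h2] /andP[h3 h4]] /=.
case: ifPn => // sj; rewrite he; last lra.
by rewrite G_start//; lra.
Qed.

Lemma tau_le i j : (i <= j)%N -> tau i <= tau j.
Proof. by move=> ij; apply: (homo_leq (r := <=%R)) ij => //; [exact: le_trans|move=> ?; exact: ltW]. Qed.

Lemma glue_upto_eq i j t : (i <= j)%N -> t < tau i -> glue_upto j t = glue_upto i t.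
Proof.
elim: j => [|j IH]; first by rewrite leqn0 => /eqP ->.
rewrite leq_eqVlt => /orP[/eqP -> //|]; rewrite ltnS => ij ti /=.
by rewrite (lt_le_trans ti (tau_le ij)) IH.
Qed.

(** All indices [j] with [t < tau j] give the same slice at [t], by [glue_upto_eq], so the choice
    made by [get] is immaterial. *)
Definition glue (t : R) : slice R M :=
  if t < 1 then glue_upto (get [set j | t < tau j]) t else L.

Lemma glue_eq j t : t < tau j -> glue t = glue_upto j t.
Proof.
move=> tj; rewrite /glue (lt_trans tj (tau_lt1 j)); set i := get _.
have ti : t < tau i by apply: (@getPex _ [set j | t < tau j]); exists j.
by case: (leqP i j) => ij; [rewrite -(glue_upto_eq ij)|rewrite (glue_upto_eq (ltnW ij))].
Qed.

Lemma glue_one t : 1 <= t -> glue t = L.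
Proof. by rewrite /glue leNgt => /negbTE ->. Qed.

Lemma glue_first t : t < tau 0 -> glue t = G 0 t.
Proof. by move=> t0; rewrite (glue_eq t0). Qed.

Lemma glue_piece t : tau 0 <= t -> t < 1 ->
  exists j, [/\ tau j <= t, t < tau j.+1 & glue t = G j.+1 t].
Proof.
move=> t0 t1; have [j tj] := tau_cvg t1.
elim: j tj => [|j IH] tj; first by move: tj; rewrite ltNge t0.
case: (ltP t (tau j)) => [/IH //|h]; exists j; split=> //.
by rewrite (glue_eq tj) /= ltNge h.
Qed.

Lemma glue_smooth_family (f : slice R M -> M -> M) :
  (forall j, smooth_family A [set` `[(0:R), 1]] (fun t => f (glue_upto j t))) ->
  smooth_family A [set` `[(0:R), 1[] (fun t => f (glue t)).
Proof.
move=> h; apply: smooth_family_local => t; rewrite /= in_itv/= => /andP[t0 t1].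
have [j tj] := tau_cvg t1; exists (tau j - t), [set` `[0, 1]], (fun t => f (glue_upto j t)).
split=> //; first by rewrite subr_gt0.
move=> s; rewrite /= !in_itv/= => /andP[s0 s1]; rewrite ltr_norml => /andP[_ sj].
by rewrite s0 (ltW s1); split=> //; rewrite (@glue_eq j)//; lra.
Qed.

Lemma glue_smooth_function (f : slice R M -> M -> R) :
  (forall j, smooth_function A [set` `[(0:R), 1]] (fun t => f (glue_upto j t))) ->
  smooth_function A [set` `[(0:R), 1[] (fun t => f (glue t)).
Proof.
move=> h; apply: smooth_function_local => t; rewrite /= in_itv/= => /andP[t0 t1].
have [j tj] := tau_cvg t1; exists (tau j - t), [set` `[0, 1]], (fun t => f (glue_upto j t)).
split=> //; first by rewrite subr_gt0.
move=> s; rewrite /= !in_itv/= => /andP[s0 s1]; rewrite ltr_norml => /andP[_ sj].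
by rewrite s0 (ltW s1); split=> //; rewrite (@glue_eq j)//; lra.
Qed.

Lemma glue_smooth : smooth_before_one A (path_isotopy glue) (fun t => sham (glue t)) (fun t => sconf (glue t)).
Proof.
split.
- by apply: (glue_smooth_family (f := fun S => sfwd S)) => j; have [_ [h _] _ _ _] := contact_path_glue j.
- by apply: (glue_smooth_family (f := fun S => sbwd S)) => j; have [_ [_ h] _ _ _] := contact_path_glue j.
- by apply: (glue_smooth_function (f := fun S => sham S)) => j; have [_ _ ? _ _] := contact_path_glue j.
- by apply: (glue_smooth_function (f := fun S => sconf S)) => j; have [_ _ _ ? _] := contact_path_glue j.
Qed.

End Gluing.

Lemma end_continuous (R : realType) (M Y : topologicalType) (k : R -> M -> Y) :
  {within [set` `[(0:R), 1[] `*` [set: M], continuous (fun p : R * M => k p.1 p.2)} ->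
  (forall x W, open W -> W (k 1 x) -> nbhs ((1 : R), x) [set q : R * M | q.1 \in `[0, 1] -> W (k q.1 q.2)]) ->
  {within `[0, 1] `*` [set: M], continuous (fun p : R * M => k p.1 p.2)}.
Proof.
move=> /(within_continuousP [set` `[(0:R), 1[]) h h1; apply/(within_continuousP [set` `[(0:R), 1]]) => t x t01 W oW Wx.
have [t1|t1] := ltP t 1; last first.
  have E : t = 1 by apply/eqP; rewrite eq_le t1 andbT; move: t01; rewrite /= in_itv/= => /andP[].
  by move: Wx; rewrite E => Wx; exact: h1.
have n1 : nbhs (t, x) [set q : R * M | [set` `[(0:R), 1[] q.1 -> W (k q.1 q.2)].
  by apply: h => //; move: t01; rewrite /= !in_itv/= t1 => /andP[->].
have n2 : nbhs (t, x) [set q : R * M | q.1 < 1] by exact: (near_fst x (near_lt t1)).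
apply: filterS2 n1 n2 => q /= q1 q2; rewrite in_itv/= => /andP[q0 _]; apply: q1.
by rewrite in_itv/= q0 q2.
Qed.

(** * The concatenation as a continuous contact system *)

Section GlueContinuous.
Context {R : realType} {n : nat} {M : ptopologicalType} (A : atlas R n.*2.+1 M).
Variables (alpha : one_form A) (g : riemannian A) (mu : {measure set (borel M) -> \bar R}).
Hypotheses (M_compact : compact [set: M]) (M_hausdorff : hausdorff_space M).
Hypotheses (M_connected : connected [set: M]) (alpha_contact : contact_form alpha).
Hypothesis mu_volume : volume_measure alpha mu.
Notation D := (sym_dist g).
Notation I01 := [set` `[(0 : R), 1]].

Variables (G : nat -> R -> slice R M) (K : nat -> slice R M) (tau eta : nat -> R) (L : slice R M).
Hypotheses (cG : forall j, contact_path alpha (G j)) (eta0 : forall j, 0 < eta j).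
Hypothesis G_end : forall j t, tau j - eta j <= t -> G j t = K j.
Hypothesis G_start : forall j t, t <= tau j + eta j -> G j.+1 t = K j.
Hypotheses (tau_incr : forall j, tau j < tau j.+1) (tau_lt1 : forall j, tau j < 1).
Hypothesis tau_cvg : forall t, t < 1 -> exists j, t < tau j.

Definition slice_close (b : R) (S : slice R M) := forall x,
  [/\ D (sfwd S x) (sfwd L x) <= b, D (sbwd S x) (sbwd L x) <= b & `|sconf S x - sconf L x| <= b].

Variable b : nat -> R.
Hypothesis b_cvg : b @ \oo --> (0 : R).
Hypotheses (L_cancel : cancel (sfwd L) (sbwd L)) (L_cancel' : cancel (sbwd L) (sfwd L)).
Hypotheses (L_fwd : continuous (sfwd L)) (L_bwd : continuous (sbwd L)) (L_ham : sham L = fun _ => 0).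
Hypotheses (tau0 : 0 < tau 0) (G00 : forall x, sfwd (G 0 0) x = x).
Hypotheses (K_close : forall j, slice_close (b j) (K j)) (K_ham : forall j, sham (K j) = fun _ => 0).
Notation F := (glue G tau L).
Hypothesis F_close : forall j t, tau j <= t -> t < 1 -> slice_close (b j) (F t).
Hypothesis F_ham : forall j t, tau j <= t -> t < 1 -> osc_norm mu (sham (F t)) <= b j.

Let FE j t : t < tau j -> F t = glue_upto G tau j t. Proof. exact: glue_eq. Qed.

Let b0 j : 0 <= b j.
Proof. by have [h _ _] := K_close j point; apply: le_trans h; exact: sym_dist_ge0. Qed.

Let osc0 : osc_norm mu (fun _ => 0) = 0.
Proof.
have c0 : continuous (fun _ : M => 0 : R) by move=> ?; exact: cst_continuous.
apply/eqP; rewrite eq_le (osc_norm_ge0 M_compact alpha_contact mu_volume c0) andbT.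
have := osc_norm_le M_compact alpha_contact mu_volume (C := 0) c0; rewrite mulr0; apply.
by move=> _; rewrite normr0.
Qed.

Let F_close' j t : t \in `[0, 1] -> tau j <= t -> slice_close (b j) (F t).
Proof.
rewrite in_itv/= => /andP[_ t1] jt; have [t1'|t1'] := ltP t 1; first exact: F_close.
by rewrite glue_one// => x; rewrite !sym_dist_xx// subrr normr0 b0.
Qed.

Let F_ham' j t : t \in `[0, 1] -> tau j <= t -> osc_norm mu (sham (F t)) <= b j.
Proof.
rewrite in_itv/= => /andP[_ t1] jt; have [t1'|t1'] := ltP t 1; first exact: F_ham.
by rewrite glue_one// L_ham osc0 b0.
Qed.

Let cP j : contact_path alpha (glue_upto G tau j) := contact_path_glue cG eta0 G_end G_start tau_incr j.

Let sF := glue_smooth L cG eta0 G_end G_start tau_incr tau_lt1 tau_cvg.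

Let b_small e : 0 < e -> exists j, b j < e.
Proof.
by move=> e0; have := b_cvg => /cvgrPdist_lt/(_ e e0)[N _ hN]; exists N; have := hN N (leqnn _);
  rewrite /= sub0r normrN ger0_norm// b0.
Qed.

Let F_bij t : t \in `[0, 1] -> cancel (sfwd (F t)) (sbwd (F t)) /\ cancel (sbwd (F t)) (sfwd (F t)).
Proof.
move=> t01; have [t1|t1] := ltP t 1; last by rewrite glue_one.
by have [j tj] := tau_cvg t1; rewrite (FE tj); have [i _ _ _ _] := cP j; exact: i.
Qed.

Lemma glue_ham_continuous : {within I01 `*` [set: M], continuous (fun p : R * M => sham (F p.1) p.2)}.
Proof.
have [_ _ sH _] := sF; apply: (end_continuous (k := fun t => sham (F t))).
  exact: (smooth_function_continuous sH).
move=> x W oW; rewrite glue_one// L_ham => W0.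
have : nbhs (0 : R) W by exact: open_nbhs_nbhs.
move=> /nbhs_ballP[e /= e0 he]; have [j bj] := b_small e0.
have : nbhs ((1 : R), x) [set q : R * M | tau j < q.1] by exact: (near_fst x (near_gt (tau_lt1 j))).
apply: filterS => -[t y] /= jt t01; apply: he; rewrite /ball/= sub0r normrN.
apply: le_lt_trans bj; apply: le_trans (F_ham' t01 (ltW jt)).
apply: (norm_le_osc_norm M_compact alpha_contact mu_volume).
have [t1|t1] := ltP t 1; last by rewrite glue_one// L_ham => z; exact: cst_continuous.
have [i ti] := tau_cvg t1; rewrite (FE ti); have [_ _ s _ _] := cP i.
exact: (continuous_slice (smooth_function_continuous s) t01).
Qed.

Let map_continuous (f : slice R M -> M -> M) :
  smooth_family A [set` `[(0:R), 1[] (fun t => f (F t)) -> continuous (f L) ->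
  (forall j t x, t \in `[0, 1] -> tau j <= t -> D (f (F t) x) (f L x) <= b j) ->
  {within I01 `*` [set: M], continuous (fun p : R * M => f (F p.1) p.2)}.
Proof.
move=> [sf _] cL close; apply: (end_continuous (k := fun t => f (F t))) => // x W oW.
have c1 : clamp (1 : R) = 1 by rewrite clamp_id// in_itv/= lexx ler01.
(* Clamping turns continuity within [0, 1] x M at time 1 into continuity at the point (1, x), to
   which [dist_limit_continuous] applies. *)
pose k (p : R * M) := f (F (clamp p.1)) p.2.
have ck : {for ((1 : R), x), continuous k}.
  apply: (@dist_limit_continuous _ _ _ _ g M_hausdorff M_connected _ _ k (fun p => f L p.2)).
  - apply: (continuous_comp (f := snd)); [exact: cvg_snd|exact: cL].
  - by rewrite /k /= c1 glue_one.
  move=> e e0; have [j bj] := b_small e0.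
  have : nbhs ((1 : R), x) [set q : R * M | tau j < q.1] by exact: (near_fst x (near_gt (tau_lt1 j))).
  apply: filterS => -[t y] /= jt; apply: le_lt_trans bj; apply: close; first exact: clamp_in.
  by rewrite /clamp le_max le_min (ltW (tau_lt1 j)) (ltW jt) orbT.
move=> W1; have : nbhs ((1 : R), x) (k @^-1` W).
  by apply: ck; apply: open_nbhs_nbhs; split=> //; rewrite /k /= c1.
by apply: filterS => -[t y] /= + t01; rewrite /k /= clamp_id.
Qed.

(** [glue_upto j] coincides with the concatenation before [tau j]. Afterwards it rests at [K j], and
    both are within [b j] of the limit [L], while the Hamiltonians are 0 and at most [b j] in norm;
    all errors are thus bounded by multiples of [b j]. *)
Lemma glue_continuous_system : continuous_contact_system alpha g mu (path_isotopy F)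
  (fun t => sham (F t)) (fun t => sconf (F t)).
Proof.
have [sf sb _ _] := sF; split; last 2 first.
- exact: glue_ham_continuous.
- exists (fun j => path_isotopy (glue_upto G tau j)), (fun j t => sham (glue_upto G tau j t)),
    (fun j t => sconf (glue_upto G tau j t)).
  have tau0j j : 0 < tau j by apply: lt_le_trans tau0 _; exact: tau_le.
  have afterE j t : tau j <= t -> glue_upto G tau j t = K j.
    by move=> jt; exact: (glue_upto_after eta0 G_end tau_incr).
  have two j : 0 <= 2 * b j by rewrite mulr_ge0.
  split.
  + move=> j; have [i1 [i2 i3] i4 i5 [i6 i7]] := cP j; split=> //; split=> // x /=.
    by rewrite (@glue_upto_eq _ _ G tau tau_incr 0 j)//=.
  + apply: (@squeeze_cvgr _ _ _ _ (fun _ => 0) (fun j => 4 * b j)); last 2 first.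
      exact: cvg_cst.
      by rewrite -(mulr0 (4 : R)); apply: cvgM => //; exact: cvg_cst.
    apply: nearW => j; rewrite dbar_ge0//=.
    (* One factor 2 for the maps and their inverses, the other for the triangle inequality through
       [L]. *)
    have -> : 4 * b j = 2 * (2 * b j) by ring.
    apply: dbar_le_pointwise => // t x t01 /=; (have [tj|tj] := ltP t (tau j);
      first by rewrite (FE tj) sym_dist_xx// two);
      rewrite (afterE _ _ tj); have [a1 a2 _] := K_close j x; have [c1 c2 _] := F_close' t01 tj x.
      apply: le_trans (sym_dist_triangle g M_connected _ (sfwd L x) _) _.
      by rewrite (sym_distC g (sfwd L x)); lra.
    apply: le_trans (sym_dist_triangle g M_connected _ (sbwd L x) _) _.
    by rewrite (sym_distC g (sbwd L x)); lra.
  + apply/uniform_limitP => e e0; have e2 : 0 < e / 2 by exact: divr_gt0.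
    have := b_cvg => /cvgrPdist_lt/(_ _ e2)[N _ hN]; exists N => j t x Nj t01.
    have [tj|tj] := ltP t (tau j); first by rewrite (FE tj) subrr normr0.
    rewrite (afterE _ _ tj); have [_ _ a] := K_close j x; have [_ _ c] := F_close' t01 tj x.
    have := hN j Nj; rewrite /= sub0r normrN ger0_norm// => bj.
    have -> : sconf (K j) x - sconf (F t) x = (sconf (K j) x - sconf L x) - (sconf (F t) x - sconf L x) by ring.
    by apply: le_lt_trans (ler_normB _ _) _; lra.
  apply: (@squeeze_cvgr _ _ _ _ (fun _ => 0) b) => //; last exact: cvg_cst.
  apply: nearW => j; set u := fun t x => _.
  have ub t : t \in `[0, 1] -> osc_norm mu (u t) <= b j.
    move=> t01; have [tj|tj] := ltP t (tau j).
      have -> : u t = (fun _ => 0) by apply/funext => x; rewrite /u (FE tj) subrr.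
      by rewrite osc0.
    have -> : u t = sham (F t) by apply/funext => x; rewrite /u (afterE _ _ tj) K_ham subr0.
    exact: F_ham'.
  have z01 : (0 : R) \in `[0, 1] by rewrite in_itv/= lexx ler01.
  apply/andP; split; last first.
    apply: ge_sup; first by exists (osc_norm mu (u 0)), 0.
    by move=> _ [t t01 <-]; exact: ub.
  (* The supremum is nonnegative because its member at time 0 is 0: there the truncation and the
     concatenation agree. *)
  apply: (@le_trans _ _ (osc_norm mu (u 0))).
    have -> : u 0 = (fun _ => 0) by apply/funext => x; rewrite /u (FE (tau0j j)) subrr.
    by rewrite osc0.
  apply: ub_le_sup; last by exists 0.
  by exists (b j) => _ [t t01 <-]; exact: ub.
split.
- by move=> t t01; exact: F_bij.
- apply: (map_continuous (f := fun S => sfwd S) sf L_fwd) => j t x t01 jt.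
  by have [] := F_close' t01 jt x.
- apply: (map_continuous (f := fun S => sbwd S) sb L_bwd) => j t x t01 jt.
  by have [] := F_close' t01 jt x.
Qed.

End GlueContinuous.

(** * The concatenation attached to a topological contact system *)

Section Construction.
Context {R : realType} {n : nat} {M : ptopologicalType} (A : atlas R n.*2.+1 M).
Variables (alpha : one_form A) (g : riemannian A) (mu : {measure set (borel M) -> \bar R}).
Hypotheses (M_compact : compact [set: M]) (M_hausdorff : hausdorff_space M).
Hypotheses (M_connected : connected [set: M]) (alpha_contact : contact_form alpha).
Hypothesis mu_volume : volume_measure alpha mu.
Notation D := (sym_dist g).
Notation I01 := [set` `[(0 : R), 1]].

Variables (PhiH : isotopy R M) (H h : R -> M -> R) (X : nat -> R -> slice R M).
Hypotheses (cPhi : continuous_isotopy PhiH) (HL1 : L1C0 mu H).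
Hypotheses (cX : forall i, contact_path alpha (X i)) (X0 : forall i x, sfwd (X i 0) x = x).
Hypothesis Xdbar : dbar g (path_isotopy (X i)) PhiH @[i --> \oo] --> (0 : R).
Hypothesis Xconf : uniform_limit (fun i t => sconf (X i t)) h.
Hypothesis Xham : norm_1oo mu (fun t x => H t x - sham (X i t) x) @[i --> \oo] --> 0%E.
Variable Dn : nat -> M.
Hypothesis Dn_dense : forall W, open W -> W !=set0 -> exists k, W (Dn k).

Let zero01 : (0 : R) \in `[0, 1]. Proof. by rewrite in_itv/= lexx ler01. Qed.
Let one01 : (1 : R) \in `[0, 1]. Proof. by rewrite in_itv/= lexx ler01. Qed.

Let X_bij i t : t \in `[0, 1] -> cancel (sfwd (X i t)) (sbwd (X i t)) /\ cancel (sbwd (X i t)) (sfwd (X i t)).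
Proof. by have [ii _ _ _ _] := cX i; exact: ii. Qed.

Let X0' i x : sbwd (X i 0) x = x.
Proof. by have [c _] := X_bij i zero01; have := c x; rewrite X0. Qed.

Lemma contact_path_transition i j : contact_path alpha (transition X i j).
Proof.
apply: contact_path_comp; first by apply: contact_path_comp => //; exact: contact_path_inv.
by apply: contact_path_reparam => //; exact: smooth_cst.
Qed.

(** At time 0 both isotopies are the identity with conformal factor 0, so only the fixed factor
    remains. Together with [transition_end] this makes consecutive pieces share their maps and
    conformal factors. *)
Lemma transition_start i j : [/\ sfwd (transition X i j 0) = sfwd (X i 1),
  sbwd (transition X i j 0) = sbwd (X i 1) & sconf (transition X i j 0) = sconf (X i 1)].
Proof.
split; apply/funext => x /=; rewrite ?X0 ?X0' ?X0//.
by rewrite !(conformal_zero alpha_contact (cX _) (X0 _)) oppr0 !addr0.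
Qed.

Lemma transition_end i j : [/\ sfwd (transition X i j 1) = sfwd (X j 1),
  sbwd (transition X i j 1) = sbwd (X j 1) & sconf (transition X i j 1) = sconf (X j 1)].
Proof.
have [c _] := X_bij i one01; split; apply/funext => x /=; rewrite c//.
by rewrite addrA subrr add0r.
Qed.

(** The junction between two pieces: the reparametrizations are constant there, hence the zero
    Hamiltonian. *)
Definition frozen i : slice R M := Slice (sfwd (X i 1)) (sbwd (X i 1)) (fun _ => 0) (sconf (X i 1)).

Let reparam_cst (s : R -> R) (Y : R -> slice R M) (t a : R) i : (\forall u \near t, s u = a) ->
  [/\ sfwd (Y a) = sfwd (X i 1), sbwd (Y a) = sbwd (X i 1) & sconf (Y a) = sconf (X i 1)] ->
  path_reparam s Y t = frozen i.
Proof.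
move=> sa [E1 E2 E3]; rewrite /path_reparam (derive1_near_cst sa) (nbhs_singleton sa) E1 E2 E3 /frozen.
by congr Slice; apply/funext => x; rewrite mul0r.
Qed.

Let half_cvg (c : R) : (fun j => c * 2^-1 ^+ j) @ \oo --> (0 : R).
Proof.
rewrite -(mulr0 c); apply: cvgM; first exact: cvg_cst.
by apply: cvg_expr; rewrite ger0_norm ?invr_ge0// invf_lt1// ltr1n.
Qed.

(** The reparametrization [s0] of the initial piece, its duration [T] and the index [k] are left
    free: the two alternatives differ only in this choice, and everything after time [T] costs an
    amount governed by [e]. *)
Lemma construction e : 0 < e -> exists N, forall k (T : R) (s0 : R -> R) (eta : R), (N <= k)%N ->
  0 < T -> T < 1 -> smooth_on setT s0 -> (forall t, 0 <= s0 t <= 1) -> s0 0 = 0 -> 0 < eta ->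
  (forall t, T - eta <= t -> s0 t = 1) ->
  exists F : R -> slice R M,
  [/\ continuous_contact_system alpha g mu (path_isotopy F) (fun t => sham (F t)) (fun t => sconf (F t)),
      sfwd (F 1) = fwd PhiH 1,
      smooth_before_one A (path_isotopy F) (fun t => sham (F t)) (fun t => sconf (F t)),
      forall t x, t \in `[0, 1] -> [/\ D (sfwd (F t) x) (fwd PhiH (s0 t) x) < e,
        D (sbwd (F t) x) (bwd PhiH (s0 t) x) < e & `|sconf (F t) x - h (s0 t) x| < e] &
      forall t, t \in `[0, 1] -> 
        (t < T -> sham (F t) = (fun x => derive1 s0 t * sham (X k (s0 t)) x)) /\
        (T <= t -> osc_norm mu (sham (F t)) <= 2 * e / (1 - T))].
Proof.
(* A piece whose Hamiltonian has (1,oo)-norm e 4^-j, when run through uniformly in the time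
   (1 - T) 2^-(j+1), gets a Hamiltonian of norm at most 2 e 2^-j / (1 - T). *)
move=> e0; pose ep j : R := e * 2^-1 ^+ j * 2^-1 ^+ j.
have p0 j : 0 < (2^-1 : R) ^+ j by rewrite exprn_gt0// invr_gt0.
have p1 j : (2^-1 : R) ^+ j <= 1 by rewrite exprn_ile1// ?invr_ge0// invf_le1// ler1n.
have ep0 j : 0 < ep j by rewrite !mulr_gt0.
have epe j : ep j <= e by rewrite /ep -mulrA ler_piMr ?(ltW e0)// mulr_ile1// ltW.
have [Na hNa] := approximation M_compact M_hausdorff M_connected Xdbar Xconf e0.
have tr j := transition_small M_compact M_hausdorff M_connected alpha_contact mu_volume
  cPhi HL1 cX Xdbar Xconf Xham Dn_dense (ep0 j).
case: (boolp.choice tr) => Nf hNf {tr}.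
exists (maxn Na (Nf 0%N)) => k T s0 eta; rewrite geq_max => /andP[ka k0] T0 T1 ss0 s001 s00 eta0 s0T.
(* The piece [P j] needs both [idx j] and [idx j.+1] to be at least [Nf j]; adding the thresholds
   one after the other ensures this. *)
pose idx := fix idx j := if j is i.+1 then (idx i + Nf i.+1)%N else k.
have idx1 j : (Nf j <= idx j)%N by case: j => [|j] //=; rewrite leq_addl.
have idx2 j : (Nf j <= idx j.+1)%N by rewrite /= (leq_trans (idx1 j))// leq_addr.
pose tau j : R := 1 - (1 - T) * 2^-1 ^+ j.
have T1' : 0 < 1 - T by rewrite subr_gt0.
have tau_diff j : tau j.+1 - tau j = (1 - T) * 2^-1 ^+ j / 2 by rewrite /tau exprS; field.
have tau_incr j : tau j < tau j.+1 by rewrite -subr_gt0 tau_diff !mulr_gt0.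
have tau_lt1 j : tau j < 1 by rewrite ltrBlDr ltrDl mulr_gt0.
have tau0 : tau 0%N = T by rewrite /tau expr0 mulr1; ring.
have tau_cvg t : t < 1 -> exists j, t < tau j.
  rewrite -subr_gt0 => t1; have := half_cvg (1 - T) => /cvgrPdist_lt/(_ _ t1)[N _ hN]; exists N.
  by have := hN N (leqnn _); rewrite /= sub0r normrN ger0_norm ?mulr_ge0// ?ltW// /tau; lra.
pose P j := transition X (idx j) (idx j.+1).
have cP j : contact_path alpha (P j) by exact: contact_path_transition.
have cPh j : {within I01 `*` [set: M], continuous (fun p : R * M => sham (P j p.1) p.2)}.
  by have [_ _ s _ _] := cP j; exact: (smooth_function_continuous s).
have cPs j t : t \in `[0, 1] -> continuous (sham (P j t)).
  by move=> t01; exact: (continuous_slice (phi := fun t => sham (P j t)) (@cPh j) t01).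
have rp j : exists es : R * (R -> R), [/\ 0 < es.1, smooth_on setT es.2,
    forall t, t <= tau j + es.1 -> es.2 t = 0, forall t, tau j.+1 - es.1 <= t -> es.2 t = 1 &
    forall t, [/\ 0 <= es.2 t <= 1, 0 <= derive1 es.2 t &
      derive1 es.2 t * osc_norm mu (sham (P j (clamp (es.2 t)))) <= ep j / (tau j.+1 - tau j)]].
  have q0 t : 0 <= osc_norm mu (sham (P j (clamp t))).
    by apply: (osc_norm_ge0 M_compact alpha_contact mu_volume); apply: cPs; exact: clamp_in.
  have cq := osc_norm_continuous g M_compact M_hausdorff M_connected alpha_contact mu_volume
      (G := fun t => sham (P j t)) (@cPh j).
  have [_ _ _ hj] := hNf j _ _ (idx1 j) (idx2 j).
  have iq : (\int[lebesgue_measure]_(t in `[0%R, 1%R]) (osc_norm mu (sham (P j (clamp t))))%:E < (ep j)%:E)%E.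
    apply: le_lt_trans hj; apply: ge0_le_integral_nonmeasurable => t t01; first by rewrite lee_fin.
    by rewrite clamp_id.
  have [e1 [s hs]] := reparametrization cq q0 iq (tau_incr j).
  by exists (e1, s).
case: (boolp.choice rp) => es hes {rp}.
pose G j : R -> slice R M := if j is i.+1 then path_reparam (es i).2 (P i) else path_reparam s0 (X k).
pose K j := frozen (idx j).
pose endw j := if j is i.+1 then (es i).1 else eta.
(* Halving the margins puts each time considered in the interior of the region where the
   reparametrization is constant, so that its derivative vanishes there. *)
pose w j := Num.min (endw j) (es j).1 / 2.
have es0 j : 0 < (es j).1 by have [] := hes j.
have endw0 j : 0 < endw j by case: j => [|j] //=; exact: es0.
have w0 j : 0 < w j by rewrite divr_gt0// lt_min endw0 es0.
have w1 j : w j < endw j.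
  by rewrite /w ltr_pdivrMr// gt_min; apply/orP; left; have := endw0 j; lra.
have w2 j : w j < (es j).1.
  by rewrite /w ltr_pdivrMr// gt_min; apply/orP; right; have := es0 j; lra.
have cG j : contact_path alpha (G j).
  case: j => [|j]; apply: contact_path_reparam => //; first by move=> t _; rewrite in_itv/= s001.
    by have [_ ? _ _ _] := hes j.
  by move=> t _; have [_ _ _ _ hh] := hes j; have [h01 _ _] := hh t; rewrite in_itv.
have G_end j t : tau j - w j <= t -> G j t = K j.
  move=> jt; have jt' : tau j - endw j < t by have := w1 j; lra.
  case: j jt' {jt} => [|j] jt'.
    apply: (reparam_cst (a := 1)) => //; apply: filterS (near_gt jt') => u /= ju.
    by apply: s0T; rewrite -tau0 ltW.
  apply: (reparam_cst (a := 1)); last exact: transition_end.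
  by apply: filterS (near_gt jt') => u /= ju; have [_ _ _ hh _] := hes j; apply: hh; exact: ltW.
have G_start j t : t <= tau j + w j -> G j.+1 t = K j.
  move=> jt; have jt' : t < tau j + (es j).1 by have := w2 j; lra.
  apply: (reparam_cst (a := 0)); last exact: transition_start.
  by apply: filterS (near_lt jt') => u /= ju; have [_ _ hh _ _] := hes j; apply: hh; exact: ltW.
pose L : slice R M := Slice (fwd PhiH 1) (bwd PhiH 1) (fun _ => 0) (h 1).
pose b j : R := 2 * e / (1 - T) * 2^-1 ^+ j.
have epb j : ep j <= b j.
  rewrite /ep /b; apply: (@le_trans _ _ (e * 2^-1 ^+ j)).
    by rewrite ler_piMr// mulr_ge0// ltW.
  apply: ler_wpM2r; first exact: ltW.
  by rewrite ler_pdivlMr//; nra.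
have b_decr i j : (i <= j)%N -> b j <= b i.
  move=> ij; apply: ler_wpM2l; first by rewrite divr_ge0// ?mulr_ge0// ltW.
  by apply: ler_wiXn2l => //; rewrite ?invr_ge0// invf_le1// ler1n.
have piece j t x : [/\ D (sfwd (G j.+1 t) x) (fwd PhiH 1 x) < ep j,
    D (sbwd (G j.+1 t) x) (bwd PhiH 1 x) < ep j & `|sconf (G j.+1 t) x - h 1 x| < ep j].
  have [h1 h2 h3 _] := hNf j _ _ (idx1 j) (idx2 j).
  have [_ _ _ _ hh] := hes j; have [h01 _ _] := hh t.
  by split; [apply: h1|apply: h2|apply: h3]; rewrite in_itv.
have piece_ham j t : osc_norm mu (sham (G j.+1 t)) <= b j.
  have [_ _ _ _ hh] := hes j; have [h01 d0 hd] := hh t.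
  have h01' : (es j).2 t \in `[0, 1] by rewrite in_itv.
  apply: le_trans (osc_normZ M_compact alpha_contact mu_volume d0 (@cPs j _ h01')) _.
  move: hd; rewrite clamp_id// => hd; apply: le_trans hd _.
  rewrite tau_diff /ep /b le_eqVlt; apply/orP; left; apply/eqP.
  by field; rewrite gt_eqF// gt_eqF.
(* The junction is the end of the trivial transition from [idx j] to itself, so the estimates for
   transitions cover it. *)
have frozen_close j x : [/\ D (sfwd (K j) x) (fwd PhiH 1 x) < ep j,
    D (sbwd (K j) x) (bwd PhiH 1 x) < ep j & `|sconf (K j) x - h 1 x| < ep j].
  have [h1 h2 h3 _] := hNf j _ _ (idx1 j) (idx1 j).
  have [<- <- <-] := transition_end (idx j) (idx j).
  by split; [exact: h1|exact: h2|exact: h3].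
have gpiece j t : tau j <= t -> t < 1 -> exists2 i, (j <= i)%N & glue G tau L t = G i.+1 t.
  move=> jt t1; have t0 : tau 0%N <= t by apply: le_trans jt; exact: tau_le.
  have [i [_ ti ->]] := glue_piece G L tau_incr tau_lt1 tau_cvg t0 t1; exists i => //.
  rewrite leqNgt; apply/negP => ij; have := le_lt_trans jt ti.
  by rewrite ltNge tau_le.
have [iPhi cf cb] := cPhi; have [L1 L2] := iPhi 1 one01.
have cLf : continuous (sfwd L) by exact: (continuous_slice cf one01).
have cLb : continuous (sbwd L) by exact: (continuous_slice cb one01).
have tau00 : 0 < tau 0%N by rewrite tau0.
have G00 x : sfwd (G 0%N 0) x = x by rewrite /= s00 X0.
have Kc j : slice_close g L (b j) (K j).
  move=> x; have [a1 a2 a3] := frozen_close j x; have hb := epb j.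
  by split; apply: le_trans hb; exact: ltW.
have Fc j t : tau j <= t -> t < 1 -> slice_close g L (b j) (glue G tau L t).
  move=> jt t1 x; have [i ij ->] := gpiece j t jt t1; have [a1 a2 a3] := piece i t x.
  have hb := le_trans (epb i) (b_decr j i ij).
  by split; apply: le_trans hb; exact: ltW.
have Fh j t : tau j <= t -> t < 1 -> osc_norm mu (sham (glue G tau L t)) <= b j.
  move=> jt t1; have [i ij ->] := gpiece j t jt t1.
  exact: le_trans (piece_ham i t) (b_decr j i ij).
have b_cvg : b @ \oo --> (0 : R) by exact: half_cvg.
have sys := glue_continuous_system (L := L) M_compact M_hausdorff M_connected alpha_contact mu_volume
  cG w0 G_end G_start tau_incr tau_lt1 tau_cvg b_cvg L1 L2 cLf cLb erefl tau00 G00 Kc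
  (fun j => erefl) Fc Fh.
exists (glue G tau L); split=> //.
- by rewrite glue_one.
- exact: (glue_smooth L cG w0 G_end G_start tau_incr tau_lt1 tau_cvg).
- move=> t x; rewrite in_itv/= => /andP[t0 t1].
  have [tT|tT] := ltP t T.
    rewrite glue_first ?tau0//=; apply: hNa => //; by rewrite in_itv/= s001.
  rewrite s0T; last lra.
  have [t1'|t1'] := ltP t 1; last by rewrite glue_one//= !sym_dist_xx// subrr normr0.
  have [||i _ ->] := gpiece 0%N t; rewrite ?tau0//.
  have [a1 a2 a3] := piece i t x; have ei := epe i.
  by split; apply: lt_le_trans ei.
- move=> t; rewrite in_itv/= => /andP[t0 t1]; split=> [tT|tT].
    by rewrite glue_first ?tau0.
  have [t1'|t1'] := ltP t 1; last first.
    rewrite glue_one//=; have c0 : continuous (fun _ : M => 0 : R) by move=> ?; exact: cst_continuous.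
    apply: (@le_trans _ _ (3 * 0)); last by rewrite mulr0 divr_ge0// ?mulr_ge0// ltW.
    apply: (osc_norm_le M_compact alpha_contact mu_volume c0) => y; by rewrite normr0.
  have := Fh 0%N t; rewrite tau0 /b expr0 mulr1; exact.
Qed.

End Construction.

(** * The two alternatives *)

Section Alternatives.
Context {R : realType} {n : nat} {M : ptopologicalType} (A : atlas R n.*2.+1 M).
Variables (alpha : one_form A) (g : riemannian A) (mu : {measure set (borel M) -> \bar R}).
Hypotheses (M_compact : compact [set: M]) (M_hausdorff : hausdorff_space M).
Hypotheses (M_connected : connected [set: M]) (alpha_contact : contact_form alpha).
Hypothesis mu_volume : volume_measure alpha mu.
Notation D := (sym_dist g).
Notation I01 := [set` `[(0 : R), 1]].
Notation leb := (@lebesgue_measure R).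

Lemma smooth_FTC (f : R -> R) : smooth_on setT f ->
  (\int[leb]_(t in `[0%R, 1%R]) (derive1 f t)%:E = (f 1 - f 0)%:E)%E.
Proof.
move=> sf; have cf := smooth_cts sf.
rewrite (@continuous_FTC2 _ _ f) ?EFinB//; first exact: continuous_subspaceT (smooth_cts (smooth_derive1 sf)).
split.
- by move=> t _; apply: diff_derivable; exact: (smooth_differentiable sf).
- by apply: cvg_at_right_filter; exact: cf.
- by apply: cvg_at_left_filter; exact: cf.
Qed.

Lemma is_derive_affine (a b : R) (f : R -> R) (x df : R) : is_derive x 1 f df ->
  is_derive x 1 (fun t : R => a * t + b * f t) (a + b * df).
Proof.
move=> h1.
have H := is_deriveD (is_deriveM (is_derive_cst a x (1 : R)) (is_derive_id x (1 : R)))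
  (is_deriveM (is_derive_cst b x (1 : R)) h1).
by apply: (is_derive_eq H); rewrite /GRing.scale/=; ring.
Qed.

(** Both [s t] and (1 + k) t - [s t] are nondecreasing; comparing them with their values at 0 and 1
    confines [s t] to within [k] of [t]. *)
Lemma flat_step_near_id (k : R) (s : R -> R) : 0 <= k -> smooth_on setT s -> s 0 = 0 -> s 1 = 1 ->
  (forall t, 0 <= derive1 s t <= 1 + k) -> forall t, t \in `[0, 1] -> 0 <= s t <= 1 /\ `|s t - t| <= k.
Proof.
move=> k0 ss s00 s11 ds t; rewrite in_itv/= => /andP[t0 t1].
have ds0 x : 0 <= derive1 s x by have /andP[] := ds x.
have mono := nondecreasing_of_derive (fun x => smooth_is_derive x ss) ds0.
have dl (x : R) : is_derive x 1 (fun y : R => (1 + k) * y + -1 * s y) ((1 + k) + -1 * derive1 s x).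
  exact: (is_derive_affine _ _ (smooth_is_derive x ss)).
have dl0 x : 0 <= (1 + k) + -1 * derive1 s x by have /andP[_ ?] := ds x; lra.
have mono2 := nondecreasing_of_derive dl dl0.
have := mono _ _ t0; have := mono _ _ t1; have := mono2 _ _ t0; have := mono2 _ _ t1.
rewrite s00 s11 => h1 h2 h3 h4; have kt : k * t <= k by rewrite ler_piMr.
by split; [rewrite h3 h4|rewrite ler_norml; apply/andP; split; nra].
Qed.

Variables (PhiH : isotopy R M) (H h : R -> M -> R) (X : nat -> R -> slice R M).
Hypotheses (cPhi : continuous_isotopy PhiH) (HL1 : L1C0 mu H).
Hypotheses (cX : forall i, contact_path alpha (X i)) (X0 : forall i x, sfwd (X i 0) x = x).
Hypothesis Xdbar : dbar g (path_isotopy (X i)) PhiH @[i --> \oo] --> (0 : R).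
Hypothesis Xconf : uniform_limit (fun i t => sconf (X i t)) h.
Hypothesis Xham : norm_1oo mu (fun t x => H t x - sham (X i t) x) @[i --> \oo] --> 0%E.

Lemma alternative_near e : 0 < e -> exists F : R -> slice R M,
  [/\ continuous_contact_system alpha g mu (path_isotopy F) (fun t => sham (F t)) (fun t => sconf (F t)),
      sfwd (F 1) = fwd PhiH 1,
      smooth_before_one A (path_isotopy F) (fun t => sham (F t)) (fun t => sconf (F t))
    & [/\ dbar g (path_isotopy F) PhiH < e, sup_norm (fun t x => sconf (F t) x - h t x) < e
        & (norm_1oo mu (fun t x => sham (F t) x - H t x)%R < e%:E)%E]].
Proof.
move=> e0; have [Dn Dn_dense] := dense_sequence A M_compact.
have zero01 : (0 : R) \in `[0, 1] by rewrite in_itv/= lexx ler01.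
pose c := e / 100; have c0 : 0 < c by rewrite divr_gt0.
have [N1 hN1] := construction M_compact M_hausdorff M_connected alpha_contact mu_volume
  cPhi HL1 cX X0 Xdbar Xconf Xham Dn_dense c0.
have [N2 hN2] := gap_integral_small M_compact alpha_contact mu_volume HL1 cX Xham Dn c0.
set k := maxn N1 N2; have k1 : (N1 <= k)%N := leq_maxl _ _; have k2 : (N2 <= k)%N := leq_maxr _ _.
have [C C0 hC] := ham_bounded M_compact cX k.
have [_ cf cb] := cPhi.
have [r1 r10 hr1] := uniform_control_map g M_compact M_hausdorff M_connected cf c0.
have [r2 r20 hr2] := uniform_control_map g M_compact M_hausdorff M_connected cb c0.
have [r3 r30 hr3] := uniform_control_real g M_compact M_hausdorff M_connected
  (limit_conf_continuous cX Xconf) c0.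
have [r4 r40 hr4] := uniform_control_real g M_compact M_hausdorff M_connected
  (k := fun t => sham (X k t)) (@ham_continuous _ _ _ _ _ _ cX k) c0.
(* The radii make the time shift |s t - t| <= q harmless for the four limit functions; the bound c /
   C makes the excess slope [q] harmless when multiplied by the bound [C] of the Hamiltonian. *)
pose q := Num.min (Num.min (r1 / 2) (r2 / 2)) (Num.min (Num.min (r3 / 2) (r4 / 2)) (c / C)).
have q0 : 0 < q by rewrite !lt_min !divr_gt0.
have [qa qb qc qd qe] : [/\ q <= r1 / 2, q <= r2 / 2, q <= r3 / 2, q <= r4 / 2 & q <= c / C].
  by split; rewrite /q !ge_min lexx ?orbT.
have qC : q * C <= c by rewrite -ler_pdivlMr.
have [e1 [s [/andP[e10 e12] ss s0 s1 ds]]] := flat_step q0.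
have s00 : s 0 = 0 by apply: s0; exact: ltW.
have s11 : s 1 = 1 by apply: s1; lra.
have sid := flat_step_near_id (ltW q0) ss s00 s11 ds.
have sall t : 0 <= s t <= 1.
  have [t0|t0] := leP t 0; first by rewrite s0 ?lexx ?ler01//; lra.
  have [t1|t1] := leP 1 t; first by rewrite s1 ?lexx ?ler01//; lra.
  by have [] := sid t; rewrite // in_itv/= !ltW.
have s01 t : s t \in `[0, 1] by rewrite in_itv/= sall.
pose T := 1 - e1 / 2.
have [||||F [sys F1 sm close ham]] := hN1 k T s (e1 / 2) k1 _ _ ss sall s00 _ _.
- by rewrite /T; lra.
- by rewrite /T; lra.
- by rewrite divr_gt0.
- by move=> t; rewrite /T => tT; apply: s1; lra.
have cl t x : t \in `[0, 1] -> [/\ D (sfwd (F t) x) (fwd PhiH t x) <= 2 * c,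
    D (sbwd (F t) x) (bwd PhiH t x) <= 2 * c & `|sconf (F t) x - h t x| <= 2 * c].
  move=> t01; have [a1 a2 a3] := close t x t01; have [_ st] := sid t t01.
  have z r : q <= r / 2 -> 0 < r -> `|s t - t| + D x x < r by rewrite sym_dist_xx// => qr r0; lra.
  have b1 := hr1 _ _ _ _ (s01 t) t01 (z _ qa r10); have b2 := hr2 _ _ _ _ (s01 t) t01 (z _ qb r20).
  have b3 := hr3 _ _ _ _ (s01 t) t01 (z _ qc r30).
  split.
  - by apply: le_trans (sym_dist_triangle g M_connected _ (fwd PhiH (s t) x) _) _; lra.
  - by apply: le_trans (sym_dist_triangle g M_connected _ (bwd PhiH (s t) x) _) _; lra.
  have -> : sconf (F t) x - h t x = (sconf (F t) x - h (s t) x) + (h (s t) x - h t x) by ring.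
  by apply: le_trans (ler_normD _ _) _; lra.
exists F; split=> //; split.
- apply: (@le_lt_trans _ _ (2 * (2 * c))); last by rewrite /c; lra.
  by apply: dbar_le_pointwise => // t x t01; have [] := cl t x t01.
- apply: (@le_lt_trans _ _ (2 * c)); last by rewrite /c; lra.
  apply: ge_sup; first by eexists; exists (0, point); [split=> //|reflexivity].
  by move=> _ [[t x] [/= t01 _] <-]; have [] := cl t x t01.
(* However short the tail is, it lasts for the time 1 - T and so contributes at most 2 [c] to the
   integral. *)
pose tail := 2 * c / (1 - T); have T1 : 0 < 1 - T by rewrite /T; lra.
have tail0 : 0 <= tail by rewrite divr_ge0// ?mulr_ge0// ltW.
(* The slope of [s] is 0 near the ends, so |s' - 1| is small only in the mean. Since 0 <= s' <= 1 +
   q, it is at most 1 + 2q - s', whose integral is 2q; [y] is a primitive of [C] times this bound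
   plus [c], with total increase 2 q C + c <= 3 c. *)
pose y (t : R) := ((1 + 2 * q) * C + c) * t + - C * s t.
have sy : smooth_on setT y.
  apply: smoothD; first exact: openT.
    by apply: smoothM; [exact: openT|exact: smooth_cst|exact: smooth_id].
  by apply: smoothM; [exact: openT|exact: smooth_cst|exact: ss].
have dy t : derive1 y t = (1 + 2 * q - derive1 s t) * C + c.
  have h1 := is_derive_affine ((1 + 2 * q) * C + c) (- C) (smooth_is_derive t ss).
  by rewrite derive1E (@derive_val _ _ _ _ _ _ _ h1); ring.
have dy0 t : 0 <= derive1 y t.
  by rewrite dy; have /andP[d0 d1] := ds t; apply: addr_ge0; [apply: mulr_ge0; [lra|exact: ltW]|exact: ltW].
pose b t := derive1 y t + tail * \1_[set` `[T, 1]] t.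
have my : measurable_fun I01 (derive1 y).
  apply: (measurable_funS measurableT) => //; apply: continuous_measurable_fun.
  exact: (smooth_cts (smooth_derive1 sy)).
have mtail : measurable_fun I01 (fun t => tail * \1_[set` `[T, 1]] t : R).
  apply: measurable_funM; first exact: measurable_cst.
  by apply: (measurable_funS measurableT) => //; apply: measurable_indic; exact: measurable_itv.
have mb : measurable_fun I01 b by exact: measurable_funD.
have cFh t : t \in `[0, 1] -> continuous (sham (F t)).
  by move=> t01; have [_ cs _] := sys; exact: (continuous_slice (phi := fun t => sham (F t)) cs t01).
have tl0 t : 0 <= tail * \1_[set` `[T, 1]] t by rewrite mulr_ge0// indicE ler0n.
have b0 t : t \in `[0, 1] -> 0 <= b t by move=> _; rewrite addr_ge0.
have Fb t x : t \in `[0, 1] -> `|sham (F t) x - sham (X k t) x| <= b t.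
  move=> t01; have [h1 h2] := ham t t01; have /andP[d0 d1] := ds t.
  have [tT|tT] := ltP t T.
    apply: (@le_trans _ _ (derive1 y t)); last by rewrite /b lerDl.
    rewrite (h1 tT) dy.
    have -> : derive1 s t * sham (X k (s t)) x - sham (X k t) x = (derive1 s t - 1) * sham (X k (s t)) x
       + (sham (X k (s t)) x - sham (X k t) x) by ring.
    apply: le_trans (ler_normD _ _) _; apply: lerD.
      rewrite normrM; apply: ler_pM => //; last exact: hC.
      by rewrite ler_norml; apply/andP; split; lra.
    apply: ltW; apply: hr4 => //; have [_ st] := sid t t01; rewrite sym_dist_xx//; lra.
  have tin : t \in [set` `[T, 1]].
    by rewrite inE /= in_itv/= tT; move: t01; rewrite in_itv/= => /andP[].
  rewrite /b indicE tin mulr1 [leRHS]addrC; apply: le_trans (ler_normB _ _) _; apply: lerD.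
    by apply: le_trans (h2 tT); exact: (norm_le_osc_norm M_compact alpha_contact mu_volume x (cFh t t01)).
  (* In the tail [s] is constant, so [derive1 y] equals (1 + 2q) C + c, which by itself dominates
     the smooth Hamiltonian of index [k]. *)
  rewrite dy (@derive1_near_cst _ s t 1); last first.
    by apply: filterS (near_gt (_ : 1 - e1 < t)) => [u /= /ltW|]; [exact: s1|move: tT; rewrite /T; lra].
  by have := hC t x t01; have := ltW q0; nra.
apply: le_lt_trans (norm_1oo_dist M_compact alpha_contact mu_volume HL1 cX Dn_dense cFh mb b0 Fb) _.
have Eb : (\int[leb]_(t in I01) (b t)%:E <= (5 * c)%:E)%E.
  rewrite (_ : (fun t => (b t)%:E) = (fun t => (derive1 y t)%:E + (tail * \1_[set` `[T, 1]] t)%:E)%E); last first.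
    by apply/funext => t; rewrite -EFinD.
  rewrite ge0_integralD//=; last 4 first.
  - by move=> t _; rewrite lee_fin.
  - exact/measurable_EFinP.
  - by move=> t _; rewrite lee_fin.
  - exact/measurable_EFinP.
  rewrite smooth_FTC//.
  have -> : (5 * c = 3 * c + 2 * c)%R by ring.
  rewrite [leRHS]EFinD; apply: leeD.
    by rewrite lee_fin /y s00 s11; lra.
  have mT : measurable [set` `[T, 1]] by exact: measurable_itv.
  under eq_integral do rewrite EFinM.
  rewrite ge0_integralZl_EFin//=.
  rewrite integral_indic//.
  have lT : (leb ([set` `[T, 1%R]] `&` I01) <= (1 - T)%:E)%E.
    have -> : ((1 - T)%:E = leb [set` `[T, 1%R]])%E.
      by rewrite lebesgue_measure_itv/= lte_fin ifT ?EFinB//; lra.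
    by apply: le_measure; rewrite ?inE//; exact: measurableI.
  rewrite (_ : (2 * c)%:E = tail%:E * (1 - T)%:E)%E; last first.
    by rewrite -EFinM /tail divfK// gt_eqF.
  - by apply: lee_wpmul2l.
  - by apply/measurable_EFinP; apply: (measurable_funS measurableT) => //; exact: measurable_indic.
have gk := hN2 k k2.
apply: (@le_lt_trans _ _ (3%:E * ((5 * c)%:E + c%:E))%E).
  by apply: lee_wpmul2l => //; apply: leeD => //; exact: ltW.
by rewrite -EFinD -EFinM lte_fin /c; lra.
Qed.

(** On [0, T] the time is distributed in proportion to the norm of the Hamiltonian, which brings the
    maximum down to the (1,oo)-norm divided by [T], up to a small error; the tail is made smaller
    still. Distances and conformal factors are only evaluated at other times, which does not
    increase their maxima. *)
Lemma alternative_small e : 0 < e -> exists F : R -> slice R M,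
  [/\ continuous_contact_system alpha g mu (path_isotopy F) (fun t => sham (F t)) (fun t => sconf (F t)),
      sfwd (F 1) = fwd PhiH 1,
      smooth_before_one A (path_isotopy F) (fun t => sham (F t)) (fun t => sconf (F t))
    & [/\ dbar g (path_isotopy F) (id_isotopy R M) < dbar g PhiH (id_isotopy R M) + e,
          sup_norm (fun t => sconf (F t)) < sup_norm h + e
        & ((norm_oo mu (fun t => sham (F t)))%:E < norm_1oo mu H + e%:E)%E]].
Proof.
move=> e0; have [Dn Dn_dense] := dense_sequence A M_compact.
have zero01 : (0 : R) \in `[0, 1] by rewrite in_itv/= lexx ler01.
have e24 : 0 < e / 24 by rewrite divr_gt0.
have [N2 hN2] := gap_integral_small M_compact alpha_contact mu_volume HL1 cX Xham Dn e24.
have Hk i : (N2 <= i)%N -> (norm_1oo mu (fun t => sham (X i t)) <= norm_1oo mu H + (e / 8)%:E)%E.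
  move=> i2; apply: le_trans (norm_1oo_approx g M_compact M_hausdorff M_connected alpha_contact mu_volume
    HL1 cX Dn_dense i) _.
  apply: leeD => //; apply: (@le_trans _ _ (3%:E * (e / 24)%:E)%E).
    by apply: lee_wpmul2l => //; apply: ltW; exact: hN2.
  by rewrite -EFinM lee_fin; lra.
have Hk0 i : (0 <= norm_1oo mu (fun t => sham (X i t)))%E.
  apply: integral_ge0 => t t01; rewrite lee_fin; apply: (osc_norm_ge0 M_compact alpha_contact mu_volume).
  exact: (ham_slice cX t01).
have [v vE] : exists v, norm_1oo mu H = v%:E.
  have [_ _] := HL1; have := le_trans (Hk0 _) (Hk N2 (leqnn _)).
  by case: (norm_1oo mu H) => [v| |]//; exists v.
(* This lower bound, read off from the nonnegative norm of a smooth approximation, makes [c1]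
   positive and the bound e / 4 of the tail at most v + e / 2. *)
have v0 : - (e / 8) <= v.
  by have := le_trans (Hk0 _) (Hk N2 (leqnn _)); rewrite vE -EFinD lee_fin; lra.
pose c1 := v + e / 4; have c10 : 0 < c1 by rewrite /c1; lra.
(* This value solves c1 / T = c1 + e / 4, so that squeezing the first piece into [0, T] yields the
   bound v + e / 2. *)
pose T := c1 / (c1 + e / 4); have c1e : 0 < c1 + e / 4 by lra.
have T0 : 0 < T by rewrite divr_gt0.
have T1 : T < 1 by rewrite ltr_pdivrMr//; lra.
have cT : c1 / T = c1 + e / 4 by rewrite /T invf_div mulrC divfK// gt_eqF.
(* The second term forces the norm 2 c / (1 - T) in the tail below e / 4; this is possible because
   [T] was fixed first. *)
pose c := Num.min (e / 8) (e * (1 - T) / 8).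
have T1' : 0 < 1 - T by rewrite subr_gt0.
have c0 : 0 < c by rewrite lt_min !divr_gt0// mulr_gt0.
have [ca cb'] : c <= e / 8 /\ c <= e * (1 - T) / 8 by split; rewrite /c ge_min lexx ?orbT.
have tail : 2 * c / (1 - T) <= e / 4 by rewrite ler_pdivrMr//; lra.
have [N1 hN1] := construction M_compact M_hausdorff M_connected alpha_contact mu_volume
  cPhi HL1 cX X0 Xdbar Xconf Xham Dn_dense c0.
set k := maxn N1 N2; have k1 : (N1 <= k)%N := leq_maxl _ _; have k2 : (N2 <= k)%N := leq_maxr _ _.
have q0 t : 0 <= osc_norm mu (sham (X k (clamp t))).
  apply: (osc_norm_ge0 M_compact alpha_contact mu_volume); exact: (ham_slice cX (clamp_in t)).
have cq := osc_norm_continuous g M_compact M_hausdorff M_connected alpha_contact mu_volume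
      (G := fun t => sham (X k t)) (@ham_continuous _ _ _ _ _ _ cX k).
have iq : (\int[leb]_(t in `[0%R, 1%R]) (osc_norm mu (sham (X k (clamp t))))%:E < c1%:E)%E.
  apply: (@le_lt_trans _ _ (norm_1oo mu (fun t => sham (X k t)))).
    by apply: ge0_le_integral_nonmeasurable => t t01; [rewrite lee_fin|rewrite clamp_id].
  by apply: le_lt_trans (Hk k k2) _; rewrite vE -EFinD lte_fin /c1; lra.
have [e1 [s [e10 ss s0 s1 hs]]] := reparametrization cq q0 iq T0.
have sall t : 0 <= s t <= 1 by have [] := hs t.
have s01 t : s t \in `[0, 1] by rewrite in_itv/= sall.
have s00 : s 0 = 0 by apply: s0; lra.
have [F [sys F1 sm close ham]] := hN1 k T s e1 k1 T0 T1 ss sall s00 e10 s1.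
exists F; split=> //; split.
- apply: (@le_lt_trans _ _ (dbar g PhiH (id_isotopy R M) + 2 * c)); last by lra.
  apply: dbar_le => // t t01.
  (* The new isotopy at time [t] is compared with [PhiH] at time [s t], whose distance to the
     identity is bounded by the same maximum. *)
  have := dbar_ge g M_compact M_connected PhiH (id_isotopy R M) (s01 t).
  set a1 := dist_C0 g (fwd PhiH _) _; set a2 := dist_C0 g (bwd PhiH _) _ => ha.
  have h1 : dist_C0 g (fwd (path_isotopy F) t) (fwd (id_isotopy R M) t) <= a1 + c.
    apply: dist_C0_le => x /=; have [b1 _ _] := close t x t01.
    apply: le_trans (dist_triangle g M_connected _ (fwd PhiH (s t) x) _) _.
    have := dist_le_sym g M_connected (sfwd (F t) x) (fwd PhiH (s t) x).
    by have := dist_C0_ge g M_compact M_connected (fwd PhiH (s t)) (fun x => x) x; rewrite -/a1; lra.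
  have h2 : dist_C0 g (bwd (path_isotopy F) t) (bwd (id_isotopy R M) t) <= a2 + c.
    apply: dist_C0_le => x /=; have [_ b1 _] := close t x t01.
    apply: le_trans (dist_triangle g M_connected _ (bwd PhiH (s t) x) _) _.
    have := dist_le_sym g M_connected (sbwd (F t) x) (bwd PhiH (s t) x).
    by have := dist_C0_ge g M_compact M_connected (bwd PhiH (s t)) (fun x => x) x; rewrite -/a2; lra.
  by lra.
- apply: (@le_lt_trans _ _ (sup_norm h + c)); last by lra.
  have [Ch _ hCh] := continuous_family_bounded M_compact (limit_conf_continuous cX Xconf).
  apply: ge_sup; first by eexists; exists (0, point); [split=> //|reflexivity].
  move=> _ [[t x] [/= t01 _] <-]; have [_ _ b3] := close t x t01.
  have : `|h (s t) x| <= sup_norm h.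
    apply: ub_le_sup; last by exists (s t, x); [split=> //; exact: s01|].
    by exists Ch => _ [[u y] [/= u01 _] <-]; exact: hCh.
  have -> : sconf (F t) x = h (s t) x + (sconf (F t) x - h (s t) x) by ring.
  by move=> b4; apply: le_trans (ler_normD _ _) _; lra.
rewrite vE -EFinD lte_fin; apply: (@le_lt_trans _ _ (v + e / 2)); last by lra.
apply: ge_sup; first by eexists; exists 0; [exact: zero01|reflexivity].
move=> _ [t t01 <-]; have [h1 h2] := ham t t01.
have [tT|tT] := ltP t T; last by apply: le_trans (h2 tT) _; lra.
have [_ d0 hd] := hs t; rewrite (h1 tT).
apply: le_trans (osc_normZ M_compact alpha_contact mu_volume d0 (ham_slice cX (s01 t))) _.
by move: hd; rewrite clamp_id// subr0 cT /c1; lra.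
Qed.

End Alternatives.

Theorem lemma5p5 (R : realType) (n : nat) (M : ptopologicalType)
    (A : atlas R n.*2.+1 M) (alpha : one_form A) (g : riemannian A)
    (mu : {measure set (borel M) -> \bar R})
    (M_compact : compact [set: M]) (M_hausdorff : hausdorff_space M)
    (M_connected : connected [set: M])
    (alpha_contact : contact_form alpha) (mu_volume : volume_measure alpha mu)
    (PhiH : isotopy R M) (H h : R -> M -> R)
    (PhiH_top : topological_contact_system alpha g mu PhiH H h) :
  (exists (PhiF : isotopy R M) (F f : R -> M -> R),
    [/\ continuous_contact_system alpha g mu PhiF F f,
        forall x, fwd PhiF 1 x = fwd PhiH 1 x
      & smooth_before_one A PhiF F f]) /\
  forall eps : R, 0 < eps ->
    (exists (PhiF : isotopy R M) (F f : R -> M -> R),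
      [/\ continuous_contact_system alpha g mu PhiF F f,
          forall x, fwd PhiF 1 x = fwd PhiH 1 x,
          smooth_before_one A PhiF F f
        & [/\ dbar g PhiF PhiH < eps,
              sup_norm (fun t x => f t x - h t x) < eps
            & (norm_1oo mu (fun t x => F t x - H t x)%R < eps%:E)%E]]) /\
    (exists (PhiF : isotopy R M) (F f : R -> M -> R),
      [/\ continuous_contact_system alpha g mu PhiF F f,
          forall x, fwd PhiF 1 x = fwd PhiH 1 x,
          smooth_before_one A PhiF F f
        & [/\ dbar g PhiF (id_isotopy R M)
                < dbar g PhiH (id_isotopy R M) + eps,
              sup_norm f < sup_norm h + eps
            & ((norm_oo mu F)%:E < norm_1oo mu H + eps%:E)%E]]).
Proof.
have [cPhi HL1 [Phi_ [H_ [h_ [sys dbar0 conf0 ham0]]]]] := PhiH_top.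
pose X i t := Slice (fwd (Phi_ i) t) (bwd (Phi_ i) t) (H_ i t) (h_ i t).
have cX i : contact_path alpha (X i).
  by have [[? ? ? _] [? ?] [? ?]] := sys i; split.
have X0 i x : sfwd (X i 0) x = x by have [[_ _ _ h0] _ _] := sys i; exact: h0.
have near := alternative_near M_compact M_hausdorff M_connected alpha_contact mu_volume
  cPhi HL1 cX X0 dbar0 conf0 ham0.
have small := alternative_small M_compact M_hausdorff M_connected alpha_contact mu_volume
  cPhi HL1 cX X0 dbar0 conf0 ham0.
split.
  have [F [F1 F2 F3 _]] := near 1 ltr01.
  exists (path_isotopy F), (fun t => sham (F t)), (fun t => sconf (F t)).
  by split=> // x; rewrite /= F2.
move=> eps eps0; split.
  have [F [F1 F2 F3 F4]] := near eps eps0.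
  exists (path_isotopy F), (fun t => sham (F t)), (fun t => sconf (F t)).
  by split=> // x; rewrite /= F2.
have [F [F1 F2 F3 F4]] := small eps eps0.
exists (path_isotopy F), (fun t => sham (F t)), (fun t => sconf (F t)).
by split=> // x; rewrite /= F2.
Qed.
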